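(* Let $\Omega\subseteq\mathbb{R}^2$ be open, let $x_1,\ldots,x_N\in\Omega$ be distinct points and let $y_1,\ldots,y_N\in\mathbb{R}$. Let $p,q\in[1,\infty]$ and let $\lambda\in[0,2^{1/p-1}4\pi]$. Then there exists a minimizer in $L^1_{\mathrm{loc}}(\Omega)$ of the functional $\mathcal{F}^{p,q}_\lambda:L^1_{\mathrm{loc}}(\Omega)\to[0,\infty]$, $$\mathcal{F}^{p,q}_\lambda(f):=|\mathrm{D}^2_pf|(\Omega)+\lambda\,\big\Vert(f(x_i)-y_i)_{i=1,\ldots,N}\big\Vert_{\ell^q}.$$
   Context: Schatten norms: for $M\in\mathbb{R}^{2\times2}$ and $p\in[1,\infty]$, $|M|_p$ is the $\ell^p$ norm of the vector of singular values of $M$. Hessian--Schatten variation: for $p\in[1,\infty]$ with conjugate exponent $p^*$, $\Omega\subseteq\mathbb{R}^2$ open, $f\in L^1_{\mathrm{loc}}(\Omega)$ and $A\subseteq\Omega$ open, $$|\mathrm{D}^2_pf|(A):=\sup\Big\{\int_A\sum_{i,j=1}^2 f\,\partial_i\partial_jF_{i,j}\,d\mathscr{L}^2:\ F\in C_c^\infty(A)^{2\times2},\ \sup_{x}|F(x)|_{p^*}\le1\Big\}.$$ Convention on point values: in dimension $2$, any $f\in L^1_{\mathrm{loc}}(\Omega)$ with $|\mathrm{D}^2_pf|(\Omega)<\infty$ has a continuous representative, and $f(x_i)$ denotes the value of this representative; if $|\mathrm{D}^2_pf|(\Omega)=\infty$ then $\mathcal{F}^{p,q}_\lambda(f)=\infty$.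 Conventions: $1/\infty=0$. *)

(* Defs.v *)
From HB Require Import structures.
From mathcomp Require Import all_boot all_order all_algebra.
From mathcomp Require Import all_classical all_reals all_analysis.
From mathcomp Require Import ring lra.

Set Implicit Arguments.
Unset Strict Implicit.
Unset Printing Implicit Defensive.
Import Order.TTheory GRing.Theory Num.Theory.
Import numFieldNormedType.Exports.
Local Open Scope classical_set_scope.
Local Open Scope ring_scope.

(* Only 1 <= p <= +oo is meaningful; -oo gets the junk value of +oo. *)
Definition lpnorm (R : realType) (n : nat) (p : \bar R) (v : 'rV[R]_n) : R :=
  if p is r%:E then (\sum_i `|v 0 i| `^ r) `^ r^-1
  else \big[Order.max/0]_i `|v 0 i|.

(* The square roots of the eigenvalues of M^T M, counted with their
   algebraic multiplicities, in nonincreasing order. *)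
Definition is_singular_values (R : realType) (n : nat) (M : 'M[R]_n)
    (s : 'rV[R]_n) : Prop :=
  [/\ forall i, 0 <= s 0 i,
      forall i j : 'I_n, (i <= j)%N -> s 0 j <= s 0 i &
      char_poly (M^T *m M) = \prod_i ('X - ((s 0 i) ^+ 2)%:P)].

Definition singular_values (R : realType) (n : nat) (M : 'M[R]_n) : 'rV[R]_n :=
  xget 0 [set s | is_singular_values M s].

Lemma singular_valuesP (R : realType) (M : 'M[R]_2) :
  is_singular_values M (singular_values M).
Proof.
pose a := M 0 0; pose b := M 0 1; pose c := M 1 0; pose d := M 1 1.
pose T := a ^+ 2 + b ^+ 2 + c ^+ 2 + d ^+ 2.
pose D := (a * d - b * c) ^+ 2.
pose w := Num.sqrt (T ^+ 2 - 4 * D).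
have D0 : 0 <= D by exact: sqr_ge0.
have T0 : 0 <= T by rewrite !addr_ge0// sqr_ge0.
have dE : T ^+ 2 - 4 * D =
    (a ^+ 2 + c ^+ 2 - b ^+ 2 - d ^+ 2) ^+ 2 + 4 * (a * b + c * d) ^+ 2.
  by rewrite /T /D; ring.
have d0 : 0 <= T ^+ 2 - 4 * D.
  by rewrite dE addr_ge0 ?sqr_ge0// mulr_ge0// sqr_ge0.
have w2 : w ^+ 2 = T ^+ 2 - 4 * D by rewrite sqr_sqrtr.
have w0 : 0 <= w by exact: sqrtr_ge0.
have wT : w <= T by rewrite -(ler_pXn2r (n := 2))// w2; lra.
pose s : 'rV[R]_2 := \row_(i < 2)
  if i == 0 then Num.sqrt ((T + w) / 2) else Num.sqrt ((T - w) / 2).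
suff sP : is_singular_values M s by exact: (xgetI 0 sP).
split.
- by move=> i; rewrite mxE; case: ifP => _; exact: sqrtr_ge0.
- move=> i j; rewrite !mxE.
  case: i => -[|[|//]] ? ; case: j => -[|[|//]] ? //= _.
  by apply: ler_wsqrtr; lra.
- rewrite big_ord_recl big_ord1 !mxE /= !sqr_sqrtr; [|lra|lra].
  rewrite /char_poly (expand_det_row _ 0) big_ord_recl big_ord1.
  rewrite /cofactor !det_mx11 !mxE /= !big_ord_recl !big_ord0 !mxE /=.
  have -> : lift ord0 ord0 = 1 :> 'I_2 by exact/val_inj.
  have -> : ord0 = 0 :> 'I_2 by exact/val_inj.
  have E1 : lift 0 0 = 1 :> 'I_2 by exact/val_inj.
  have E0 : lift 1 0 = 0 :> 'I_2 by exact/val_inj.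
  rewrite ?E1 ?E0 -/a -/b -/c -/d !mulr1n !mulr0n !addr0 expr0 /bump /= expr1.
  rewrite mul1r.
  set u := (T + w) / 2; set v := (T - w) / 2.
  have uv : u * v = (a * a + c * c) * (b * b + d * d) -
      (a * b + c * d) * (b * a + d * c).
    have -> : u * v = (T ^+ 2 - w ^+ 2) / 4 by rewrite /u /v; field.
    by rewrite w2 /D; field.
  have u_v : u + v = (a * a + c * c) + (b * b + d * d).
    by rewrite /u /v /T; field.
  transitivity ('X ^+ 2 - (u + v)%:P * 'X + (u * v)%:P); last by rewrite (polyCD u v) (polyCM u v); ring.
  by rewrite uv u_v !(polyCB, polyCD, polyCM); ring.
Qed.

Definition schatten_norm (R : realType) (n : nat) (p : \bar R) (M : 'M[R]_n)
  : R := lpnorm p (singular_values M).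

Definition lebesgue2 (R : realType) :
    {measure set (measurableTypeR R * measurableTypeR R) -> \bar R} :=
  (@lebesgue_measure R \x @lebesgue_measure R)%E.

(* An element of the space L^1_loc(Omega) is represented by a total Borel
   function; only its values almost everywhere on Omega matter below. *)
Definition L1loc (R : realType) (Omega : set (R * R)) (f : R * R -> R) : Prop :=
  measurable_fun (Omega : set (measurableTypeR R * measurableTypeR R)) f /\
  forall K : set (R * R), compact K -> K `<=` Omega ->
    (\int[@lebesgue2 R]_(x in K) `|f x|%:E < +oo)%E.

Definition partial (R : realType) (i : 'I_2) (f : R * R -> R) : R * R -> R :=
  'D_(if i == 0 then (1, 0) else (0, 1)) f.

Definition has_partial (R : realType) (i : 'I_2) (f : R * R -> R) : Prop :=
  forall x, derivable f x (if i == 0 then (1, 0) else (0, 1)).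

(* All iterated partial derivatives exist and are continuous. *)
Definition smooth (R : realType) (f : R * R -> R) : Prop :=
  forall s : seq 'I_2, continuous (foldr (@partial R) f s) /\
    forall i, has_partial i (foldr (@partial R) f s).

(* Fields in C_c^oo(A)^{2x2}, extended by zero to the whole plane. *)
Definition test_field (R : realType) (A : set (R * R)) (F : R * R -> 'M[R]_2)
    : Prop :=
  [/\ forall i j, smooth (fun x => F x i j),
      compact (closure [set x | F x != 0]) &
      closure [set x | F x != 0] `<=` A].

Definition hessian_schatten_variation (R : realType) (p : \bar R)
    (f : R * R -> R) (A : set (R * R)) : \bar R :=
  ereal_sup [set (\int[@lebesgue2 R]_(x in A)
      (\sum_(i < 2) \sum_(j < 2)
         f x * partial i (partial j (fun z => F z i j)) x)%:E)%E |
    F in [set F : R * R -> 'M[R]_2 | test_field A F /\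
      forall x, schatten_norm (hoelder_conjugate p) (F x) <= 1]].

Definition is_continuous_representative (R : realType) (Omega : set (R * R))
    (f g : R * R -> R) : Prop :=
  {in Omega, continuous g} /\ {ae @lebesgue2 R, forall x, Omega x -> g x = f x}.

(* Its values on an open Omega do not depend on the choice made by xget; the
   default f is returned when there is no continuous representative. *)
Definition continuous_representative (R : realType) (Omega : set (R * R))
    (f : R * R -> R) : R * R -> R :=
  xget f [set g | is_continuous_representative Omega f g].

Definition functionalF (R : realType) (p q : \bar R) (lambda : R)
    (Omega : set (R * R)) (N : nat) (x : 'I_N -> R * R) (y : 'I_N -> R)
    (f : R * R -> R) : \bar R :=
  let V := hessian_schatten_variation p f Omega in
  if V == +oo%E then +oo%E else
  (V + (lambda * lpnorm q
     (\row_i (continuous_representative Omega f (x i) - y i)))%:E)%E.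

(* Main.v *)
(* For y in the plane and e > 0 the matrix field
   K_{y,e}(z) = [[u^2-v^2, 2uv], [2uv, v^2-u^2]] / (u^2+v^2+e^2), (u,v) = z - y,
   has both singular values at most 1, and its double divergence
   8 e^4 / (u^2+v^2+e^2)^3 is an approximate identity of mass 4 pi. Testing
   against cut-offs of K_{y,e} therefore gives point values as e -> 0. They
   depend continuously on y because a Hessian measure has no atoms, they
   coincide a.e. with the function, and they differ from a smoothly mollified
   function with bounded second derivatives, hence from an affine function, by
   at most a multiple of the variation.

   A minimising sequence is normalised by subtracting locally affine functions
   that vanish at the x_i, and an ultrafilter limit of the associated functionals
   on C_c is again given by a continuous function f. Point values need not
   converge to those of f. But a test field for f may be set to zero near each
   x_i and replaced there by 2^(1/p-1) s_i K_{x_i,e} with s_i = +-1, which shows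
   that a jump t_i of the value at x_i in the limit costs at least
   2^(1/p-1) 4 pi |t_i| of the variation, and by the assumption on lambda this
   pays for the change of the fidelity term. *)
Require Import Defs.
From HB Require Import structures.
From mathcomp Require Import all_boot all_order all_algebra.
From mathcomp Require Import all_classical all_reals all_analysis.
From mathcomp Require Import measurable_realfun.
From mathcomp Require Import ring lra.
Set Implicit Arguments.
Unset Strict Implicit.
Unset Printing Implicit Defensive.
Import Order.TTheory GRing.Theory Num.Theory.
Import numFieldNormedType.Exports.
Local Open Scope classical_set_scope.
Local Open Scope ring_scope.

(** Point evaluation is not continuous along a minimising sequence: a cone of fixed height over a
    shrinking disc tends to 0 in L^1, while its peak and, by scaling, its variation stay the same.
    The fidelity term alone can therefore jump upwards in the limit, and only the sum of both terms
    can be lower semicontinuous. For e = 0 the kernel is 2 w w^T - Id with w = (z - y)/|z - y|, the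
    reflection that fixes the radial direction. Its row-wise divergence is the gradient of log |z -
    y|^2, whose divergence is 4 pi times the Dirac mass at y. As both singular values are 1, its
    Schatten norm for the exponent conjugate to p is 2^(1-1/p); the weight 2^(1/p-1) normalises it,
    and the bound on lambda is this weight times 4 pi. Functions and their limits are treated alike,
    as linear forms on C_c bounded on compact sets, with the Hessian seen only through its pairing
    with test fields. Since Omega may be disconnected and a component may contain too few of the x_i
    to determine an affine function, the functions that are subtracted are only locally affine, and
    what they must achieve is boundedness in n near each point. *)

(* Opaque names for the two indices: comparing the numerals 0 and 1 of 'I_2
   during unification is very slow. *)
Definition o0 : 'I_2 := 0.
Definition o1 : 'I_2 := 1.

Lemma o01 : (o0 == o1) = false. Proof. by []. Qed.
Lemma o10 : (o1 == o0) = false. Proof. by []. Qed.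
Definition ordE := (o01, o10, eqxx).

(** * Smooth functions on the plane *)

Section smooth_functions.
Context {R : realType}.
Local Notation T2 := (R * R)%type.
Implicit Types (f g : T2 -> R) (z : T2) (i : 'I_2).

Definition edir i : T2 := if i == 0 then (1, 0) else (0, 1).

Lemma partialE i f z : partial i f z = 'D_(edir i) f z. Proof. by []. Qed.
Lemma edir0 : edir o0 = (1, 0). Proof. by []. Qed.
Lemma edir1 : edir o1 = (0, 1). Proof. by []. Qed.

Lemma ord2_ind (P : 'I_2 -> Prop) : P o0 -> P o1 -> forall i, P i.
Proof.
move=> P0 P1 [[|[|//]] h].
  by have -> : Ordinal h = o0 by exact: val_inj.
by have -> : Ordinal h = o1 by exact: val_inj.
Qed.

Lemma quotient_fst f z :
  (fun h : R => h^-1 *: (f (h *: (1, 0) + z) - f z)) =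
  (fun h : R => h^-1 *: (f (h *: 1 + z.1, z.2) - f (z.1, z.2))).
Proof.
case: z => z1 z2; apply: funext => h /=; congr (_ *: (f _ - _)).
rewrite /GRing.scale/= /GRing.add /= /add_pair /=.
by rewrite /scale_pair /= /GRing.scale /= mulr0 add0r.
Qed.

Lemma quotient_snd f z :
  (fun h : R => h^-1 *: (f (h *: (0, 1) + z) - f z)) =
  (fun h : R => h^-1 *: (f (z.1, h *: 1 + z.2) - f (z.1, z.2))).
Proof.
case: z => z1 z2; apply: funext => h /=; congr (_ *: (f _ - _)).
rewrite /GRing.scale/= /GRing.add /= /add_pair /=.
by rewrite /scale_pair /= /GRing.scale /= mulr0 add0r.
Qed.

Lemma is_derive_fst f z d :
  is_derive z.1 1 (fun t => f (t, z.2)) d -> is_derive z (edir o0) f d.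
Proof.
case=> h1 h2; split.
  by move: h1; rewrite /derivable/= quotient_fst.
by rewrite -h2 /derive/= quotient_fst.
Qed.

Lemma is_derive_snd f z d :
  is_derive z.2 1 (fun t => f (z.1, t)) d -> is_derive z (edir o1) f d.
Proof.
case=> h1 h2; split.
  by move: h1; rewrite /derivable/= quotient_snd.
by rewrite -h2 /derive/= quotient_snd.
Qed.

Lemma derivable_slice_fst f z :
  derivable f z (edir o0) -> is_derive z.1 1 (fun t => f (t, z.2)) (partial o0 f z).
Proof.
rewrite /partial/= => h; split.
  by move: h; rewrite /derivable/= quotient_fst.
by rewrite /derive/= quotient_fst.
Qed.

Lemma derivable_slice_snd f z :
  derivable f z (edir o1) -> is_derive z.2 1 (fun t => f (z.1, t)) (partial o1 f z).
Proof.
rewrite /partial/= => h; split.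
  by move: h; rewrite /derivable/= quotient_snd.
by rewrite /derive/= quotient_snd.
Qed.

Lemma is_derive_partial i f z d : is_derive z (edir i) f d -> partial i f z = d.
Proof. by case=> _ <-. Qed.

Section is_derive_lambda.
Context {V : normedModType R}.
Implicit Types (u w : V -> R) (x v : V).

Lemma isdM u w x v du dw : is_derive x v u du -> is_derive x v w dw ->
  is_derive x v (fun t => u t * w t) (u x * dw + w x * du).
Proof. exact: is_deriveM. Qed.

Lemma isdD u w x v du dw : is_derive x v u du -> is_derive x v w dw ->
  is_derive x v (fun t => u t + w t) (du + dw).
Proof. exact: is_deriveD. Qed.

Lemma isdN u x v du : is_derive x v u du -> is_derive x v (fun t => - u t) (- du).
Proof. exact: is_deriveN. Qed.

Lemma isdB u w x v du dw : is_derive x v u du -> is_derive x v w dw ->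
  is_derive x v (fun t => u t - w t) (du - dw).
Proof. exact: is_deriveB. Qed.

Lemma isdX u n x v du : is_derive x v u du ->
  is_derive x v (fun t => u t ^+ n) (n%:R * u x ^+ n.-1 * du).
Proof.
move=> h; have := @is_deriveX _ _ u n x v _ h.
by rewrite exprfctE.
Qed.

Lemma isdV u x v du : u x != 0 -> is_derive x v u du ->
  is_derive x v (fun t => (u t)^-1) (- (u x)^-1 ^+ 2 * du).
Proof.
move=> u0 [h1 h2]; split; first exact: derivableV.
by rewrite deriveV// h2 exprVn.
Qed.

Lemma isdC (a : R) x v : is_derive x v (fun=> a) 0.
Proof. exact: is_derive_cst. Qed.

End is_derive_lambda.

(** The index makes the family stable under differentiation: [flat n] has derivative
    [flat n.+2 - n * flat n.+1], so one statement on first derivatives yields smoothness of all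
    members. *)
Definition flat n (t : R) : R := if 0 < t then t^-1 ^+ n * expR (- t^-1) else 0.

(** With u = 1/t, raising e^(u/(n+1)) >= u/(n+1) to the power n+1 gives e^u >= (u/(n+1))^(n+1). The
    factor t on the right makes the difference quotients of [flat] at 0 tend to 0. *)
Lemma flat_le n (t : R) : 0 < t -> t^-1 ^+ n * expR (- t^-1) <= n.+1%:R ^+ n.+1 * t.
Proof.
move=> t0; set u := t^-1; have u0 : 0 < u by rewrite invr_gt0.
have h : (u / n.+1%:R) ^+ n.+1 <= expR u.
  have -> : expR u = expR (u / n.+1%:R) ^+ n.+1.
    by rewrite -expRM_natl -mulr_natl mulrC divfK// pnatr_eq0.
  apply: lerXn2r; rewrite ?nnegrE ?expR_ge0 ?divr_ge0 ?(ltW u0)//.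
  by apply: le_trans (expR_ge1Dx _); rewrite lerDr.
rewrite expRN ler_pdivrMr ?expR_gt0//.
have -> : u ^+ n = n.+1%:R ^+ n.+1 * t * (u / n.+1%:R) ^+ n.+1.
  rewrite expr_div_n; set c := _ ^+ n.+1; have c0 : c != 0.
    by rewrite expf_neq0// pnatr_eq0.
  rewrite mulrCA -mulrA [c * _]mulrCA mulrA.
  by rewrite -[t]invrK -/u exprS; field; rewrite c0 gt_eqF.
by apply: ler_wpM2l => //; rewrite mulr_ge0 ?(ltW t0)// exprn_ge0.
Qed.

Lemma is_derive_flat n (t : R) :
  is_derive t 1 (flat n) (flat n.+2 t - n%:R * flat n.+1 t).
Proof.
have [t0|t0|->] := ltgtP t 0.
- have ne : \forall s \near t, cst 0 s = flat n s.
    near=> s; rewrite /flat /= ltNge (_ : s <= 0)//.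
    by apply/ltW; near: s; exact: lt_nbhsl.
  apply: (near_eq_is_derive ne).
  rewrite /flat !ltNge (ltW t0) /= mulr0 subr0; exact: is_derive_cst.
- have ne : \forall s \near t, (fun s => s^-1 ^+ n * expR (- s^-1)) s = flat n s.
    near=> s; rewrite /flat /= (_ : 0 < s)//.
    by near: s; exact: lt_nbhsr.
  apply: (near_eq_is_derive ne).
  rewrite /flat t0.
  have di := isdV (lt0r_neq0 t0) (is_derive_id t (1 : R)).
  have dE := @is_derive1_comp _ expR _ t _ _ (is_derive_expR _) (isdN di).
  apply: is_derive_eq (isdM (isdX n di) dE) _.
  by case: n {ne} => [|n] /=; rewrite ?exprS; ring.
- rewrite /flat ltxx mulr0 subr0.
  suff h : (fun h : R => h^-1 *: ((flat n (h *: 1 + 0)) - flat n 0)) @ 0^' --> (0 : R).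
    split; first by apply/cvg_ex; exists 0.
    exact: cvg_lim h.
  apply/cvgrPdist_le => /= e e0; near=> h.
  rewrite sub0r normrN /GRing.scale /= mulr1 addr0 {2}/flat ltxx subr0.
  have h0 : h != 0 by near: h; exact: nbhs_dnbhs_neq.
  have [hp|hn] := ltP 0 h; last by rewrite /flat ltNge hn /= mulr0 normr0 ltW.
  rewrite /flat hp mulrA -exprS ger0_norm ?mulr_ge0 ?expR_ge0 ?exprn_ge0 ?invr_ge0 ?(ltW hp)//.
  apply: le_trans (flat_le n.+1 hp) _.
  rewrite -ler_pdivlMl ?exprn_gt0 ?ltr0n//.
  apply: le_trans (ler_norm _) _; near: h.
  apply: dnbhs0_le; rewrite mulr_gt0// invr_gt0 exprn_gt0 ?ltr0n//.
Unshelve. all: by end_near. Qed.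



Lemma smooth_continuous f : smooth f -> continuous f.
Proof. by move=> sf; have [] := sf [::]. Qed.

Lemma smooth_has_partial i f : smooth f -> has_partial i f.
Proof. by move=> sf; have [_ h] := sf [::]; exact: h. Qed.

Lemma smooth_partial i f : smooth f -> smooth (partial i f).
Proof.
move=> sf s; have := sf (rcons s i); rewrite foldr_rcons.
exact.
Qed.

Lemma smooth_is_derive i f z : smooth f -> is_derive z (edir i) f (partial i f z).
Proof. by move=> sf; apply: DeriveDef => //; exact: smooth_has_partial. Qed.

(** [smooth] speaks of all iterated partial derivatives, so membership in a class of continuous
    functions that is stable under partial derivatives suffices, by induction on the list of
    directions. *)
Lemma smooth_coind (P : (T2 -> R) -> Prop) :
  (forall f, P f -> continuous f /\ forall i, has_partial i f /\ P (partial i f)) ->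
  forall f, P f -> smooth f.
Proof.
move=> HP f Pf s.
suff : P (foldr (@partial R) f s) by move=> /HP [? h]; split=> // i; have [] := h i.
by elim: s => //= i s /HP [_ /(_ i) []].
Qed.

(** A class stable under partial derivatives, made for [smooth_coind]. Stability of smoothness under
    sums, products, inverses and composition with [flat] follows at once from first derivatives. *)
Inductive smooth_expr : (T2 -> R) -> Prop :=
| SE_smooth f : smooth f -> smooth_expr f
| SE_cst (c : R) : smooth_expr (fun=> c)
| SE_fst : smooth_expr fst
| SE_snd : smooth_expr snd
| SE_flat n f : smooth_expr f -> smooth_expr (fun z => flat n (f z))
| SE_add f g : smooth_expr f -> smooth_expr g -> smooth_expr (fun z => f z + g z)
| SE_mul f g : smooth_expr f -> smooth_expr g -> smooth_expr (fun z => f z * g z)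
| SE_inv f : (forall z, f z != 0) -> smooth_expr f -> smooth_expr (fun z => (f z)^-1).

Lemma flat_continuous n : continuous (flat n).
Proof.
move=> t; apply/differentiable_continuous/derivable1_diffP.
by case: (is_derive_flat n t).
Qed.

Lemma isd_comp (phi : R -> R) f z i (a b : R) :
  is_derive (f z) 1 phi a -> is_derive z (edir i) f b ->
  is_derive z (edir i) (fun z => phi (f z)) (a * b).
Proof.
move: i; elim/ord2_ind => ha hb.
  apply: is_derive_fst.
  case: hb => hb1 hb2; have := derivable_slice_fst hb1; rewrite partialE hb2 => hb.
  by case: z ha hb hb1 hb2 => z1 z2 ha hb _ _; exact: (@is_derive1_comp _ phi (fun t => f (t, z2))).
apply: is_derive_snd.
case: hb => hb1 hb2; have := derivable_slice_snd hb1; rewrite partialE hb2 => hb.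
by case: z ha hb hb1 hb2 => z1 z2 ha hb _ _; exact: (@is_derive1_comp _ phi (fun t => f (z1, t))).
Qed.

Lemma isd_fst i z : is_derive z (edir i) fst ((i == o0)%:R).
Proof.
move: i; elim/ord2_ind.
  by apply: is_derive_fst; exact: is_derive_id.
by apply: is_derive_snd; exact: is_derive_cst.
Qed.

Lemma isd_snd i z : is_derive z (edir i) snd ((i == o1)%:R).
Proof.
move: i; elim/ord2_ind.
  by apply: is_derive_fst; exact: is_derive_cst.
by apply: is_derive_snd; exact: is_derive_id.
Qed.

Lemma smooth_exprP f : smooth_expr f -> continuous f /\
  forall i, exists f', smooth_expr f' /\ forall z, is_derive z (edir i) f (f' z).
Proof.
elim=> {f} [f sf|c|||n f sf [cf IH]|f g sf [cf IHf] sg [cg IHg]|f g sf [cf IHf] sg [cg IHg]|f f0 sf [cf IH]].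
- split; first exact: smooth_continuous.
  move=> i; exists (partial i f); split; first by apply/SE_smooth/smooth_partial.
  by move=> z; exact: smooth_is_derive.
- split; first exact: cst_continuous.
  by move=> i; exists (fun=> 0); split; [exact: SE_cst|move=> z; exact: isdC].
- split; first by move=> z; exact: cvg_fst.
  by move=> i; exists (fun=> (i == o0)%:R); split; [exact: SE_cst|move=> z; exact: isd_fst].
- split; first by move=> z; exact: cvg_snd.
  by move=> i; exists (fun=> (i == o1)%:R); split; [exact: SE_cst|move=> z; exact: isd_snd].
- split.
    by move=> z; apply: continuous_comp; [exact: cf|exact: flat_continuous].
  move=> i; have [f' [sf' h]] := IH i.
  exists (fun z => (flat n.+2 (f z) + (- n%:R) * flat n.+1 (f z)) * f' z); split.
    apply: SE_mul => //; apply: SE_add; first exact: SE_flat.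
    by apply: SE_mul; [exact: SE_cst|exact: SE_flat].
  move=> z; rewrite mulNr; apply: isd_comp (h z).
  exact: is_derive_flat.
- split; first by move=> z; apply: cvgD; [exact: cf|exact: cg].
  move=> i; have [f' [sf' hf]] := IHf i; have [g' [sg' hg]] := IHg i.
  exists (fun z => f' z + g' z); split; first exact: SE_add.
  by move=> z; exact: isdD.
- split; first by move=> z; apply: cvgM; [exact: cf|exact: cg].
  move=> i; have [f' [sf' hf]] := IHf i; have [g' [sg' hg]] := IHg i.
  exists (fun z => f z * g' z + g z * f' z); split.
    by apply: SE_add; exact: SE_mul.
  by move=> z; exact: isdM.
- split; first by move=> z; apply: cvgV; [exact: f0|exact: cf].
  move=> i; have [f' [sf' hf]] := IH i.
  exists (fun z => - 1 * ((f z)^-1 * (f z)^-1 * f' z)); split.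
    by do !(apply: SE_mul => //; try exact: SE_inv); exact: SE_cst.
  move=> z; apply: is_derive_eq (isdV (f0 z) (hf z)) _.
  by rewrite expr2; ring.
Qed.

Lemma smooth_expr_smooth f : smooth_expr f -> smooth f.
Proof.
apply: smooth_coind => {}f /smooth_exprP [cf H]; split=> // i.
have [f' [sf' h]] := H i; split; first by move=> z; have [] := h z.
suff -> : partial i f = f' by [].
by apply: funext => z; exact: is_derive_partial.
Qed.

Lemma smooth_cst (c : R) : smooth (fun=> c).
Proof. exact/smooth_expr_smooth/SE_cst. Qed.

Lemma smooth_fst : smooth (@fst R R).
Proof. exact/smooth_expr_smooth/SE_fst. Qed.

Lemma smooth_snd : smooth (@snd R R).
Proof. exact/smooth_expr_smooth/SE_snd. Qed.

Lemma smoothD f g : smooth f -> smooth g -> smooth (fun z => f z + g z).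
Proof. by move=> sf sg; apply/smooth_expr_smooth/SE_add; exact: SE_smooth. Qed.

Lemma smoothM f g : smooth f -> smooth g -> smooth (fun z => f z * g z).
Proof. by move=> sf sg; apply/smooth_expr_smooth/SE_mul; exact: SE_smooth. Qed.

Lemma smoothN f : smooth f -> smooth (fun z => - f z).
Proof.
move=> sf; rewrite (_ : (fun z => - f z) = fun z => - 1 * f z).
  exact: smoothM (smooth_cst _) sf.
by apply: funext => z; rewrite mulN1r.
Qed.

Lemma smoothB f g : smooth f -> smooth g -> smooth (fun z => f z - g z).
Proof. by move=> sf sg; exact: smoothD sf (smoothN sg). Qed.

Lemma smoothV f : (forall z, f z != 0) -> smooth f -> smooth (fun z => (f z)^-1).
Proof. by move=> f0 sf; apply/smooth_expr_smooth/SE_inv => //; exact: SE_smooth. Qed.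

Lemma smoothX n f : smooth f -> smooth (fun z => f z ^+ n).
Proof.
move=> sf; elim: n => [|n IH].
  by rewrite (_ : (fun z => _) = fun=> 1); [exact: smooth_cst|apply: funext].
rewrite (_ : (fun z => _) = fun z => f z * f z ^+ n); first exact: smoothM.
by apply: funext => z; rewrite exprS.
Qed.

Lemma smooth_flat n f : smooth f -> smooth (fun z => flat n (f z)).
Proof. by move=> sf; apply/smooth_expr_smooth/SE_flat; exact: SE_smooth. Qed.

Lemma partialD i f g : smooth f -> smooth g ->
  partial i (fun z => f z + g z) = fun z => partial i f z + partial i g z.
Proof.
move=> sf sg; apply: funext => z; apply: is_derive_partial.
by apply: isdD; exact: smooth_is_derive.
Qed.

Lemma partialB i f g : smooth f -> smooth g ->
  partial i (fun z => f z - g z) = fun z => partial i f z - partial i g z.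
Proof.
move=> sf sg; apply: funext => z; apply: is_derive_partial.
by apply: isdB; exact: smooth_is_derive.
Qed.

Lemma partialN i f : smooth f ->
  partial i (fun z => - f z) = fun z => - partial i f z.
Proof.
move=> sf; apply: funext => z; apply: is_derive_partial.
by apply: isdN; exact: smooth_is_derive.
Qed.

Lemma partialM i f g : smooth f -> smooth g ->
  partial i (fun z => f z * g z) = fun z => f z * partial i g z + partial i f z * g z.
Proof.
move=> sf sg; apply: funext => z; apply: is_derive_partial.
rewrite [partial i f z * _]mulrC.
by apply: isdM; exact: smooth_is_derive.
Qed.

Lemma partial_cst i (c : R) : partial i (fun=> c) = fun=> 0.
Proof. by apply: funext => z; apply: is_derive_partial; exact: isdC. Qed.

Lemma partialZ i (c : R) f : smooth f ->
  partial i (fun z => c * f z) = fun z => c * partial i f z.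
Proof.
move=> sf; rewrite (partialM _ (smooth_cst _) sf).
by rewrite partial_cst; apply: funext => z; rewrite mul0r addr0.
Qed.

Lemma partial_fst i : partial i (@fst R R) = fun=> (i == o0)%:R.
Proof. by apply: funext => z; apply: is_derive_partial; exact: isd_fst. Qed.

Lemma partial_snd i : partial i (@snd R R) = fun=> (i == o1)%:R.
Proof. by apply: funext => z; apply: is_derive_partial; exact: isd_snd. Qed.

End smooth_functions.

Global Opaque o0 o1.

(** * Smooth cut-offs and closed squares *)

Section cutoffs.
Context {R : realType}.
Local Notation T2 := (R * R)%type.
Implicit Types (f g : T2 -> R) (z x y : T2) (i : 'I_2) (r t : R).

Lemma flat_ge0 n t : 0 <= flat n t.
Proof.
rewrite /flat; case: ifPn => // t0.
by rewrite mulr_ge0 ?expR_ge0 ?exprn_ge0 ?invr_ge0 ?ltW.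
Qed.

Lemma flat0_gt0 t : 0 < t -> 0 < flat 0 t.
Proof. by move=> t0; rewrite /flat t0 expr0 mul1r expR_gt0. Qed.

Lemma flat_le0 n t : t <= 0 -> flat n t = 0.
Proof. by rewrite /flat ltNge => ->. Qed.

Definition step t := flat 0 t * (flat 0 t + flat 0 (1 - t))^-1.

Lemma step_den t : flat 0 t + flat 0 (1 - t) != 0.
Proof.
rewrite lt0r_neq0//; have [t0|t0] := leP t 0.
  by rewrite ltr_wpDl ?flat_ge0// flat0_gt0//; lra.
by rewrite ltr_pwDl ?flat_ge0// flat0_gt0.
Qed.

Lemma step_ge0 t : 0 <= step t.
Proof. by rewrite mulr_ge0 ?invr_ge0 ?addr_ge0 ?flat_ge0. Qed.

Lemma step_le1 t : step t <= 1.
Proof.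
rewrite ler_pdivrMr; first by rewrite mul1r lerDl flat_ge0.
by rewrite lt_neqAle eq_sym step_den addr_ge0 ?flat_ge0.
Qed.

Lemma step_eq1 t : 1 <= t -> step t = 1.
Proof.
move=> t1; have := step_den t.
by rewrite /step (@flat_le0 0 (1 - t)) ?subr_le0// addr0 => h; rewrite divff.
Qed.

Lemma step_eq0 t : t <= 0 -> step t = 0.
Proof. by move=> t0; rewrite /step flat_le0// mul0r. Qed.

Definition bump t := step (2 + t) * step (2 - t).

Lemma bump_ge0 t : 0 <= bump t. Proof. by rewrite mulr_ge0 ?step_ge0. Qed.

Lemma bump_le1 t : bump t <= 1.
Proof. by rewrite mulr_ile1 ?step_ge0 ?step_le1. Qed.

Lemma bump_eq1 t : `|t| <= 1 -> bump t = 1.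
Proof. by rewrite ler_norml => /andP[? ?]; rewrite /bump !step_eq1 ?mulr1//; lra. Qed.

Lemma bump_eq0 t : 2 <= `|t| -> bump t = 0.
Proof.
rewrite ler_normr => /orP[] h; rewrite /bump.
  by rewrite [step (2 - t)]step_eq0 ?mulr0//; lra.
by rewrite [step (2 + t)]step_eq0 ?mul0r//; lra.
Qed.

Lemma smooth_step f : smooth f -> smooth (fun z => step (f z)).
Proof.
move=> sf; have h : smooth (fun z => 1 - f z) by exact: smoothB (smooth_cst _) sf.
apply: smoothM; first exact: smooth_flat.
apply: smoothV; first by move=> z; exact: step_den.
by apply: smoothD; exact: smooth_flat.
Qed.

Lemma smooth_bump f : smooth f -> smooth (fun z => bump (f z)).
Proof.
move=> sf; apply: smoothM; apply: smooth_step.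
  exact: smoothD (smooth_cst _) sf.
exact: smoothB (smooth_cst _) sf.
Qed.

Definition bump1 x r z := bump ((z.1 - x.1) / r).
Definition bump2 x r z := bump ((z.2 - x.2) / r).
(** A tensor product, equal to 1 on a square of radius r and to 0 off the square of radius 2r. Each
    factor depends on one variable only, which is what [partial_sep] exploits. *)
Definition cut x r z := bump1 x r z * bump2 x r z.

Lemma smooth_bump1 x r : smooth (bump1 x r).
Proof.
apply: smooth_bump; apply: smoothM; last exact: smooth_cst.
by apply: smoothB; [exact: smooth_fst|exact: smooth_cst].
Qed.

Lemma smooth_bump2 x r : smooth (bump2 x r).
Proof.
apply: smooth_bump; apply: smoothM; last exact: smooth_cst.
by apply: smoothB; [exact: smooth_snd|exact: smooth_cst].
Qed.

Lemma smooth_cut x r : smooth (cut x r).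
Proof. by apply: smoothM; [exact: smooth_bump1|exact: smooth_bump2]. Qed.

Lemma cut_ge0 x r z : 0 <= cut x r z.
Proof. by rewrite mulr_ge0 ?bump_ge0. Qed.

Lemma cut_le1 x r z : cut x r z <= 1.
Proof. by rewrite mulr_ile1 ?bump_ge0 ?bump_le1. Qed.

Definition sq x r : set T2 := [set z | `|z.1 - x.1| <= r /\ `|z.2 - x.2| <= r].

Lemma sq_center x r : 0 <= r -> sq x r x.
Proof. by move=> r0; split; rewrite subrr normr0. Qed.

Lemma sqS x r t : r <= t -> sq x r `<=` sq x t.
Proof. by move=> rt z [h1 h2]; split; [exact: le_trans h1 _|exact: le_trans h2 _]. Qed.

Lemma sq_trans x y r t z : sq x r y -> sq y t z -> sq x (r + t) z.
Proof.
move=> [h1 h2] [h3 h4]; split.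
  by rewrite (_ : z.1 - x.1 = (y.1 - x.1) + (z.1 - y.1)); [apply: le_trans (ler_normD _ _) _; lra|ring].
by rewrite (_ : z.2 - x.2 = (y.2 - x.2) + (z.2 - y.2)); [apply: le_trans (ler_normD _ _) _; lra|ring].
Qed.

Lemma sq_sym x y r : sq x r y -> sq y r x.
Proof. by move=> [h1 h2]; split; rewrite distrC. Qed.

Lemma sqE x r : sq x r = (`[x.1 - r, x.1 + r]%classic `*` `[x.2 - r, x.2 + r]%classic).
Proof.
apply/seteqP; split => [z [h1 h2]|z [/= h1 h2]]; split => /=;
 move: h1 h2; rewrite ?in_itv/= !ler_distl//.
Qed.

Lemma sq_compact x r : compact (sq x r).
Proof. by rewrite sqE; apply: compact_setX; exact: segment_compact. Qed.

Lemma sq_nbhs x r : 0 < r -> nbhs x (sq x r).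
Proof.
move=> r0; apply/nbhs_ballP; exists r => //= z [/= h1 h2].
by split; rewrite distrC ltW.
Qed.

Lemma nbhs_sq x (A : set T2) : nbhs x A -> exists r, 0 < r /\ sq x r `<=` A.
Proof.
move=> /nbhs_ballP [r /= r0 h]; exists (r / 2); split; first by rewrite divr_gt0.
move=> z [h1 h2]; apply: h; split => /=; rewrite /ball /= distrC;
 [apply: le_lt_trans h1 _|apply: le_lt_trans h2 _]; lra.
Qed.

Lemma compact_closedT2 (K : set T2) : compact K -> closed K.
Proof. by apply: compact_closed; exact: norm_hausdorff. Qed.

Lemma sq_closed x r : closed (sq x r).
Proof. by apply: compact_closedT2; exact: sq_compact. Qed.

Lemma cut_eq1 x r z : 0 < r -> sq x r z -> cut x r z = 1.
Proof.
move=> r0 [h1 h2]; rewrite /cut /bump1 /bump2 !bump_eq1 ?mulr1//;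
 by rewrite normrM normfV (gtr0_norm r0) ler_pdivrMr// mul1r.
Qed.

Lemma cut_eq0 x r z : 0 < r -> ~ sq x (2 * r) z -> cut x r z = 0.
Proof.
move=> r0 h; rewrite /cut /bump1 /bump2.
have [h1|h1] := leP `|z.1 - x.1| (2 * r); last first.
  rewrite bump_eq0 ?mul0r// normrM normfV (gtr0_norm r0) ler_pdivlMr//; exact: ltW.
have [h2|h2] := leP `|z.2 - x.2| (2 * r); first by case: h.
rewrite [bump ((z.2 - _) / _)]bump_eq0 ?mulr0// normrM normfV (gtr0_norm r0) ler_pdivlMr//; exact: ltW.
Qed.

Lemma onem_cut_norm x r z : `|1 - cut x r z| <= 1.
Proof. by rewrite ger0_norm ?subr_ge0 ?cut_le1// lerBlDr lerDl cut_ge0. Qed.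

Lemma cut_norm x r z : `|cut x r z| <= 1.
Proof. by rewrite ger0_norm ?cut_ge0// cut_le1. Qed.

Lemma partial_near i f g z : (\near z, f z = g z) -> partial i f z = partial i g z.
Proof. exact: near_eq_derive. Qed.

Lemma partial_off i f (K : set T2) : closed K -> (forall z, ~ K z -> f z = 0) ->
  forall z, ~ K z -> partial i f z = 0.
Proof.
move=> cK h z nK; rewrite (_ : 0 = partial i (fun=> 0 : R) z); last by rewrite partial_cst.
apply: partial_near; have := closed_openC cK; rewrite openE => /(_ z nK).
by apply: filterS => w /h.
Qed.

Lemma partial1_indep f : (forall z t, f (z.1, t) = f z) -> partial o1 f = fun=> 0.
Proof.
move=> h; apply: funext => z; apply: is_derive_partial; apply: is_derive_snd.
rewrite (_ : (fun t => _) = fun=> f z); first exact: is_derive_cst.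
by apply: funext => t.
Qed.

Lemma partial0_indep f : (forall z t, f (t, z.2) = f z) -> partial o0 f = fun=> 0.
Proof.
move=> h; apply: funext => z; apply: is_derive_partial; apply: is_derive_fst.
rewrite (_ : (fun t => _) = fun=> f z); first exact: is_derive_cst.
by apply: funext => t.
Qed.

Lemma partial0_slice f z : partial o0 f z = 'D_1 (fun t => f (t, z.2)) z.1.
Proof. by rewrite partialE edir0 /derive /= quotient_fst. Qed.

Lemma partial1_slice f z : partial o1 f z = 'D_1 (fun t => f (z.1, t)) z.2.
Proof. by rewrite partialE edir1 /derive /= quotient_snd. Qed.

Lemma partial_translate i f x : partial i (fun z => f (z - x)) = fun z => partial i f (z - x).
Proof.
apply: funext => z; rewrite /partial /derive.
suff -> : (fun h : R => h^-1 *: (f (h *: (if i == 0 then (1, 0) else (0, 1)) + z - x) - f (z - x))) =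
 (fun h : R => h^-1 *: (f (h *: (if i == 0 then (1, 0) else (0, 1)) + (z - x)) - f (z - x))) by [].
by apply: funext => h; rewrite addrA.
Qed.

Lemma smooth_translate f x : smooth f -> smooth (fun z => f (z - x)).
Proof.
move=> sf; pose P g := exists2 f0 : T2 -> R, smooth f0 & g = (fun z => f0 (z - x)).
apply: (@smooth_coind _ P); last by exists f.
move=> _ [f0 sf0 ->]; split.
  move=> z; apply: (@continuous_comp _ _ _ (fun z => z - x) f0); last exact: smooth_continuous.
  by apply: cvgB; [exact: cvg_id|exact: cvg_cst].
move=> i; split; last first.
  by exists (partial i f0); [exact: smooth_partial|rewrite partial_translate].
move=> z; have := @smooth_has_partial _ i f0 sf0 (z - x).
rewrite /derivable.
suff -> : (fun h : R => h^-1 *: (f0 (h *: (if i == 0 then (1, 0) else (0, 1)) + z - x) - f0 (z - x))) =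
 (fun h : R => h^-1 *: (f0 (h *: (if i == 0 then (1, 0) else (0, 1)) + (z - x)) - f0 (z - x))) by [].
by apply: funext => h; rewrite addrA.
Qed.

(** Both sides equal f'(z_1) g'(z_2), because each derivative only sees the factor of its own
    variable. This symmetry is what makes the rotated gradients used below divergence-free. *)
Lemma partial_sep f g : smooth f -> smooth g -> (forall z t, f (z.1, t) = f z) ->
  (forall z t, g (t, z.2) = g z) ->
  partial o0 (partial o1 (fun z => f z * g z)) = partial o1 (partial o0 (fun z => f z * g z)).
Proof.
move=> sf sg hf hg.
have -> : partial o1 (fun z => f z * g z) = fun z => f z * partial o1 g z.
  by rewrite partialM// (partial1_indep hf); apply: funext => z; rewrite mul0r addr0.
have -> : partial o0 (fun z => f z * g z) = fun z => partial o0 f z * g z.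
  by rewrite partialM// (partial0_indep hg); apply: funext => z; rewrite mulr0 add0r.
have spg := smooth_partial o1 sg; have spf := smooth_partial o0 sf.
rewrite (partialM _ sf spg) (partialM _ spf sg).
rewrite (_ : partial o0 (partial o1 g) = fun=> 0); last first.
  apply: partial0_indep => z t; rewrite !partial1_slice /=.
  by congr (derive _ _ _); apply: funext => s; rewrite -[RHS](hg (z.1, s) t).
rewrite (_ : partial o1 (partial o0 f) = fun=> 0); last first.
  apply: partial1_indep => z t; rewrite !partial0_slice /=.
  by congr (derive _ _ _); apply: funext => s; rewrite -[RHS](hf (s, z.2) t).
by apply: funext => z; rewrite mulr0 mul0r add0r addr0.
Qed.

End cutoffs.

Global Opaque partial bump cut.

(** * Test fields, test functions and the double divergence *)

Section fields.
Context {R : realType}.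
Local Notation T2 := (R * R)%type.
Implicit Types (f g : T2 -> R) (z x y : T2) (i j : 'I_2) (r t : R) (F G : T2 -> 'M[R]_2).
Implicit Types (A K : set T2).

Definition dd F z : R := \sum_(i < 2) \sum_(j < 2) partial i (partial j (fun w => F w i j)) z.

Lemma sum_ord2 (V : nmodType) (h : 'I_2 -> V) : \sum_(i < 2) h i = h o0 + h o1.
Proof.
rewrite big_ord_recl big_ord1.
by congr (h _ + h _); exact/val_inj.
Qed.

Lemma ddE F z : dd F z =
  partial o0 (partial o0 (fun w => F w o0 o0)) z + partial o0 (partial o1 (fun w => F w o0 o1)) z
  + (partial o1 (partial o0 (fun w => F w o1 o0)) z + partial o1 (partial o1 (fun w => F w o1 o1)) z).
Proof.
rewrite /dd; apply: etrans (sum_ord2 _) _; apply: congr2; exact: sum_ord2.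
Qed.

Definition smooth_field F := forall i j, smooth (fun z => F z i j).

(** The support is bounded by some compact set instead of being a closure, which is convenient for
    sums and products; [tfieldP] shows that the resulting notion agrees with [test_field]. *)
Definition supported F A := exists K, [/\ compact K, K `<=` A & forall z, ~ K z -> F z = 0].

Definition tfield A F := smooth_field F /\ supported F A.

(** The space C_c(A), on which the linear forms act; smoothness is demanded of the matrix fields
    only. *)
Definition testfun A f := continuous f /\
  exists K, [/\ compact K, K `<=` A & forall z, ~ K z -> f z = 0].

Lemma tfieldP A F : test_field A F <-> tfield A F.
Proof.
split=> [[s c h]|[s [K [cK KA h]]]].
  split=> //; exists (closure [set x | F x != 0]); split=> // z hz.
  by apply/eqP/negP => /negP Fz; apply: hz; exact: subset_closure.
have sub : closure [set x | F x != 0] `<=` K.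
  rewrite (closure_id K).1; last exact: compact_closedT2.
  by apply: closure_subset => z /eqP Fz; apply: contrapT => /h.
split=> //; last exact: subset_trans KA.
by apply: subclosed_compact sub => //; exact: closed_closure.
Qed.

Lemma tfieldS A B F : A `<=` B -> tfield A F -> tfield B F.
Proof.
move=> AB [s [K [cK KA h]]]; split=> //; exists K; split=> //.
exact: subset_trans AB.
Qed.

Lemma smooth_fieldD F G : smooth_field F -> smooth_field G -> smooth_field (fun z => F z + G z).
Proof.
move=> sF sG i j; rewrite (_ : (fun z => _) = fun z => F z i j + G z i j).
  exact: smoothD.
by apply: funext => z; rewrite mxE.
Qed.

Lemma smooth_fieldZ f F : smooth f -> smooth_field F -> smooth_field (fun z => f z *: F z).
Proof.
move=> sf sF i j; rewrite (_ : (fun z => _) = fun z => f z * F z i j).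
  exact: smoothM sf (sF i j).
by apply: funext => z; rewrite mxE.
Qed.

Lemma supportedD A F G : supported F A -> supported G A -> supported (fun z => F z + G z) A.
Proof.
move=> [K [cK KA hK]] [L [cL LA hL]]; exists (K `|` L); split.
- exact: compactU.
- by move=> z [/KA|/LA].
- by move=> z /not_orP [/hK -> /hL ->]; rewrite addr0.
Qed.

Lemma supportedZ A f F : supported F A -> supported (fun z => f z *: F z) A.
Proof.
by move=> [K [cK KA hK]]; exists K; split=> // z /hK ->; rewrite scaler0.
Qed.

Lemma tfieldD A F G : tfield A F -> tfield A G -> tfield A (fun z => F z + G z).
Proof.
by move=> [sF hF] [sG hG]; split; [exact: smooth_fieldD|exact: supportedD].
Qed.

Lemma tfieldZ A f F : smooth f -> tfield A F -> tfield A (fun z => f z *: F z).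
Proof.
by move=> sf [sF hF]; split; [exact: smooth_fieldZ|exact: supportedZ].
Qed.

Lemma tfield_cut A x r F : 0 < r -> sq x (2 * r) `<=` A -> smooth_field F ->
  tfield A (fun z => cut x r z *: F z).
Proof.
move=> r0 h sF; split; first by apply: smooth_fieldZ => //; exact: smooth_cut.
exists (sq x (2 * r)); split=> //; first exact: sq_compact.
by move=> z hz; rewrite cut_eq0// scale0r.
Qed.

Lemma ddD F G : smooth_field F -> smooth_field G ->
  dd (fun z => F z + G z) = fun z => dd F z + dd G z.
Proof.
move=> sF sG; apply: funext => z; rewrite /dd -big_split/=; apply: eq_bigr => i _.
rewrite -big_split/=; apply: eq_bigr => j _.
rewrite (_ : (fun z => (F z + G z) i j) = fun z => F z i j + G z i j); last first.
  by apply: funext => w; rewrite mxE.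
rewrite partialD// partialD//; exact: smooth_partial.
Qed.

Lemma ddZ (c : R) F : smooth_field F -> dd (fun z => c *: F z) = fun z => c * dd F z.
Proof.
move=> sF; apply: funext => z; rewrite /dd mulr_sumr; apply: eq_bigr => i _.
rewrite mulr_sumr; apply: eq_bigr => j _.
rewrite (_ : (fun z => (c *: F z) i j) = fun z => c * F z i j); last first.
  by apply: funext => w; rewrite mxE.
rewrite partialZ// partialZ//; exact: smooth_partial.
Qed.

Lemma smooth_field_cst (M : 'M[R]_2) : smooth_field (fun=> M).
Proof. by move=> i j; exact: smooth_cst. Qed.

Lemma smooth_fieldN F : smooth_field F -> smooth_field (fun z => - F z).
Proof.
move=> sF; rewrite (_ : (fun z => _) = fun z => (-1) *: F z).
  by apply: smooth_fieldZ => //; exact: smooth_cst.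
by apply: funext => z; rewrite scaleN1r.
Qed.

Lemma tfieldN A F : tfield A F -> tfield A (fun z => - F z).
Proof.
move=> [sF [K [cK KA hK]]]; split; first exact: smooth_fieldN.
by exists K; split=> // z /hK ->; rewrite oppr0.
Qed.

Lemma tfieldB A F G : tfield A F -> tfield A G -> tfield A (fun z => F z - G z).
Proof. by move=> tF tG; apply: tfieldD => //; exact: tfieldN. Qed.

Lemma ddN F : smooth_field F -> dd (fun z => - F z) = fun z => - dd F z.
Proof.
move=> sF; rewrite (_ : (fun z => - F z) = fun z => (-1) *: F z).
  by rewrite ddZ//; apply: funext => z; rewrite mulN1r.
by apply: funext => z; rewrite scaleN1r.
Qed.

Lemma ddB F G : smooth_field F -> smooth_field G ->
  dd (fun z => F z - G z) = fun z => dd F z - dd G z.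
Proof. by move=> sF sG; rewrite (ddD sF (smooth_fieldN sG)) (ddN sG). Qed.

Lemma dd0 : dd (fun=> 0 : 'M[R]_2) = fun=> 0.
Proof.
apply: funext => z; rewrite /dd big1// => i _; rewrite big1// => j _.
rewrite (_ : (fun w => _) = fun=> 0); first by rewrite !partial_cst.
by apply: funext => w; rewrite mxE.
Qed.

Lemma continuousT2D f g : continuous f -> continuous g -> continuous (fun z => f z + g z).
Proof. by move=> cf cg z; apply: (@continuousD _ _ _ f g); [exact: cf|exact: cg]. Qed.

Lemma continuousT2M f g : continuous f -> continuous g -> continuous (fun z => f z * g z).
Proof. by move=> cf cg z; apply: (@continuousM _ _ f g); [exact: cf|exact: cg]. Qed.

Lemma dd_testfun A F : tfield A F -> testfun A (dd F).
Proof.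
move=> [sF [K [cK KA hK]]]; split.
  have -> : dd F = fun z => \sum_(i < 2) \sum_(j < 2) partial i (partial j (fun w => F w i j)) z by [].
  have c i j : continuous (partial i (partial j (fun w => F w i j))).
    by apply/smooth_continuous/smooth_partial/smooth_partial.
  rewrite (_ : (fun z => _) = fun z =>
    partial o0 (partial o0 (fun w => F w o0 o0)) z + partial o0 (partial o1 (fun w => F w o0 o1)) z
    + (partial o1 (partial o0 (fun w => F w o1 o0)) z + partial o1 (partial o1 (fun w => F w o1 o1)) z)).
    by apply: continuousT2D; apply: continuousT2D; exact: c.
  by apply: funext => z; exact: ddE.
exists K; split=> // z nKz; rewrite /dd big1// => i _; rewrite big1// => j _.
have clK := compact_closedT2 cK.
apply: (@partial_off _ i _ K clK _ z nKz) => w nKw.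
by apply: (@partial_off _ j _ K clK _ w nKw) => u /hK ->; rewrite mxE.
Qed.

Lemma testfunS A B f : A `<=` B -> testfun A f -> testfun B f.
Proof.
by move=> AB [s [K [cK KA h]]]; split=> //; exists K; split=> //; exact: subset_trans AB.
Qed.

Lemma testfunD A f g : testfun A f -> testfun A g -> testfun A (fun z => f z + g z).
Proof.
move=> [cf [K [cK KA hK]]] [cg [L [cL LA hL]]]; split; first exact: continuousT2D.
exists (K `|` L); split.
- exact: compactU.
- by move=> z [/KA|/LA].
- by move=> z /not_orP [/hK -> /hL ->]; rewrite addr0.
Qed.

Lemma testfunM A f g : continuous f -> testfun A g -> testfun A (fun z => f z * g z).
Proof.
move=> cf [cg [L [cL LA hL]]]; split; first exact: continuousT2M.
by exists L; split=> // z /hL ->; rewrite mulr0.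
Qed.

Lemma testfunZ A (a : R) f : testfun A f -> testfun A (fun z => a * f z).
Proof. by move=> tf; apply: testfunM => //; exact: cst_continuous. Qed.

Lemma testfunN A f : testfun A f -> testfun A (fun z => - f z).
Proof.
move=> tf; rewrite (_ : (fun z => _) = fun z => -1 * f z); first exact: testfunZ.
by apply: funext => z; rewrite mulN1r.
Qed.

Lemma testfunB A f g : testfun A f -> testfun A g -> testfun A (fun z => f z - g z).
Proof. by move=> tf tg; apply: testfunD => //; exact: testfunN. Qed.

Lemma testfun_cut A x r f : 0 < r -> sq x (2 * r) `<=` A -> continuous f ->
  testfun A (fun z => cut x r z * f z).
Proof.
move=> r0 h cf; split; first by apply: continuousT2M => //; exact/smooth_continuous/smooth_cut.
exists (sq x (2 * r)); split=> //; first exact: sq_compact.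
by move=> z hz; rewrite cut_eq0// mul0r.
Qed.

Lemma testfun_bounded A f : testfun A f -> exists2 s : R, 0 <= s & forall z, `|f z| <= s.
Proof.
move=> [cf [K [cK KA h]]].
have : bounded_set (f @` K).
  apply: compact_bounded; apply: continuous_compact => //.
  exact: continuous_subspaceT.
move=> [M [_ /(_ (Num.max 0 (M + 1)))]] /= hM.
have {}hM : forall t : R, (f @` K) t -> `|t| <= Num.max 0 (M + 1).
  by apply: hM; rewrite lt_max ltrDl ltr01 orbT.
exists (Num.max 0 (M + 1)); first by rewrite le_max lexx.
move=> z; have [Kz|/h ->] := pselect (K z); first by apply: hM; exists z.
by rewrite normr0 le_max lexx.
Qed.

Definition mx2 (a b c d : R) : 'M[R]_2 :=
  \matrix_(i, j) (if i == o0 then if j == o0 then a else b else if j == o0 then c else d).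

Lemma smooth_field_mx2 (a b c d : T2 -> R) : smooth a -> smooth b -> smooth c -> smooth d ->
  smooth_field (fun z => mx2 (a z) (b z) (c z) (d z)).
Proof.
move=> sa sb sc sd i j.
have E : (fun z => mx2 (a z) (b z) (c z) (d z) i j) =
   (if i == o0 then if j == o0 then a else b else if j == o0 then c else d).
  by apply: funext => z; rewrite mxE; case: ifP; case: ifP.
by rewrite E; case: ifP; case: ifP.
Qed.

Lemma dd_mx2 (a b c d : T2 -> R) z : dd (fun z => mx2 (a z) (b z) (c z) (d z)) z =
  partial o0 (partial o0 a) z + partial o0 (partial o1 b) z
  + (partial o1 (partial o0 c) z + partial o1 (partial o1 d) z).
Proof.
have E00 : (fun w => mx2 (a w) (b w) (c w) (d w) o0 o0) = a by apply: funext => w; rewrite mxE ?ordE.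
have E01 : (fun w => mx2 (a w) (b w) (c w) (d w) o0 o1) = b by apply: funext => w; rewrite mxE ?ordE.
have E10 : (fun w => mx2 (a w) (b w) (c w) (d w) o1 o0) = c by apply: funext => w; rewrite mxE ?ordE.
have E11 : (fun w => mx2 (a w) (b w) (c w) (d w) o1 o1) = d by apply: funext => w; rewrite mxE ?ordE.
by rewrite ddE E00 E01 E10 E11.
Qed.

Lemma mx2E (M : 'M[R]_2) : M = mx2 (M o0 o0) (M o0 o1) (M o1 o0) (M o1 o1).
Proof.
by apply/matrixP; elim/ord2_ind; elim/ord2_ind; rewrite mxE ?ordE.
Qed.

End fields.

Global Opaque dd.

Ltac gen_partial := repeat match goal with |- context [partial ?i ?f ?z] =>
  generalize (partial i f z); intro end.

(** * The kernel and its double divergence *)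

Section kernel.
Context {R : realType}.

Lemma scale_mx2 (k a b c d : R) : k *: mx2 a b c d = mx2 (k * a) (k * b) (k * c) (k * d).
Proof. by apply/matrixP => i j; rewrite !mxE; case: ifP; case: ifP. Qed.

Local Notation T2 := (R * R)%type.
Implicit Types (f g : T2 -> R) (z x y : T2) (i j : 'I_2) (r t e : R) (F G : T2 -> 'M[R]_2).
Implicit Types (A K : set T2).

Definition qden y e z : R := (z.1 - y.1) ^+ 2 + (z.2 - y.2) ^+ 2 + e ^+ 2.
Definition kerA y e z := ((z.1 - y.1) ^+ 2 - (z.2 - y.2) ^+ 2) * (qden y e z)^-1.
Definition kerB y e z := 2 * ((z.1 - y.1) * (z.2 - y.2)) * (qden y e z)^-1.
Definition ker y e z : 'M[R]_2 := mx2 (kerA y e z) (kerB y e z) (kerB y e z) (- kerA y e z).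
Definition eta y e z := 8 * e ^+ 4 * (qden y e z)^-1 ^+ 3.
(** The pair [gradA], [gradB] is the gradient of log q - e^2/q with q = [qden]. It is the row-wise
    divergence of [ker], and the Laplacian of this potential is [eta]. *)
Definition gradA y e z := 2 * (z.1 - y.1) * (qden y e z)^-1 * (1 + e ^+ 2 * (qden y e z)^-1).
Definition gradB y e z := 2 * (z.2 - y.2) * (qden y e z)^-1 * (1 + e ^+ 2 * (qden y e z)^-1).
(** The terms of the double divergence of [chi *: ker] in which [chi] is differentiated. They vanish
    where [chi] is locally constant; if [chi] is 1 near [y] they stay regular as e -> 0 and are
    meaningful for e = 0. *)
Definition kerrem (chi : T2 -> R) y e z :=
  (partial o0 (partial o0 chi) z - partial o1 (partial o1 chi) z) * kerA y e z
  + (partial o0 (partial o1 chi) z + partial o1 (partial o0 chi) z) * kerB y e z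
  + 2 * (partial o0 chi z * gradA y e z + partial o1 chi z * gradB y e z).

Lemma kerremE chi y e z : kerrem chi y e z =
  (partial o0 (partial o0 chi) z - partial o1 (partial o1 chi) z) * kerA y e z
  + (partial o0 (partial o1 chi) z + partial o1 (partial o0 chi) z) * kerB y e z
  + 2 * (partial o0 chi z * gradA y e z + partial o1 chi z * gradB y e z).
Proof. by []. Qed.

Lemma kerE y e z : ker y e z = mx2 (kerA y e z) (kerB y e z) (kerB y e z) (- kerA y e z).
Proof. by []. Qed.

Lemma etaE y e z : eta y e z = 8 * e ^+ 4 * (qden y e z)^-1 ^+ 3.
Proof. by []. Qed.

Lemma qdenE y e z : qden y e z = (z.1 - y.1) ^+ 2 + (z.2 - y.2) ^+ 2 + e ^+ 2.
Proof. by []. Qed.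

Lemma qden_ge0 y e z : 0 <= qden y e z.
Proof. by rewrite !addr_ge0 ?sqr_ge0. Qed.

Lemma qden_neq0 y e z : e != 0 -> qden y e z != 0.
Proof.
move=> e0; rewrite lt0r_neq0// ltr_wpDl ?addr_ge0 ?sqr_ge0//.
by rewrite exprn_even_gt0.
Qed.

Lemma isd_fstB i z (c : R) : is_derive z (edir i) (fun z => z.1 - c) (i == o0)%:R.
Proof. by have := isdB (isd_fst i z) (isdC c z (edir i)); rewrite subr0. Qed.

Lemma isd_sndB i z (c : R) : is_derive z (edir i) (fun z => z.2 - c) (i == o1)%:R.
Proof. by have := isdB (isd_snd i z) (isdC c z (edir i)); rewrite subr0. Qed.

Lemma isd_qden i y e z : is_derive z (edir i) (qden y e)
  (2 * ((z.1 - y.1) * (i == o0)%:R + (z.2 - y.2) * (i == o1)%:R)).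
Proof.
apply: is_derive_eq (isdD (isdD (isdX 2 (isd_fstB i z y.1)) (isdX 2 (isd_sndB i z y.2)))
  (isdC (e ^+ 2) z (edir i))) _.
by rewrite /= addr0 !expr1; ring.
Qed.

Section smoothness.
Variables (y : T2) (e : R).
Hypothesis e0 : e != 0.

Lemma smooth_fstB (c : R) : smooth (fun z : T2 => z.1 - c).
Proof. by apply: smoothB; [exact: smooth_fst|exact: smooth_cst]. Qed.

Lemma smooth_sndB (c : R) : smooth (fun z : T2 => z.2 - c).
Proof. by apply: smoothB; [exact: smooth_snd|exact: smooth_cst]. Qed.

Lemma smooth_qdenV : smooth (fun z => (qden y e z)^-1).
Proof.
apply: smoothV; first by move=> z; exact: qden_neq0.
apply: smoothD; last exact: smooth_cst.
by apply: smoothD; apply: smoothX; [exact: smooth_fstB|exact: smooth_sndB].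
Qed.

Lemma smooth_kerA : smooth (kerA y e).
Proof.
apply: smoothM; last exact: smooth_qdenV.
by apply: smoothB; apply: smoothX; [exact: smooth_fstB|exact: smooth_sndB].
Qed.

Lemma smooth_kerB : smooth (kerB y e).
Proof.
apply: smoothM; last exact: smooth_qdenV.
apply: smoothM; first exact: smooth_cst.
by apply: smoothM; [exact: smooth_fstB|exact: smooth_sndB].
Qed.

Lemma smooth_gradA : smooth (gradA y e).
Proof.
apply: smoothM; last first.
  apply: smoothD; first exact: smooth_cst.
  by apply: smoothM; [exact: smooth_cst|exact: smooth_qdenV].
apply: smoothM; last exact: smooth_qdenV.
by apply: smoothM; [exact: smooth_cst|exact: smooth_fstB].
Qed.

Lemma smooth_gradB : smooth (gradB y e).
Proof.
apply: smoothM; last first.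
  apply: smoothD; first exact: smooth_cst.
  by apply: smoothM; [exact: smooth_cst|exact: smooth_qdenV].
apply: smoothM; last exact: smooth_qdenV.
by apply: smoothM; [exact: smooth_cst|exact: smooth_sndB].
Qed.

Lemma smooth_eta : smooth (eta y e).
Proof.
apply: smoothM; first exact: smooth_cst.
by apply: smoothX; exact: smooth_qdenV.
Qed.

Lemma smooth_ker : smooth_field (ker y e).
Proof.
exact: (smooth_field_mx2 smooth_kerA smooth_kerB smooth_kerB (smoothN smooth_kerA)).
Qed.

Lemma isd_qdenV i z : is_derive z (edir i) (fun z => (qden y e z)^-1)
  (- (qden y e z)^-1 ^+ 2 * (2 * ((z.1 - y.1) * (i == o0)%:R + (z.2 - y.2) * (i == o1)%:R))).
Proof. by apply: isdV; [exact: qden_neq0|exact: isd_qden]. Qed.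

Lemma isd_kerA i z : is_derive z (edir i) (kerA y e)
  (2 * ((z.1 - y.1) * (i == o0)%:R - (z.2 - y.2) * (i == o1)%:R) * (qden y e z)^-1
   - 2 * ((z.1 - y.1) ^+ 2 - (z.2 - y.2) ^+ 2) * (qden y e z)^-1 ^+ 2 *
    ((z.1 - y.1) * (i == o0)%:R + (z.2 - y.2) * (i == o1)%:R)).
Proof.
apply: is_derive_eq (isdM (isdB (isdX 2 (isd_fstB i z y.1)) (isdX 2 (isd_sndB i z y.2)))
  (isd_qdenV i z)) _.
by rewrite /= !expr1; ring.
Qed.

Lemma isd_kerB i z : is_derive z (edir i) (kerB y e)
  (2 * ((z.1 - y.1) * (i == o1)%:R + (z.2 - y.2) * (i == o0)%:R) * (qden y e z)^-1
   - 4 * ((z.1 - y.1) * (z.2 - y.2)) * (qden y e z)^-1 ^+ 2 *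
    ((z.1 - y.1) * (i == o0)%:R + (z.2 - y.2) * (i == o1)%:R)).
Proof.
apply: is_derive_eq (isdM (isdM (isdC 2 z (edir i)) (isdM (isd_fstB i z y.1) (isd_sndB i z y.2)))
  (isd_qdenV i z)) _.
by rewrite /=; ring.
Qed.

Lemma ker_row0 z : partial o0 (kerA y e) z + partial o1 (kerB y e) z = gradA y e z.
Proof.
rewrite (is_derive_partial (isd_kerA o0 z)) (is_derive_partial (isd_kerB o1 z)) /gradA ?ordE /=.
have := qden_neq0 y z e0; rewrite /qden => h; rewrite /qden; field.
exact: h.
Qed.

Lemma ker_row1 z : partial o0 (kerB y e) z - partial o1 (kerA y e) z = gradB y e z.
Proof.
rewrite (is_derive_partial (isd_kerA o1 z)) (is_derive_partial (isd_kerB o0 z)) /gradB ?ordE /=.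
have := qden_neq0 y z e0; rewrite /qden => h; rewrite /qden; field.
exact: h.
Qed.

Lemma div_grad z : partial o0 (gradA y e) z + partial o1 (gradB y e) z = eta y e z.
Proof.
have dd i := isdD (isdC 1 z (edir i)) (isdM (isdC (e ^+ 2) z (edir i)) (isd_qdenV i z)).
have dA := isdM (isdM (isdM (isdC 2 z (edir o0)) (isd_fstB o0 z y.1)) (isd_qdenV o0 z)) (dd o0).
have dB := isdM (isdM (isdM (isdC 2 z (edir o1)) (isd_sndB o1 z y.2)) (isd_qdenV o1 z)) (dd o1).
rewrite (is_derive_partial dA) (is_derive_partial dB) /eta ?ordE /=.
have := qden_neq0 y z e0; rewrite /qden => h; rewrite /qden; field.
exact: h.
Qed.

(** Each row is reduced by [ker_row0] or [ker_row1] to [chi] times a gradient field plus terms with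
    a derivative of [chi], and the outer derivative is taken afterwards. In this order only first
    derivatives of the kernel are computed; the second-order part is [div_grad]. *)
Lemma dd_cut_ker chi : smooth chi ->
  dd (fun z => chi z *: ker y e z) = fun z => chi z * eta y e z + kerrem chi y e z.
Proof.
move=> sc; have sA := smooth_kerA; have sB := smooth_kerB.
have -> : (fun z => chi z *: ker y e z) = fun z => mx2 (chi z * kerA y e z) (chi z * kerB y e z)
   (chi z * kerB y e z) (- (chi z * kerA y e z)).
  by apply: funext => z; rewrite scale_mx2 mulrN.
apply: funext => z; rewrite dd_mx2.
have scA := smoothM sc sA; have scB := smoothM sc sB.
have sc0 := smooth_partial o0 sc; have sc1 := smooth_partial o1 sc.
rewrite (partialN o1 scA).
have eA : partial o0 (partial o0 (fun z => chi z * kerA y e z)) z +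
    partial o0 (partial o1 (fun z => chi z * kerB y e z)) z =
  partial o0 (fun z => chi z * gradA y e z + (partial o0 chi z * kerA y e z + partial o1 chi z * kerB y e z)) z.
  transitivity (partial o0 (fun z => partial o0 (fun z => chi z * kerA y e z) z +
     partial o1 (fun z => chi z * kerB y e z) z) z).
    by rewrite (partialD o0 (smooth_partial o0 scA) (smooth_partial o1 scB)).
  congr (partial o0 _ z); apply: funext => w.
  rewrite (partialM o0 sc sA) (partialM o1 sc sB) -ker_row0.
  by gen_partial; generalize (kerA y e w) (kerB y e w) (chi w) => *; ring.
have eB : partial o1 (partial o0 (fun z => chi z * kerB y e z)) z +
    partial o1 (fun z => - partial o1 (fun z => chi z * kerA y e z) z) z =
  partial o1 (fun z => chi z * gradB y e z + (partial o0 chi z * kerB y e z - partial o1 chi z * kerA y e z)) z.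
  transitivity (partial o1 (fun z => partial o0 (fun z => chi z * kerB y e z) z -
     partial o1 (fun z => chi z * kerA y e z) z) z).
    rewrite (partialB o1 (smooth_partial o0 scB) (smooth_partial o1 scA)).
    by rewrite (partialN o1 (smooth_partial o1 scA)).
  congr (partial o1 _ z); apply: funext => w.
  rewrite (partialM o1 sc sA) (partialM o0 sc sB) -ker_row1.
  by gen_partial; generalize (kerA y e w) (kerB y e w) (chi w) => *; ring.
have sgA := smooth_gradA; have sgB := smooth_gradB.
apply: (etrans (congr2 +%R eA eB)).
rewrite (partialD o0 (smoothM sc sgA) (smoothD (smoothM sc0 sA) (smoothM sc1 sB))).
rewrite (partialD o0 (smoothM sc0 sA) (smoothM sc1 sB)).
rewrite (partialD o1 (smoothM sc sgB) (smoothB (smoothM sc0 sB) (smoothM sc1 sA))).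
rewrite (partialB o1 (smoothM sc0 sB) (smoothM sc1 sA)).
rewrite (partialM o0 sc sgA) (partialM o0 sc0 sA) (partialM o0 sc1 sB).
rewrite (partialM o1 sc sgB) (partialM o1 sc0 sB) (partialM o1 sc1 sA).
rewrite /kerrem -div_grad -ker_row0 -ker_row1.
gen_partial; generalize (kerA y e z) (kerB y e z) (chi z) => *.
ring.
Qed.

Lemma ker_le1 i j z : `|ker y e z i j| <= 1.
Proof.
have D0 : 0 < qden y e z by rewrite lt_neqAle eq_sym qden_neq0//= qden_ge0.
have u0 := sqr_ge0 (z.1 - y.1); have v0 := sqr_ge0 (z.2 - y.2); have e2 := sqr_ge0 e.
have hA : `|kerA y e z| <= 1.
  rewrite normrM normfV (gtr0_norm D0) ler_pdivrMr// mul1r ler_norml /qden; apply/andP; split; lra.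
have hB : `|kerB y e z| <= 1.
  rewrite normrM normfV (gtr0_norm D0) ler_pdivrMr// mul1r ler_norml /qden; apply/andP; split.
    have := sqr_ge0 ((z.1 - y.1) + (z.2 - y.2)); rewrite sqrrD mulr2n; lra.
  have := sqr_ge0 ((z.1 - y.1) - (z.2 - y.2)); rewrite sqrrB mulr2n; lra.
move: i j; elim/ord2_ind; elim/ord2_ind; rewrite mxE ?ordE//=.
by rewrite normrN.
Qed.

Lemma eta_ge0 z : 0 <= eta y e z.
Proof.
apply: mulr_ge0; first by apply: mulr_ge0 => //; exact: exprn_even_ge0.
by apply: exprn_ge0; rewrite invr_ge0; exact: qden_ge0.
Qed.

End smoothness.
End kernel.

(** * Locally bounded linear forms with bounded Hessian *)

Section test_forms.
Context {R : realType}.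
Local Notation T2 := (R * R)%type.
Implicit Types (f g h k : T2 -> R) (z x y : T2) (i j : 'I_2) (r t e s E : R) (F G : T2 -> 'M[R]_2).
Implicit Types (A K Omega : set T2) (I : (T2 -> R) -> R).

Lemma mxDE (M N : 'M[R]_2) i j : (M + N) i j = M i j + N i j. Proof. by rewrite mxE. Qed.

Lemma mxBE (M N : 'M[R]_2) i j : (M - N) i j = M i j - N i j.
Proof. by rewrite mxE [(- N) i j]mxE. Qed.

Lemma mxZE (a : R) (M : 'M[R]_2) i j : (a *: M) i j = a * M i j. Proof. by rewrite mxE. Qed.

(** An element of the dual of C_c(Omega), that is a signed Radon measure known through its
    integrals. Locally integrable functions and their ultrafilter limits are both of this kind, so
    that point values can be defined once for both. *)
Record testform Omega I : Prop := Testform {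
  tf_lin : forall (a : R) h k, testfun Omega h -> testfun Omega k ->
    I (fun z => a * h z + k z) = a * I h + I k;
  tf_bnd : forall K, compact K -> K `<=` Omega -> exists2 C : R, 0 <= C &
    forall h s, continuous h -> (forall z, ~ K z -> h z = 0) ->
      (forall z, `|h z| <= s) -> `|I h| <= C * s }.

Definition entries_le F s := forall z i j, `|F z i j| <= s.

(** Entries take the place of the Schatten norm: the construction of point values asks for some
    bound on the Hessian rather than the exact one, and this form of it does not depend on p. *)
Definition hessian_bound Omega I E :=
  forall F s, tfield Omega F -> entries_le F s -> I (dd F) <= E * s.

Section testform_theory.
Variables (Omega : set T2) (I : (T2 -> R) -> R).
Hypothesis tI : testform Omega I.

Lemma testfun0 A : testfun A (fun=> 0).
Proof.
split; first exact: cst_continuous.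
by exists set0; split=> //; exact: compact0.
Qed.

Lemma tf0 : I (fun=> 0) = 0.
Proof.
have := tf_lin tI 1 (testfun0 Omega) (testfun0 Omega).
rewrite mul1r (_ : (fun=> _) = fun=> 0); first by move=> h; lra.
by apply: funext => z; rewrite addr0.
Qed.

Lemma tfD h k : testfun Omega h -> testfun Omega k -> I (fun z => h z + k z) = I h + I k.
Proof.
move=> th tk; have := tf_lin tI 1 th tk; rewrite mul1r => <-.
by congr I; apply: funext => z; rewrite mul1r.
Qed.

Lemma tfZ (a : R) h : testfun Omega h -> I (fun z => a * h z) = a * I h.
Proof.
move=> th; have := tf_lin tI a th (testfun0 Omega); rewrite tf0 addr0 => <-.
by congr I; apply: funext => z; rewrite addr0.
Qed.

Lemma tfN h : testfun Omega h -> I (fun z => - h z) = - I h.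
Proof.
move=> th; rewrite -mulN1r -(tfZ _ th).
by congr I; apply: funext => z; rewrite mulN1r.
Qed.

Lemma tfB h k : testfun Omega h -> testfun Omega k -> I (fun z => h z - k z) = I h - I k.
Proof. by move=> th tk; rewrite (tfD th (testfunN tk)) (tfN tk). Qed.

Lemma tf_ddD F G : tfield Omega F -> tfield Omega G ->
  I (dd (fun z => F z + G z)) = I (dd F) + I (dd G).
Proof.
by move=> tF tG; rewrite (ddD tF.1 tG.1); apply: tfD; exact: dd_testfun.
Qed.

Lemma tf_ddB F G : tfield Omega F -> tfield Omega G ->
  I (dd (fun z => F z - G z)) = I (dd F) - I (dd G).
Proof.
by move=> tF tG; rewrite (ddB tF.1 tG.1); apply: tfB; exact: dd_testfun.
Qed.

Lemma tf_ddN F : tfield Omega F -> I (dd (fun z => - F z)) = - I (dd F).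
Proof.
by move=> tF; rewrite (ddN tF.1); apply: tfN; exact: dd_testfun.
Qed.

Lemma tf_ddZ (a : R) F : tfield Omega F -> I (dd (fun z => a *: F z)) = a * I (dd F).
Proof.
by move=> tF; rewrite (ddZ a tF.1); apply: tfZ; exact: dd_testfun.
Qed.

Lemma entries_leN F s : entries_le F s -> entries_le (fun z => - F z) s.
Proof. by move=> hF z i j; rewrite mxE normrN. Qed.

Lemma hessian_bound_norm E F s : hessian_bound Omega I E -> tfield Omega F ->
  entries_le F s -> `|I (dd F)| <= E * s.
Proof.
move=> hE tF hF; rewrite ler_norml hE// andbT.
rewrite lerNl -(tf_ddN tF); apply: hE; first exact: tfieldN.
exact: entries_leN.
Qed.

Lemma hessian_bound_ge0 E : hessian_bound Omega I E -> 0 <= E.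
Proof.
move=> hE; have t0 : tfield Omega (fun=> 0 : 'M[R]_2).
  split; first exact: smooth_field_cst.
  by exists set0; split => //; exact: compact0.
have := hE _ 1 t0 _; rewrite mulr1 => h.
have : I (dd (fun=> 0 : 'M[R]_2)) = 0.
  by rewrite dd0 tf0.
by move=> <-; apply: h => z i j; rewrite mxE normr0.
Qed.

Lemma entries_le0 F : entries_le F 0 -> F = fun=> 0.
Proof.
move=> hF; apply: funext => z; apply/matrixP => i j; rewrite mxE; apply/eqP.
by rewrite -normr_le0; exact: hF.
Qed.

Lemma entries_le_unit F s : 0 < s -> entries_le F s -> entries_le (fun z => s^-1 *: F z) 1.
Proof.
move=> s0 hF z i j; rewrite mxZE normrM ger0_norm ?invr_ge0 ?(ltW s0)//.
by rewrite mulrC ler_pdivrMr// mul1r.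
Qed.

Lemma tf_homogeneous A (c : R) F s : A `<=` Omega ->
  (forall G, tfield A G -> entries_le G 1 -> I (dd G) <= c) ->
  0 <= s -> tfield A F -> entries_le F s -> I (dd F) <= c * s.
Proof.
move=> AO H; rewrite le_eqVlt => /predU1P[<-|s0] tF hF.
  by rewrite (entries_le0 hF) mulr0 dd0 tf0.
rewrite -ler_pdivrMr// mulrC -tf_ddZ; last exact: tfieldS tF.
apply: H; first exact: (tfieldZ (smooth_cst _) tF).
exact: entries_le_unit.
Qed.

End testform_theory.

(** The one-dimensional derivative of [bump], read off from the plane, where its smoothness has been
    established. *)
Definition dbump (s : R) : R := partial o0 (fun z : T2 => bump z.1) (s, 0).

Lemma is_derive_bump s : is_derive s 1 bump (dbump s).
Proof.
have sb : smooth (fun z : T2 => bump z.1) by apply: smooth_bump; exact: smooth_fst.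
exact: (derivable_slice_fst (@smooth_has_partial _ o0 _ sb (s, 0))).
Qed.

Lemma dbump_off s : 2 < `|s| -> dbump s = 0.
Proof.
move=> hs; rewrite /dbump.
have cK : closed (@fst R R @^-1` `[-2, 2]%classic).
  by apply: closed_comp; [move=> ? _; exact: cvg_fst|exact: interval_closed].
apply: (@partial_off _ o0 _ _ cK).
  move=> z /= hz; apply: bump_eq0; apply/ltW.
  by rewrite ltNge; apply/negP => h; apply: hz; rewrite in_itv/= -ler_norml.
by rewrite /= in_itv/= -ler_norml => h; lra.
Qed.

Lemma dbump_bounded : exists2 C : R, 0 <= C & forall s, `|dbump s| <= C.
Proof.
have sb : smooth (fun z : T2 => bump z.1) by apply: smooth_bump; exact: smooth_fst.
have cp := smooth_continuous (smooth_partial o0 sb).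
have [C C0 h] := testfun_bounded (testfun_cut (@ltr0Sn R 2) (@subsetT _ (sq (0 : T2) (2 * 3))) cp).
exists C => // s; have [hs|hs] := leP `|s| 2; last by rewrite dbump_off// normr0.
have := h (s, 0); rewrite cut_eq1 ?mul1r//.
by split => /=; rewrite subr0 ?normr0//; apply: le_trans hs _; rewrite ler_nat.
Qed.

Lemma isd_bump1 x r i z : is_derive z (edir i) (bump1 x r)
  (dbump ((z.1 - x.1) / r) * ((i == o0)%:R / r)).
Proof.
apply: (isd_comp (is_derive_bump _)).
apply: is_derive_eq (isdM (isd_fstB i z x.1) (isdC r^-1 z (edir i))) _.
by rewrite mulr0 add0r mulrC.
Qed.

Lemma isd_bump2 x r i z : is_derive z (edir i) (bump2 x r)
  (dbump ((z.2 - x.2) / r) * ((i == o1)%:R / r)).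
Proof.
apply: (isd_comp (is_derive_bump _)).
apply: is_derive_eq (isdM (isd_sndB i z x.2) (isdC r^-1 z (edir i))) _.
by rewrite mulr0 add0r mulrC.
Qed.

(* The rows of [rot_field] are rotated gradients of cut-offs of linear
   functions, so the field is constant near [x] and its double divergence
   vanishes. *)
Definition rotP x t z := bump1 x t z * (bump2 x t z * (z.2 - x.2)).
Definition rotQ x t z := (bump1 x t z * (z.1 - x.1)) * bump2 x t z.
Definition rot_field x t (M : 'M[R]_2) z : 'M[R]_2 :=
  mx2 (M o0 o0 * partial o1 (rotP x t) z - M o0 o1 * partial o1 (rotQ x t) z)
      (M o0 o1 * partial o0 (rotQ x t) z - M o0 o0 * partial o0 (rotP x t) z)
      (M o1 o0 * partial o1 (rotP x t) z - M o1 o1 * partial o1 (rotQ x t) z)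
      (M o1 o1 * partial o0 (rotQ x t) z - M o1 o0 * partial o0 (rotP x t) z).

Lemma smooth_bump1_lin x t : smooth (fun z => bump1 x t z * (z.1 - x.1)).
Proof. exact: (smoothM (smooth_bump1 x t) (smooth_fstB x.1)). Qed.

Lemma smooth_bump2_lin x t : smooth (fun z => bump2 x t z * (z.2 - x.2)).
Proof. exact: (smoothM (smooth_bump2 x t) (smooth_sndB x.2)). Qed.

Lemma smooth_rotP x t : smooth (rotP x t).
Proof. exact: (smoothM (smooth_bump1 x t) (smooth_bump2_lin x t)). Qed.

Lemma smooth_rotQ x t : smooth (rotQ x t).
Proof. exact: (smoothM (smooth_bump1_lin x t) (smooth_bump2 x t)). Qed.

Lemma smooth_lin2 (a b : R) f g : smooth f -> smooth g -> smooth (fun z => a * f z - b * g z).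
Proof.
move=> sf sg.
exact: (smoothB (smoothM (smooth_cst a) sf) (smoothM (smooth_cst b) sg)).
Qed.

Lemma smooth_rot_field x t M : smooth_field (rot_field x t M).
Proof.
have sP i := smooth_partial i (smooth_rotP x t).
have sQ i := smooth_partial i (smooth_rotQ x t).
exact: (smooth_field_mx2 (smooth_lin2 _ _ (sP o1) (sQ o1)) (smooth_lin2 _ _ (sQ o0) (sP o0))
  (smooth_lin2 _ _ (sP o1) (sQ o1)) (smooth_lin2 _ _ (sQ o0) (sP o0))).
Qed.

Lemma partial_lin2 i (a b : R) f g : smooth f -> smooth g ->
  partial i (fun z => a * f z - b * g z) = fun z => a * partial i f z - b * partial i g z.
Proof.
move=> sf sg; rewrite (partialB i (smoothM (smooth_cst a) sf) (smoothM (smooth_cst b) sg)).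
by rewrite (partialZ i a sf) (partialZ i b sg).
Qed.

Lemma dd_rot_field x t M : dd (rot_field x t M) = fun=> 0.
Proof.
have sP := smooth_rotP x t; have sQ := smooth_rotQ x t.
have sP' i := smooth_partial i sP; have sQ' i := smooth_partial i sQ.
have eP : partial o0 (partial o1 (rotP x t)) = partial o1 (partial o0 (rotP x t)).
  exact: (partial_sep (smooth_bump1 x t) (smooth_bump2_lin x t) (fun=> fun=> erefl) (fun=> fun=> erefl)).
have eQ : partial o0 (partial o1 (rotQ x t)) = partial o1 (partial o0 (rotQ x t)).
  exact: (partial_sep (smooth_bump1_lin x t) (smooth_bump2 x t) (fun=> fun=> erefl) (fun=> fun=> erefl)).
apply: funext => z; rewrite /rot_field dd_mx2.
rewrite (partial_lin2 o0 _ _ (sP' o1) (sQ' o1)) (partial_lin2 o1 _ _ (sQ' o0) (sP' o0)).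
rewrite (partial_lin2 o0 _ _ (sP' o1) (sQ' o1)) (partial_lin2 o1 _ _ (sQ' o0) (sP' o0)).
rewrite eP eQ.
have sP2 := smooth_partial o1 (sP' o0); have sQ2 := smooth_partial o1 (sQ' o0).
have E i (a b : R) f g : smooth f -> smooth g ->
    partial i (fun w => a * f w - b * g w) z = a * partial i f z - b * partial i g z.
  by move=> sf sg; exact: (f_equal (@^~ z) (partial_lin2 i a b sf sg)).
apply: etrans (congr2 +%R (congr2 +%R (E _ _ _ _ _ sP2 sQ2) (E _ _ _ _ _ sQ2 sP2))
  (congr2 +%R (E _ _ _ _ _ sP2 sQ2) (E _ _ _ _ _ sQ2 sP2))) _.
by gen_partial; ring.
Qed.

Lemma rot_fieldE x t M z : rot_field x t M z =
  let u := (z.1 - x.1) / t in let v := (z.2 - x.2) / t in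
  let b1 := bump u in let b2 := bump v in let d1 := dbump u in let d2 := dbump v in
  mx2 (M o0 o0 * (b1 * (b2 + (z.2 - x.2) * (d2 / t))) - M o0 o1 * (b1 * (z.1 - x.1) * (d2 / t)))
      (M o0 o1 * ((b1 + (z.1 - x.1) * (d1 / t)) * b2) - M o0 o0 * ((d1 / t) * (b2 * (z.2 - x.2))))
      (M o1 o0 * (b1 * (b2 + (z.2 - x.2) * (d2 / t))) - M o1 o1 * (b1 * (z.1 - x.1) * (d2 / t)))
      (M o1 o1 * ((b1 + (z.1 - x.1) * (d1 / t)) * b2) - M o1 o0 * ((d1 / t) * (b2 * (z.2 - x.2)))).
Proof.
have dP i := isdM (isd_bump1 x t i z) (isdM (isd_bump2 x t i z) (isd_sndB i z x.2)).
have dQ i := isdM (isdM (isd_bump1 x t i z) (isd_fstB i z x.1)) (isd_bump2 x t i z).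
rewrite /rot_field !(is_derive_partial (dP _)) !(is_derive_partial (dQ _)) ?ordE /= /bump1 /bump2.
generalize (bump ((z.1 - x.1) / t)) (bump ((z.2 - x.2) / t))
  (dbump ((z.1 - x.1) / t)) (dbump ((z.2 - x.2) / t)) => b1 b2 d1 d2.
by congr mx2; ring.
Qed.


Lemma dbump_in s : `|s| < 1 -> dbump s = 0.
Proof.
move=> hs; case: (is_derive_bump s) => _ <-.
rewrite (@near_eq_derive _ _ _ bump (fun=> 1)) ?derive_cst//.
have : \forall w \near s, `|w| < 1.
  apply/nbhs_ballP; exists (1 - `|s|); rewrite /= ?subr_gt0// => w /=.
  by rewrite /ball /= distrC => h; have := ler_normD (w - s) s; rewrite subrK; lra.
by apply: filterS => w /ltW; exact: bump_eq1.
Qed.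

Lemma bump_mul_le s : `|bump s * s| <= 2.
Proof.
have [hs|hs] := leP `|s| 2; last by rewrite bump_eq0 ?mul0r ?normr0 ?ltW.
rewrite normrM -[leRHS]mul1r ler_pM// ger0_norm ?bump_ge0//; exact: bump_le1.
Qed.

(** The bound is uniform in t: a derivative of a cut-off costs 1/t, but it is multiplied by a
    coordinate of z - x, which is at most 2t where that derivative does not vanish. The two products
    in each entry contribute 1 + 2C and 2C. *)
Lemma rot_field_bound : exists2 C : R, 0 <= C & forall x t (M : 'M[R]_2), 0 < t ->
  (forall i j, `|M i j| <= 1) -> entries_le (rot_field x t M) C.
Proof.
have [C C0 hC] := dbump_bounded.
exists (1 + 4 * C); first by rewrite addr_ge0// mulr_ge0.
move=> x t M t0 hM z.
rewrite rot_fieldE /=; set u := (z.1 - x.1) / t; set v := (z.2 - x.2) / t.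
have -> : z.1 - x.1 = u * t by rewrite /u divfK// gt_eqF.
have -> : z.2 - x.2 = v * t by rewrite /v divfK// gt_eqF.
have b1 s : `|bump s| <= 1 by rewrite ger0_norm ?bump_ge0 ?bump_le1.
have sd s : `|s * dbump s| <= 2 * C.
  have [hs|hs] := leP `|s| 2; last by rewrite dbump_off ?mulr0 ?normr0 ?mulr_ge0.
  by rewrite normrM ler_pM.
have E1 s (a : R) : s * t * (a / t) = s * a by field; rewrite gt_eqF.
have E2 (a b : R) : b * (a * t) * (dbump v / t) = b * a * dbump v by field; rewrite gt_eqF.
have E3 s (a b : R) : a / t * (b * (s * t)) = b * s * a by field; rewrite gt_eqF.
have bnd (m n a b : R) : `|m| <= 1 -> `|n| <= 1 -> `|a| <= 1 + 2 * C -> `|b| <= 2 * C ->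
    `|m * a - n * b| <= 1 + 4 * C.
  move=> hm hn ha hb; apply: le_trans (ler_normB _ _) _.
  have -> : 1 + 4 * C = 1 * (1 + 2 * C) + 1 * (2 * C) by ring.
  by rewrite !normrM lerD// ler_pM.
have h1 s a : `|bump a * (bump s + s * dbump s)| <= 1 + 2 * C.
  rewrite normrM -[leRHS]mul1r ler_pM//; apply: le_trans (ler_normD _ _) _.
  exact: lerD.
have h2 s a : `|bump a * a * dbump s| <= 2 * C.
  by rewrite normrM ler_pM// bump_mul_le.
move=> i j.
rewrite !E1 !E2 !E3; move: i j; elim/ord2_ind; elim/ord2_ind; rewrite mxE ?ordE.
- exact: bnd.
- by apply: bnd => //; rewrite mulrC.
- exact: bnd.
- by apply: bnd => //; rewrite mulrC.
Qed.

Definition osq x r : set T2 := [set z | `|z.1 - x.1| < r /\ `|z.2 - x.2| < r].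

Lemma osq_sub x r : osq x r `<=` sq x r.
Proof. by move=> z [/ltW ? /ltW ?]. Qed.

Lemma osqE x r : osq x r = (`]x.1 - r, x.1 + r[%classic `*` `]x.2 - r, x.2 + r[%classic).
Proof.
apply/seteqP; split => [z [h1 h2]|z [/= h1 h2]]; split => /=;
 move: h1 h2; rewrite ?in_itv/= !ltr_distl//.
Qed.

Lemma osq_open x r : open (osq x r).
Proof.
rewrite osqE (_ : _ `*` _ = (@fst R R @^-1` `]x.1 - r, x.1 + r[%classic) `&`
  (@snd R R @^-1` `]x.2 - r, x.2 + r[%classic))//.
by apply: openI; apply: open_comp; try exact: interval_open;
  move=> z _; [exact: cvg_fst|exact: cvg_snd].
Qed.

Lemma osq_center x r : 0 < r -> osq x r x.
Proof. by move=> r0; split; rewrite subrr normr0. Qed.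

Lemma rot_field_near x t M z : 0 < t -> osq x t z -> rot_field x t M z = M.
Proof.
move=> t0 [h1 h2]; rewrite rot_fieldE /=.
have hu : `|(z.1 - x.1) / t| < 1 by rewrite normrM normfV (gtr0_norm t0) ltr_pdivrMr ?mul1r.
have hv : `|(z.2 - x.2) / t| < 1 by rewrite normrM normfV (gtr0_norm t0) ltr_pdivrMr ?mul1r.
rewrite !dbump_in// !bump_eq1 ?(ltW hu) ?(ltW hv)//.
rewrite [RHS]mx2E; congr mx2; ring.
Qed.

Lemma rot_field_off x t M z : 0 < t -> ~ sq x (2 * t) z -> rot_field x t M z = 0.
Proof.
move=> t0 h; rewrite rot_fieldE /=; set u := (z.1 - x.1) / t; set v := (z.2 - x.2) / t.
have off s : 2 < `|s| -> bump s = 0 /\ dbump s = 0.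
  by move=> hs; rewrite dbump_off ?bump_eq0 ?ltW.
have [hu|hu] := leP `|u| 2; last first.
  have [-> ->] := off _ hu; apply/matrixP; elim/ord2_ind; elim/ord2_ind; rewrite !mxE ?ordE; ring.
have [hv|hv] := leP `|v| 2; last first.
  have [-> ->] := off _ hv; apply/matrixP; elim/ord2_ind; elim/ord2_ind; rewrite !mxE ?ordE; ring.
case: h; split.
  by move: hu; rewrite /u normrM normfV (gtr0_norm t0) ler_pdivrMr.
by move: hv; rewrite /v normrM normfV (gtr0_norm t0) ler_pdivrMr.
Qed.

Lemma compact_setD_open K A : compact K -> open A -> compact (K `\` A).
Proof.
move=> cK oA; rewrite setDE; apply: compact_closedI => //.
exact: open_closedC.
Qed.

Opaque rot_field.

(** * Absence of atoms *)

Section no_atoms.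
Variables (Omega : set T2) (I : (T2 -> R) -> R) (E : R).
Hypothesis oO : open Omega.
Hypothesis tI : testform Omega I.
Hypothesis hE : hessian_bound Omega I E.

(** Take a field [F0] in the punctured square whose pairing is within c of the supremum. Its support
    is compact and avoids x, so a field [G] closer to x can be added with all entries still at most
    1. The pairing of the sum does not exceed the supremum, hence that of [G] is at most c. *)
Lemma punctured_small x (c : R) : Omega x -> 0 < c ->
  exists r, [/\ 0 < r, sq x r `<=` Omega &
    forall G, tfield (sq x r `\ x) G -> entries_le G 1 -> I (dd G) <= c].
Proof.
move=> Ox c0; have [r [r0 hr]] := nbhs_sq (open_nbhs_nbhs (conj oO Ox)).
pose A := sq x r `\ x.
have AO : A `<=` Omega by move=> z [/hr].
pose S := [set I (dd F) | F in [set F | tfield A F /\ entries_le F 1]].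
have S0 : S 0.
  exists (fun=> 0); last first.
    by rewrite dd0 (tf0 tI).
  split; last by move=> z i j; rewrite mxE normr0.
  by split; [exact: smooth_field_cst|exists set0; split => //; exact: compact0].
have hS : has_sup S.
  split; first by exists 0.
  exists E => _ [F [tF hF] <-]; rewrite -[E]mulr1; apply: hE => //.
  exact: tfieldS tF.
have [_ [F0 [tF0 hF0] <-] hsup] := sup_adherent c0 hS.
have [sF0 [K [cK KA hK]]] := tF0.
have nKx : ~ K x by move=> /KA [_]; apply.
have oKc : open (~` K) by apply: closed_openC; exact: compact_closedT2.
have [t [t0 ht]] := nbhs_sq (open_nbhs_nbhs (conj oKc nKx)).
exists (Num.min r t); split; first by rewrite lt_min r0.
  by apply: subset_trans hr; apply: sqS; rewrite ge_min lexx.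
move=> G [sG [L [cL LA hL]]] hG.
have tG : tfield A G.
  split=> //; exists L; split => // z /LA [h zx]; split=> //.
  by apply: sqS h; rewrite ge_min lexx.
have : S (I (dd (fun z => F0 z + G z))).
  have tFG := tfieldD tF0 tG.
  refine (ex_intro2 _ _ _ (conj tFG _) erefl).
  move=> z i j; rewrite mxDE; have [Kz|nKz] := pselect (K z); last first.
    have -> : F0 z i j = 0 by rewrite (hK _ nKz) mxE.
    by rewrite add0r; exact: hG.
  have -> : G z i j = 0.
    rewrite (hL z) ?mxE// => /LA [h _]; apply: (ht z) => //.
    by apply: sqS h; rewrite ge_min lexx orbT.
  by rewrite addr0; exact: hF0.
move=> /(sup_upper_bound hS) h.
have e := tf_ddD tI (tfieldS AO tF0) (tfieldS AO tG).
have h' : I (dd F0) + I (dd G) <= sup S := eq_ind _ (fun w => w <= sup S) h _ e.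
rewrite -(lerD2l (I (dd F0))); apply: (le_trans h').
by rewrite -lerBlDr; exact: ltW hsup.
Qed.

(* The Hessian of a function on the plane has no atoms: near [x] a field [F]
   may be replaced by the double-divergence-free [rot_field] with value [F x]. *)
Lemma no_atom x (c : R) : Omega x -> 0 < c ->
  exists r, [/\ 0 < r, sq x r `<=` Omega &
    forall F s, 0 <= s -> tfield (sq x r) F -> entries_le F s -> I (dd F) <= c * s].
Proof.
move=> Ox c0; have E0 := hessian_bound_ge0 tI hE.
have [C C0 hC] := rot_field_bound.
have den : 0 < 3 + E + C by rewrite ltr_pwDl// ltr_pwDl.
have [d [d0 cE]] : exists d : R, 0 < d /\ d * (3 + E + C) = c.
  by exists (c / (3 + E + C)); rewrite divr_gt0// divfK// gt_eqF.
have fin (a1 a2 a3 : R) : a1 <= d -> a2 <= E * d -> a3 <= d * (1 + C) -> a1 + (a2 + a3) <= c.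
  rewrite -cE => ? ? ?.
  have -> : d * (3 + E + C) = d + (E * d + d * (1 + C)) + d by ring.
  by apply: ler_wpDr; [exact: ltW|apply: lerD => //; exact: lerD].
have [r [r0 hr hsmall]] := punctured_small Ox d0.
suff main F : tfield (sq x r) F -> entries_le F 1 -> I (dd F) <= c.
  by exists r; split=> // F s; exact: (tf_homogeneous tI).
move=> tF hF; have [sF [K [cK KA hK]]] := tF.
pose M := F x.
have : \forall z \near x, forall i j, `|F z i j - M i j| < d.
  have H i j : \forall z \near x, `|F z i j - M i j| < d.
    have cF : continuous (fun z => F z i j) := smooth_continuous (sF i j).
    have := cF x; move=> /cvgrPdist_lt /(_ d d0).
    by apply: filterS => z; rewrite distrC.
  have := H o0 o0; have := H o0 o1; have := H o1 o0; have := H o1 o1.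
  move=> h1 h2 h3 h4; near=> z.
  by elim/ord2_ind; elim/ord2_ind; near: z.
move=> /nbhs_sq [t1 [t10 ht1]].
pose t := Num.min t1 r / 2.
have t0 : 0 < t by rewrite divr_gt0// lt_min t10.
have tt1 : 2 * t <= t1 by rewrite /t mulrC divfK// ge_min lexx.
have tr : 2 * t <= r by rewrite /t mulrC divfK// ge_min lexx orbT.
(* [F] is [F1 + F2 + F3] plus the [rot_field]. [F1] and [F3] vanish near x, so that
   [punctured_small] applies; [F2] has entries at most d, since [F] is within d of M on the support
   of the cut-off; the last field has double divergence 0. *)
pose F1 z : 'M[R]_2 := (1 - cut x t z) *: F z.
pose F2 z : 'M[R]_2 := cut x t z *: (F z - M).
pose F3 z : 'M[R]_2 := cut x t z *: M - rot_field x t M z.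
have sM := smooth_field_cst M.
have s1c : smooth (fun z => 1 - cut x t z).
  exact: (smoothB (smooth_cst 1) (smooth_cut x t)).
have oA : open (osq x t) := @osq_open x t.
have sqA : sq x (2 * t) `<=` sq x r by exact: sqS.
have tF1 : tfield (sq x r `\ x) F1.
  split; first exact: smooth_fieldZ.
  exists (K `\` osq x t); split; first exact: compact_setD_open.
    move=> z [/KA Kz h]; split => // zx; apply: h; rewrite zx; exact: osq_center.
  move=> z nz; rewrite /F1; have [Kz|/hK ->] := pselect (K z); last by rewrite scaler0.
  rewrite cut_eq1 ?subrr ?scale0r//; apply: osq_sub; apply: contrapT => h.
  exact: nz.
have sFM : smooth_field (fun z => F z - M).
  exact: (smooth_fieldD sF (smooth_fieldN sM)).
have tF2 : tfield (sq x r) F2 by exact: tfield_cut.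
have tF3 : tfield (sq x r `\ x) F3.
  split.
    exact: (smooth_fieldD (smooth_fieldZ (smooth_cut x t) sM)
      (smooth_fieldN (@smooth_rot_field x t M))).
  exists (sq x (2 * t) `\` osq x t); split.
  - by apply: compact_setD_open => //; exact: sq_compact.
  - by move=> z [/sqA h1 h2]; split=> // zx; apply: h2; rewrite zx; exact: osq_center.
  - move=> z nz; rewrite /F3; have [h|h] := pselect (sq x (2 * t) z); last first.
      by rewrite cut_eq0// scale0r rot_field_off// subr0.
    have oz : osq x t z by apply: contrapT => h'; apply: nz.
    by rewrite cut_eq1 ?scale1r; [rewrite rot_field_near// subrr| |exact: osq_sub].
have tR : tfield (sq x r) (rot_field x t M).
  split; first exact: smooth_rot_field.
  exists (sq x (2 * t)); split => //; first exact: sq_compact.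
  by move=> z; exact: rot_field_off.
have pS : sq x r `\ x `<=` Omega by move=> z [/hr].
have FE : F = fun z => F1 z + (F2 z + (F3 z + rot_field x t M z)).
  apply: funext => z; rewrite /F1 /F2 /F3 subrK scalerBl scale1r scalerBr.
  by rewrite subrK subrK.
have tF1O := tfieldS pS tF1; have tF2O := tfieldS hr tF2.
have tF3O := tfieldS pS tF3; have tRO := tfieldS hr tR.
have tRF := tfieldD tF3O tRO.
have e1 := tf_ddD tI tF1O (tfieldD tF2O tRF).
have e2 := tf_ddD tI tF2O tRF.
have e3 : I (dd (fun z => F3 z + rot_field x t M z)) = I (dd F3).
  by apply: etrans (tf_ddD tI tF3O tRO) _; rewrite dd_rot_field (tf0 tI) addr0.
have -> : I (dd F) = I (dd F1) + (I (dd F2) + I (dd F3)) :=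
  etrans (congr1 (fun G => I (dd G)) FE) (etrans e1 (congr1 (+%R (I (dd F1)))
    (etrans e2 (congr1 (+%R (I (dd F2))) e3)))).
have hF1 : entries_le F1 1.
  move=> z i j; rewrite mxZE normrM -[leRHS]mul1r.
  exact: (ler_pM (normr_ge0 _) (normr_ge0 _) (onem_cut_norm x t z) (hF z i j)).
have hF2 : entries_le F2 d.
  move=> z i j; rewrite /F2 mxZE mxBE normrM -[leRHS]mul1r.
  have [h|h] := pselect (sq x (2 * t) z).
    apply: (ler_pM (normr_ge0 _) (normr_ge0 _) (cut_norm x t z)).
    by apply/ltW/ht1; exact: sqS h.
  rewrite (cut_eq0 t0 h) normr0 mul0r mul1r; exact: ltW d0.
have M1 i j : `|M i j| <= 1 by exact: hF.
have hF3 : entries_le F3 (1 + C).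
  move=> z i j; rewrite /F3 mxBE mxZE; apply: le_trans (ler_normB _ _) _.
  apply: lerD; last exact: hC.
  rewrite normrM -[leRHS]mul1r.
  exact: (ler_pM (normr_ge0 _) (normr_ge0 _) (cut_norm x t z) (M1 i j)).
have h1 := hsmall _ tF1 hF1.
have h2 := hE tF2O hF2.
have h3 : I (dd F3) <= d * (1 + C).
  by apply: (tf_homogeneous tI pS hsmall _ tF3 hF3); rewrite addr_ge0.
exact: fin.
Unshelve. all: by end_near. Qed.

End no_atoms.

End test_forms.

(** * Joint continuity of the kernels in position and parameter *)

Section joint_continuity.
Context {R : realType}.
Local Notation T2 := (R * R)%type.
Local Notation Q := (T2 * (T2 * R))%type.
Implicit Types (z x y : T2) (e s : R) (K : set T2) (w : Q).

(** Compactness in its covering form: control on a neighbourhood of each z, jointly with the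
    parameter, becomes control for all z of K simultaneously. Uniform continuity and locally uniform
    limits below are all instances of it. *)
Lemma near_uniform (P : Type) (F : set_system P) (K : set T2) (phi : T2 -> P -> R)
    (psi : T2 -> R) (s : R) : Filter F -> compact K ->
  (forall z, K z -> \forall z' \near z & p \near F, `|phi z' p - psi z'| < s) ->
  \forall p \near F, forall z, K z -> `|phi z p - psi z| < s.
Proof.
move=> FF /compact_near_coveringP cK H.
exact: (cK _ F (fun p z => `|phi z p - psi z| < s)).
Qed.

Lemma cvg_at_D (T : topologicalType) (t : T) (f g : T -> R) :
  {for t, continuous f} -> {for t, continuous g} -> {for t, continuous (fun u => f u + g u)}.
Proof. exact: (@continuousD _ _ _ f g). Qed.

Lemma cvg_at_M (T : topologicalType) (t : T) (f g : T -> R) :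
  {for t, continuous f} -> {for t, continuous g} -> {for t, continuous (fun u => f u * g u)}.
Proof. exact: (@continuousM _ _ f g). Qed.

Lemma cvg_at_N (T : topologicalType) (t : T) (f : T -> R) :
  {for t, continuous f} -> {for t, continuous (fun u => - f u)}.
Proof. exact: (@continuousN _ _ _ f). Qed.

Lemma cvg_at_V (T : topologicalType) (t : T) (f : T -> R) : f t != 0 ->
  {for t, continuous f} -> {for t, continuous (fun u => (f u)^-1)}.
Proof. exact: (@continuousV _ _ f). Qed.

Lemma cvg_at_C (T : topologicalType) (t : T) (c : R) : {for t, continuous (fun=> c)}.
Proof. exact: cst_continuous. Qed.

Lemma cvg_at_z1 w : {for w, continuous (fun w : Q => w.1.1 - w.2.1.1)}.
Proof.
apply: cvg_at_D; last apply: cvg_at_N.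
  by apply: (@continuous_comp Q T2 R fst fst); exact: cvg_fst.
apply: (@continuous_comp Q (T2 * R)%type R snd (fun v => v.1.1)); first exact: cvg_snd.
by apply: (@continuous_comp (T2 * R)%type T2 R fst fst); exact: cvg_fst.
Qed.

Lemma cvg_at_z2 w : {for w, continuous (fun w : Q => w.1.2 - w.2.1.2)}.
Proof.
apply: cvg_at_D; last apply: cvg_at_N.
  by apply: (@continuous_comp Q T2 R fst snd); [exact: cvg_fst|exact: cvg_snd].
apply: (@continuous_comp Q (T2 * R)%type R snd (fun v => v.1.2)); first exact: cvg_snd.
by apply: (@continuous_comp (T2 * R)%type T2 R fst snd); [exact: cvg_fst|exact: cvg_snd].
Qed.

Lemma cvg_at_e w : {for w, continuous (fun w : Q => w.2.2)}.
Proof. by apply: (@continuous_comp Q (T2 * R)%type R snd snd); exact: cvg_snd. Qed.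

Lemma cvg_at_qden w : {for w, continuous (fun w : Q => qden w.2.1 w.2.2 w.1)}.
Proof.
apply: cvg_at_D; last exact: (cvg_at_M (@cvg_at_e w) (@cvg_at_e w)).
exact: (cvg_at_D (cvg_at_M (@cvg_at_z1 w) (@cvg_at_z1 w)) (cvg_at_M (@cvg_at_z2 w) (@cvg_at_z2 w))).
Qed.

Section at_point.
Variable w : Q.
Hypothesis qw : qden w.2.1 w.2.2 w.1 != 0.

Let cV : {for w, continuous (fun w : Q => (qden w.2.1 w.2.2 w.1)^-1)}.
Proof. exact: (@cvg_at_V _ w (fun w : Q => qden w.2.1 w.2.2 w.1) qw (@cvg_at_qden w)). Qed.

Let c1 := @cvg_at_z1 w.
Let c2 := @cvg_at_z2 w.
Let ce := @cvg_at_e w.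

Lemma cvg_at_kerA : {for w, continuous (fun w : Q => kerA w.2.1 w.2.2 w.1)}.
Proof.
exact: (cvg_at_M (cvg_at_D (cvg_at_M c1 c1) (cvg_at_N (cvg_at_M c2 c2))) cV).
Qed.

Lemma cvg_at_kerB : {for w, continuous (fun w : Q => kerB w.2.1 w.2.2 w.1)}.
Proof. exact: (cvg_at_M (cvg_at_M (@cvg_at_C _ w 2) (cvg_at_M c1 c2)) cV). Qed.

Lemma cvg_at_gradA : {for w, continuous (fun w : Q => gradA w.2.1 w.2.2 w.1)}.
Proof.
exact: (cvg_at_M (cvg_at_M (cvg_at_M (@cvg_at_C _ w 2) c1) cV)
  (cvg_at_D (@cvg_at_C _ w 1) (cvg_at_M (cvg_at_M ce ce) cV))).
Qed.

Lemma cvg_at_gradB : {for w, continuous (fun w : Q => gradB w.2.1 w.2.2 w.1)}.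
Proof.
exact: (cvg_at_M (cvg_at_M (cvg_at_M (@cvg_at_C _ w 2) c2) cV)
  (cvg_at_D (@cvg_at_C _ w 1) (cvg_at_M (cvg_at_M ce ce) cV))).
Qed.

Lemma cvg_at_eta : {for w, continuous (fun w : Q => eta w.2.1 w.2.2 w.1)}.
Proof.
rewrite (_ : (fun w : Q => eta _ _ _) = fun w : Q =>
   8 * (w.2.2 * (w.2.2 * (w.2.2 * w.2.2))) * ((qden w.2.1 w.2.2 w.1)^-1 *
    ((qden w.2.1 w.2.2 w.1)^-1 * (qden w.2.1 w.2.2 w.1)^-1))); last first.
  by apply: funext => v; rewrite /eta !exprS !expr0 !mulr1.
have V3 := cvg_at_M cV (cvg_at_M cV cV).
apply: cvg_at_M V3; apply: cvg_at_M; first exact: cvg_at_C.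
exact: (cvg_at_M ce (cvg_at_M ce (cvg_at_M ce ce))).
Qed.

Lemma cvg_at_lift (f : T2 -> R) : {for w.1, continuous f} ->
  {for w, continuous (fun w : Q => f w.1)}.
Proof.
by move=> cf; apply: (@continuous_comp Q T2 R fst f w); [exact: cvg_fst|exact: cf].
Qed.

Lemma cvg_at_kerrem chi : smooth chi ->
  {for w, continuous (fun w : Q => kerrem chi w.2.1 w.2.2 w.1)}.
Proof.
move=> sc.
have L (f : T2 -> R) : smooth f -> {for w, continuous (fun w : Q => f w.1)}.
  by move=> sf; apply: cvg_at_lift; exact: (smooth_continuous sf).
have l i := L _ (smooth_partial i sc).
have ll i j := L _ (smooth_partial i (smooth_partial j sc)).
exact: (cvg_at_D (cvg_at_D
  (cvg_at_M (cvg_at_D (ll o0 o0) (cvg_at_N (ll o1 o1))) cvg_at_kerA)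
  (cvg_at_M (cvg_at_D (ll o0 o1) (ll o1 o0)) cvg_at_kerB))
  (cvg_at_M (@cvg_at_C _ w 2) (cvg_at_D (cvg_at_M (l o0) cvg_at_gradA) (cvg_at_M (l o1) cvg_at_gradB)))).
Qed.

End at_point.

Lemma qden_neq x e z : z <> x -> qden x e z != 0.
Proof.
move=> zx; rewrite lt0r_neq0// ltr_pwDl ?sqr_ge0// lt_neqAle addr_ge0 ?sqr_ge0// andbT.
rewrite eq_sym paddr_eq0 ?sqr_ge0// !sqrf_eq0 !subr_eq0; apply/negP => /andP[/eqP h1 /eqP h2].
by apply: zx; case: z x h1 h2 => [? ?] [? ?] /= -> ->.
Qed.

(** Made for the parameter value e = 0: the kernels are jointly continuous there at every z other
    than x, so they converge uniformly on compact sets avoiding x as (y, e) tends to (x, 0). *)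
Lemma uniform_at K (phi : T2 -> T2 -> R -> R) x s : 0 < s -> compact K ->
  (forall z, K z -> {for (z, (x, 0)), continuous (fun w : Q => phi w.1 w.2.1 w.2.2)}) ->
  exists d : R, 0 < d /\ forall y e, sq x d y -> `|e| <= d ->
    forall z, K z -> `|phi z y e - phi z x 0| < s.
Proof.
move=> s0 cK H.
have : \forall p \near (x, 0 : R), forall z, K z -> `|phi z p.1 p.2 - phi z x 0| < s.
  apply: (@near_uniform (T2 * R)%type (nbhs (x, 0 : R)) K (fun z p => phi z p.1 p.2) (fun z => phi z x 0) s) => // z Kz.
  have s2 : 0 < s / 2 by rewrite divr_gt0.
  have := H z Kz; move=> /cvgrPdist_lt /(_ _ s2) /= [[U V] [/= nU nV] hUV].
  exists (U, V) => // -[z' p] [/= Uz' Vp].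
  have h1 := hUV (z', p) (conj Uz' Vp).
  have h2 := hUV (z', (x, 0)) (conj Uz' (nbhs_singleton nV)).
  rewrite /= in h1 h2; rewrite distrC in h1.
  rewrite -(subrKA (phi z x 0)); apply: le_lt_trans (ler_normD _ _) _.
  by rewrite [s]splitr ltrD.
move=> [[U V] [/= nU nV] hUV].
have [d1 [d10 h1]] := nbhs_sq nU.
have [d2 /= d20 h2] := (nbhs_ballP _ _).1 nV.
exists (Num.min d1 (d2 / 2)); split; first by rewrite lt_min d10 divr_gt0.
move=> y e hy he z Kz; apply: (hUV (y, e)) => //; split => /=.
  by apply: h1; apply: sqS hy; rewrite ge_min lexx.
apply: h2; rewrite /ball /= sub0r normrN; apply: le_lt_trans he _.
by rewrite gt_min; apply/orP; right; lra.
Qed.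

End joint_continuity.

Global Opaque kerA kerB gradA gradB qden eta ker kerrem.

(** * Point values of a form *)

Section point_values.
Context {R : realType}.
Local Notation T2 := (R * R)%type.
Implicit Types (z x y : T2) (e s c d : R) (K A Omega : set T2) (chi : T2 -> R).

(** More general than [cut x r], so that a single function is a cut-off at all points near x, as
    [cutoff_cut] records. Continuity of the point values rests on this freedom. *)
Definition cutoff Omega x chi := [/\ smooth chi, forall z, `|chi z| <= 1,
  exists K, [/\ compact K, K `<=` Omega & forall z, ~ K z -> chi z = 0] &
  exists2 r, 0 < r & forall z, sq x r z -> chi z = 1].

Lemma cutoff_cut Omega x y r : 0 < r -> sq x (2 * r) `<=` Omega -> osq x r y ->
  cutoff Omega y (cut x r).
Proof.
move=> r0 hO oy; split.
- exact: smooth_cut.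
- by move=> z; exact: cut_norm.
- exists (sq x (2 * r)); split=> //; first exact: sq_compact.
  by move=> z; exact: cut_eq0.
- have [d [d0 hd]] := nbhs_sq (open_nbhs_nbhs (conj (@osq_open _ x r) oy)).
  by exists d => // z /hd /osq_sub; exact: cut_eq1.
Qed.

Lemma kerrem_near chi x r y e z : smooth chi -> (forall w, sq x r w -> chi w = 1) ->
  osq x r z -> kerrem chi y e z = 0.
Proof.
move=> sc h1 oz.
have P0 i : forall w, osq x r w -> partial i chi w = 0.
  move=> w ow; rewrite -(f_equal (@^~ w) (partial_cst i (1 : R))); apply: partial_near.
  apply: filterS (open_nbhs_nbhs (conj (@osq_open _ x r) ow)) => v /osq_sub; exact: h1.
have P1 i j : partial i (partial j chi) z = 0.
  rewrite -(f_equal (@^~ z) (partial_cst i (0 : R))); apply: partial_near.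
  by apply: filterS (open_nbhs_nbhs (conj (@osq_open _ x r) oz)) => v; exact: P0.
by rewrite kerremE !P0// !P1 subrr addr0 !mul0r addr0 add0r mulr0.
Qed.

Lemma kerrem_off chi K y e z : compact K -> (forall w, ~ K w -> chi w = 0) ->
  ~ K z -> kerrem chi y e z = 0.
Proof.
move=> /compact_closedT2 cK h nz.
have P0 i := @partial_off _ i _ _ cK h.
have P1 i j := @partial_off _ i _ _ cK (P0 j).
by rewrite kerremE !P0// !P1// subrr addr0 !mul0r addr0 add0r mulr0.
Qed.

Section testform_at.
Variables (Omega : set T2) (I : (T2 -> R) -> R) (E : R).
Hypothesis oO : open Omega.
Hypothesis tI : testform Omega I.
Hypothesis hE : hessian_bound Omega I E.

Section at_cutoff.
Variables (x : T2) (chi : T2 -> R).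
Hypothesis hchi : cutoff Omega x chi.

Lemma tfield_chi_ker y e : e != 0 -> tfield Omega (fun z => chi z *: ker y e z).
Proof.
move=> e0; have [sc _ [K [cK KO hK]] _] := hchi; split.
  exact: (smooth_fieldZ sc (smooth_ker y e0)).
by exists K; split=> // z /hK ->; rewrite scale0r.
Qed.

Lemma testfun_chi_eta y e : e != 0 -> testfun Omega (fun z => chi z * eta y e z).
Proof.
move=> e0; have [sc _ [K [cK KO hK]] _] := hchi; split.
  exact: (smooth_continuous (smoothM sc (smooth_eta y e0))).
by exists K; split=> // z /hK ->; rewrite mul0r.
Qed.

Lemma testfun_kerrem y e : e != 0 -> testfun Omega (kerrem chi y e).
Proof.
move=> e0; have [sc _ [K [cK KO hK]] _] := hchi; split; last first.
  by exists K; split=> // z nz; exact: (kerrem_off _ _ cK hK nz).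
have := dd_testfun (tfield_chi_ker y e0); rewrite (dd_cut_ker y e0 sc) => h.
have := testfunB h (testfun_chi_eta y e0) => -[c _].
rewrite (_ : kerrem chi y e = fun z =>
  chi z * eta y e z + kerrem chi y e z - chi z * eta y e z)//.
by apply: funext => z; rewrite addrC addKr.
Qed.

Lemma testfun_kerrem0 : testfun Omega (kerrem chi x 0).
Proof.
have [sc _ [K [cK KO hK]] [r r0 h1]] := hchi; split; last first.
  by exists K; split=> // z nz; exact: (kerrem_off _ _ cK hK nz).
move=> z; have [->|zx] := pselect (z = x).
  apply: (@cvg_near_cst _ _ _ _ _ _); apply: filterS (open_nbhs_nbhs (conj (@osq_open _ x r) (osq_center x r0))).
  by move=> w ow; rewrite !(kerrem_near _ _ sc h1)//; exact: osq_center.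
have := @cvg_at_kerrem R (z, (x, 0)) (qden_neq 0 zx) chi sc.
move=> /(@continuous_comp T2 _ R (fun z => (z, (x, 0 : R)))); apply.
move=> U [[A B] [/= nA nB] hU].
by apply: filterS nA => w Aw; apply: hU; split => //=; exact: nbhs_singleton nB.
Qed.

Lemma dd_decomp y e : e != 0 ->
  I (dd (fun z => chi z *: ker y e z)) = I (fun z => chi z * eta y e z) + I (kerrem chi y e).
Proof.
move=> e0; have [sc _ _ _] := hchi.
by rewrite (dd_cut_ker y e0 sc) (tfD tI (testfun_chi_eta y e0) (testfun_kerrem y e0)).
Qed.

(** The remainder vanishes off the support of [chi] and also near x, where [chi] is 1. On the
    compact ring in between it converges uniformly, and the form is continuous for such
    convergence. *)
Lemma kerrem_close c : 0 < c -> exists d, 0 < d /\ forall y e, sq x d y -> e != 0 -> `|e| <= d ->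
  `|I (kerrem chi y e) - I (kerrem chi x 0)| <= c.
Proof.
move=> c0; have [sc _ [K [cK KO hK]] [r r0 h1]] := hchi.
have [C C0 hC] := tf_bnd tI cK KO.
have s0 : 0 < c / (C + 1) by rewrite divr_gt0// ltr_wpDl.
have cK' := compact_setD_open cK (@osq_open _ x r).
have [d [d0 hd]] : exists d : R, 0 < d /\ forall y e, sq x d y -> `|e| <= d ->
    forall z, (K `\` osq x r) z -> `|kerrem chi y e z - kerrem chi x 0 z| < c / (C + 1).
  apply: uniform_at => // z [_ nz].
  have zx : z <> x by move=> zx; apply: nz; rewrite zx; exact: osq_center.
  exact: (@cvg_at_kerrem R (z, (x, 0)) (qden_neq 0 zx) chi sc).
exists d; split=> // y e hy e0 he.
rewrite -(tfB tI (testfun_kerrem y e0) testfun_kerrem0).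
have [cf _] := testfunB (testfun_kerrem y e0) testfun_kerrem0.
have : `|I (fun z => kerrem chi y e z - kerrem chi x 0 z)| <= C * (c / (C + 1)).
  apply: hC => //.
    by move=> z nz; rewrite !(kerrem_off _ _ cK hK nz) subrr.
  move=> z; have [Kz|nz] := pselect (K z); last first.
    by rewrite !(kerrem_off _ _ cK hK nz) subrr normr0 ltW.
  have [oz|noz] := pselect (osq x r z); last by apply/ltW/hd.
  by rewrite !(kerrem_near _ _ sc h1 oz) subrr normr0 ltW.
move=> h; apply: (le_trans h).
by rewrite mulrCA -[leRHS]mulr1 ler_wpM2l ?ltW// ltr_pdivrMr ?ltr_wpDl// mul1r ltrDl.
Qed.

Lemma ker_close r (s : R) : 0 < r -> 0 < s -> exists d, 0 < d /\
  forall y e, sq x d y -> e != 0 -> `|e| <= d ->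
  forall y' e', sq x d y' -> e' != 0 -> `|e'| <= d ->
  entries_le (fun z => (1 - cut x r z) *: (chi z *: ker y e z - chi z *: ker y' e' z)) s.
Proof.
move=> r0 s0; have [sc c1 [K [cK KO hK]] _] := hchi.
have s2 : 0 < s / 2 by rewrite divr_gt0.
have cK' := compact_setD_open cK (@osq_open _ x r).
have zx z : (K `\` osq x r) z -> z <> x.
  by move=> [_ nz] zx; apply: nz; rewrite zx; exact: osq_center.
have [d1 [d10 h1]] : exists d : R, 0 < d /\ forall y e, sq x d y -> `|e| <= d ->
    forall z, (K `\` osq x r) z -> `|kerA y e z - kerA x 0 z| < s / 2.
  by apply: uniform_at => // z /zx h; exact: (@cvg_at_kerA R (z, (x, 0)) (qden_neq 0 h)).
have [d2 [d20 h2]] : exists d : R, 0 < d /\ forall y e, sq x d y -> `|e| <= d ->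
    forall z, (K `\` osq x r) z -> `|kerB y e z - kerB x 0 z| < s / 2.
  by apply: uniform_at => // z /zx h; exact: (@cvg_at_kerB R (z, (x, 0)) (qden_neq 0 h)).
exists (Num.min d1 d2); split; first by rewrite lt_min d10.
move=> y e hy e0 he y' e' hy' e0' he' z.
have m1 : Num.min d1 d2 <= d1 by rewrite ge_min lexx.
have m2 : Num.min d1 d2 <= d2 by rewrite ge_min lexx orbT.
have two (a b l : R) : `|a - l| < s / 2 -> `|b - l| < s / 2 -> `|a - b| <= s.
  move=> ha hb; rewrite -(subrKA l); apply: le_trans (ler_normD _ _) _.
  by rewrite [s]splitr lerD// ltW// distrC.
move=> i j; rewrite mxZE -scalerBr mxZE mulrA normrM.
have [Kz|nz] := pselect (K z); last by rewrite hK// mulr0 normr0 mul0r ltW.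
have [oz|noz] := pselect (osq x r z).
  by rewrite cut_eq1// ?subrr ?mul0r ?normr0 ?mul0r ?ltW//; exact: osq_sub.
have hA : `|kerA y e z - kerA y' e' z| <= s.
  by apply: (two _ _ (kerA x 0 z)); apply: h1 => //; [exact: sqS hy|exact: le_trans he _|exact: sqS hy'|exact: le_trans he' _].
have hB : `|kerB y e z - kerB y' e' z| <= s.
  by apply: (two _ _ (kerB x 0 z)); apply: h2 => //; [exact: sqS hy|exact: le_trans he _|exact: sqS hy'|exact: le_trans he' _].
have hker : `|(ker y e z - ker y' e' z) i j| <= s.
  rewrite mxBE !kerE; move: i j; elim/ord2_ind; elim/ord2_ind; rewrite !mxE ?ordE//.
  by rewrite -opprD normrN.
rewrite -[leRHS]mul1r; apply: ler_pM => //.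
by rewrite normrM -[leRHS]mul1r ler_pM// onem_cut_norm.
Qed.

(** The difference [D] of two cut-off kernels is split by a smaller cut-off at x. The part near x
    has entries at most 2, however small e is, and is controlled by the absence of atoms; the part
    away from x has uniformly small entries and is controlled by the Hessian bound. The remainders
    converge by [kerrem_close]. *)
Lemma eta_cauchy c : Omega x -> 0 < c -> exists d, 0 < d /\
  forall y e, sq x d y -> e != 0 -> `|e| <= d ->
  forall y' e', sq x d y' -> e' != 0 -> `|e'| <= d ->
  `|I (fun z => chi z * eta y e z) - I (fun z => chi z * eta y' e' z)| <= c.
Proof.
move=> Ox c0; have E0 := hessian_bound_ge0 tI hE.
have [sc c1 _ _] := hchi.
have c4 : 0 < c / 4 by rewrite divr_gt0.
have c8 : 0 < c / 8 by rewrite divr_gt0.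
have [r [r0 hr hsm]] := no_atom oO tI hE Ox c8.
have s0 : 0 < (c / 4) / (E + 1) by rewrite divr_gt0// ltr_wpDl.
have r2 : 0 < r / 2 by rewrite divr_gt0.
have [d1 [d10 h1]] := ker_close r2 s0.
have [d2 [d20 h2]] := kerrem_close c8.
have Es : E * ((c / 4) / (E + 1)) <= c / 4.
  by rewrite mulrCA -[leRHS]mulr1 ler_wpM2l ?ltW// ltr_pdivrMr ?ltr_wpDl// mul1r ltrDl.
exists (Num.min d1 d2); split; first by rewrite lt_min d10.
move=> y e hy e0 he y' e' hy' e0' he'.
have m1 : Num.min d1 d2 <= d1 by rewrite ge_min lexx.
have m2 : Num.min d1 d2 <= d2 by rewrite ge_min lexx orbT.
have k1 := h1 _ _ (sqS m1 hy) e0 (le_trans he m1) _ _ (sqS m1 hy') e0' (le_trans he' m1).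
have k2 := h2 _ _ (sqS m2 hy) e0 (le_trans he m2).
have k3 := h2 _ _ (sqS m2 hy') e0' (le_trans he' m2).
have d1E := dd_decomp y e0; have d2E := dd_decomp y' e0'.
have tK := tfield_chi_ker y e0; have tK' := tfield_chi_ker y' e0'.
pose D z : 'M[R]_2 := chi z *: ker y e z - chi z *: ker y' e' z.
have tD : tfield Omega D := tfieldB tK tK'.
have dDE : I (dd D) = I (dd (fun z => chi z *: ker y e z)) -
    I (dd (fun z => chi z *: ker y' e' z)) := tf_ddB tI tK tK'.
pose D1 z : 'M[R]_2 := cut x (r / 2) z *: D z.
pose D2 z : 'M[R]_2 := (1 - cut x (r / 2) z) *: D z.
have r22 : 2 * (r / 2) = r by rewrite mulrC divfK.
have tD1 : tfield (sq x r) D1.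
  by apply: tfield_cut => //; [rewrite r22|exact: tD.1].
have tD1O := tfieldS hr tD1.
have tD2 : tfield Omega D2.
  exact: (tfieldZ (smoothB (smooth_cst 1) (smooth_cut x (r / 2))) tD).
have DE : D = fun z => D1 z + D2 z.
  by apply: funext => z; rewrite /D1 /D2 scalerBl scale1r addrC subrK.
have dDE2 : I (dd D) = I (dd D1) + I (dd D2) := etrans (congr1 (fun G => I (dd G)) DE)
  (tf_ddD tI tD1O tD2).
have hD z i j : `|D z i j| <= 2.
  rewrite /D -scalerBr mxZE normrM -[leRHS]mul1r ler_pM// mxBE.
  by apply: le_trans (ler_normB _ _) _; rewrite -[2]/(1 + 1) lerD// ker_le1.
have hD1 : entries_le D1 2.
  move=> z i j; rewrite /D1 mxZE normrM -[leRHS]mul1r.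
  exact: (ler_pM (normr_ge0 _) (normr_ge0 _) (cut_norm _ _ z) (hD z i j)).
have b1 : I (dd D1) <= c / 8 * 2 := hsm _ _ (ler0n _ 2) tD1 hD1.
have b1' : - I (dd D1) <= c / 8 * 2.
  rewrite -(tf_ddN tI tD1O); apply: hsm => //; first exact: tfieldN.
  exact: entries_leN.
have b2 : `|I (dd D2)| <= c / 4 := le_trans (hessian_bound_norm tI hE tD2 k1) Es.
move: d1E d2E dDE dDE2 b1 b1' b2 k2 k3.
generalize (I (dd D)) (I (dd D1)) (I (dd D2)) (I (dd (fun z => chi z *: ker y e z)))
  (I (dd (fun z => chi z *: ker y' e' z))) (I (fun z => chi z * eta y e z))
  (I (fun z => chi z * eta y' e' z)) (I (kerrem chi y e)) (I (kerrem chi y' e')) (I (kerrem chi x 0)).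
clear -c0 => t1 t2 t3 t4 t5 t6 t7 t8 t9 t10 ? ? ? ?.
move=> ? ? /ler_normlP[? ?] /ler_normlP[? ?] /ler_normlP[? ?].
apply/ler_normlP; split; lra.
Qed.

End at_cutoff.

(** The limit is joint in y -> x and e -> 0, which yields continuity of the point values, and it is
    demanded for every cut-off, so that one cut-off can be used at neighbouring points. The factor 4
    pi is the mass of [eta]. *)
Definition is_pval x (l : R) := forall chi, cutoff Omega x chi -> forall c, 0 < c ->
  exists d, 0 < d /\ forall y e, sq x d y -> e != 0 -> `|e| <= d ->
  `|I (fun z => chi z * eta y e z) - 4 * pi * l| <= c.

Lemma eta_limit x chi : Omega x -> cutoff Omega x chi -> exists l, forall c, 0 < c ->
  exists d, 0 < d /\ forall y e, sq x d y -> e != 0 -> `|e| <= d ->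
  `|I (fun z => chi z * eta y e z) - l| <= c.
Proof.
move=> Ox hchi.
pose u n := I (fun z => chi z * eta x (n.+1%:R^-1) z).
have inv0 n : (n.+1%:R^-1 : R) != 0 by rewrite invr_eq0 pnatr_eq0.
have small d : 0 < d -> \forall n \near \oo, `|(n.+1%:R^-1 : R)| <= d.
  move=> d0; near=> n; rewrite ger0_norm ?invr_ge0// invf_ple ?posrE//.
  apply/ltW; apply: lt_le_trans (_ : n%:R <= _); last by rewrite ler_nat.
  by near: n; exact: nbhs_infty_gtr.
have cu : cvgn u.
  apply: cauchy_cvg; apply: cauchy_exP => c c0.
  have c2 : 0 < c / 2 by rewrite divr_gt0.
  have [d [d0 hd]] := eta_cauchy hchi Ox c2.
  have [N _ hN] := small d d0.
  exists (u N); exists N => //= n Nn; rewrite /ball /=.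
  apply: le_lt_trans (_ : c / 2 < c); last by lra.
  apply: hd => //; first exact: (sq_center x (ltW d0)).
  - by apply: hN => /=.
  - exact: (sq_center x (ltW d0)).
  - exact: hN.
exists (limn u) => c c0.
have c2 : 0 < c / 2 by rewrite divr_gt0.
have [d [d0 hd]] := eta_cauchy hchi Ox c2.
exists d; split=> // y e hy e0 he.
have h1 : \forall n \near \oo, `|limn u - u n| <= c / 2.
  have /cvgrPdist_le := cu; exact.
near \oo => n.
rewrite -(subrKA (u n)); apply: le_trans (ler_normD _ _) _.
rewrite [c]splitr lerD//.
  apply: hd => //; first exact: (sq_center x (ltW d0)).
  by near: n; exact: small.
by rewrite distrC; near: n.
Unshelve. all: by end_near. Qed.

Lemma pi4_gt0 : 0 < 4 * pi :> R.
Proof. by rewrite mulr_gt0// pi_gt0. Qed.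

Lemma ex_pval x : Omega x -> exists l, is_pval x l.
Proof.
move=> Ox; have [r [r0 hr]] := nbhs_sq (open_nbhs_nbhs (conj oO Ox)).
have r2 : 0 < r / 2 by rewrite divr_gt0.
have cut0 : cutoff Omega x (cut x (r / 2)).
  by apply: cutoff_cut => //; [rewrite mulrC divfK|exact: osq_center].
have [l hl] := eta_limit Ox cut0.
exists (l / (4 * pi)) => chi hchi c c0.
have -> : 4 * pi * (l / (4 * pi)) = l by rewrite mulrC divfK// gt_eqF// pi4_gt0.
have [sc _ [K [cK KO hK]] [t t0 h1]] := hchi.
have [sc' _ [K' [cK' KO' hK']] [t' t0' h1']] := cut0.
have cKK := compactU cK cK'.
have KKO : K `|` K' `<=` Omega by move=> z [/KO|/KO'].
have [C C0 hC] := tf_bnd tI cKK KKO.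
have c2 : 0 < c / 2 by rewrite divr_gt0.
have s0 : 0 < c / 2 / (C + 1) by rewrite divr_gt0// ltr_wpDl.
pose tt := Num.min t t'.
have tt0 : 0 < tt by rewrite lt_min t0.
have cKKo := compact_setD_open cKK (@osq_open _ x tt).
pose phi z y e := (chi z - cut x (r / 2) z) * eta y e z.
have [d1 [d10 hd1]] : exists d : R, 0 < d /\ forall y e, sq x d y -> `|e| <= d ->
    forall z, ((K `|` K') `\` osq x tt) z -> `|phi z y e - phi z x 0| < c / 2 / (C + 1).
  apply: uniform_at => // z [_ nz].
  have zx : z <> x by move=> zx; apply: nz; rewrite zx; exact: osq_center.
  apply: cvg_at_M; last exact: (@cvg_at_eta R (z, (x, 0)) (qden_neq 0 zx)).
  apply: (@cvg_at_lift R (z, (x, 0)) (fun z => chi z - cut x (r / 2) z)).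
  exact: (smooth_continuous (smoothB sc sc')).
have [d2 [d20 hd2]] := hl _ c2.
exists (Num.min d1 d2); split; first by rewrite lt_min d10.
move=> y e hy e0 he.
have m1 : Num.min d1 d2 <= d1 by rewrite ge_min lexx.
have m2 : Num.min d1 d2 <= d2 by rewrite ge_min lexx orbT.
have k2 := hd2 _ _ (sqS m2 hy) e0 (le_trans he m2).
have k1 := hd1 _ _ (sqS m1 hy) (le_trans he m1).
have te := testfun_chi_eta hchi y e0; have te' := testfun_chi_eta cut0 y e0.
have dE : I (fun z => chi z * eta y e z) - I (fun z => cut x (r / 2) z * eta y e z) =
    I (fun z => chi z * eta y e z - cut x (r / 2) z * eta y e z) by rewrite (tfB tI te te').
(* The difference of the two cut-offs vanishes near x, and away from x the factor e^4 of [eta] makes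
   the limit zero. So the limit found for one cut-off is the limit for all of them. *)
have phi0 z : phi z x 0 = 0 by rewrite /phi etaE expr0n /= mulr0 mul0r mulr0.
have bnd : `|I (fun z => chi z * eta y e z - cut x (r / 2) z * eta y e z)| <= C * (c / 2 / (C + 1)).
  apply: hC; first by have [] := testfunB te te'.
    by move=> z /not_orP [nz nz']; rewrite hK// hK'// mul0r subrr.
  move=> z; rewrite -mulrBl.
  have [Kz|/not_orP [nz nz']] := pselect ((K `|` K') z); last first.
    by rewrite hK// hK'// subrr mul0r normr0 ltW.
  have [oz|noz] := pselect (osq x tt z); last first.
    have := k1 z (conj Kz noz); rewrite phi0 subr0; exact: ltW.
  have sz := osq_sub oz.
  rewrite h1 ?h1'; first by rewrite subrr mul0r normr0 ltW.
    by apply: sqS sz; rewrite /tt ge_min lexx orbT.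
  by apply: sqS sz; rewrite /tt ge_min lexx.
have cC : C * (c / 2 / (C + 1)) <= c / 2.
  by rewrite mulrCA -[leRHS]mulr1 ler_wpM2l ?ltW// ltr_pdivrMr ?ltr_wpDl// mul1r ltrDl.
move: (le_trans bnd cC) k2; rewrite -dE.
generalize (I (fun z => chi z * eta y e z)) (I (fun z => cut x (r / 2) z * eta y e z)).
clear -c0 => a b /ler_normlP[? ?] /ler_normlP[? ?]; apply/ler_normlP; split; lra.
Qed.

Definition pval x : R := xget 0 [set l | is_pval x l].

Lemma pvalP x : Omega x -> is_pval x (pval x).
Proof. by move=> /ex_pval [l hl]; exact: (xgetI 0 hl). Qed.

(** One cut-off around x serves at y as well, and for a common small e one number, the pairing with
    [eta y e], is close to the values at both points. *)
Lemma pval_continuous : {in Omega, continuous pval}.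
Proof.
move=> x; rewrite inE => Ox; apply/cvgrPdist_le => c c0.
have [r [r0 hr]] := nbhs_sq (open_nbhs_nbhs (conj oO Ox)).
have r2 : 0 < r / 2 by rewrite divr_gt0.
have r22 : 2 * (r / 2) = r by rewrite mulrC divfK.
have p0 := pi4_gt0.
have c2 : 0 < c / 2 * (4 * pi) by rewrite mulr_gt0// divr_gt0.
have cutx : cutoff Omega x (cut x (r / 2)).
  by apply: cutoff_cut; rewrite ?r22//; exact: osq_center.
have [d [d0 hd]] := pvalP Ox cutx c2.
have osqx := open_nbhs_nbhs (conj (@osq_open _ x (r / 2)) (osq_center x r2)).
near=> y.
have oy : osq x (r / 2) y by near: y.
have sy : sq x d y by near: y; exact: sq_nbhs.
have Oy : Omega y by apply: hr; apply: sqS (osq_sub oy); lra.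
have cuty : cutoff Omega y (cut x (r / 2)) by apply: cutoff_cut; rewrite ?r22.
have [d' [d0' hd']] := pvalP Oy cuty c2.
pose e := Num.min d d'.
have e0 : 0 < e by rewrite lt_min d0.
have eN : `|e| = e by rewrite ger0_norm// ltW.
have en0 : e != 0 by rewrite gt_eqF.
have k1 := hd y e sy en0; have k2 := hd' y e (sq_center y (ltW d0')) en0.
rewrite eN in k1 k2.
have {}k1 := k1 (_ : e <= d); have {}k2 := k2 (_ : e <= d').
rewrite -(ler_pM2r p0) -{1}(ger0_norm (ltW p0)) -normrM.
have ed : e <= d by rewrite ge_min lexx.
have ed' : e <= d' by rewrite ge_min lexx orbT.
move: (k1 ed) (k2 ed').
generalize (I (fun z => cut x (r / 2) z * eta y e z)) (pval x) (pval y).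
clear -c0 p0 => a lx ly; have -> : c * (4 * pi) = c / 2 * (4 * pi) + c / 2 * (4 * pi) by field.
set q := c / 2 * (4 * pi); rewrite mulrBl (mulrC lx) (mulrC ly).
set X := 4 * pi * lx; set Y := 4 * pi * ly.
move=> /ler_normlP[? ?] /ler_normlP[? ?]; apply/ler_normlP; split; lra.
Unshelve. all: by end_near. Qed.

Lemma dd_ker_limit x chi c : Omega x -> cutoff Omega x chi -> 0 < c ->
  exists d, 0 < d /\ forall e, e != 0 -> `|e| <= d ->
  `|I (dd (fun z => chi z *: ker x e z)) - (4 * pi * pval x + I (kerrem chi x 0))| <= c.
Proof.
move=> Ox hchi c0; have c2 : 0 < c / 2 by rewrite divr_gt0.
have [d1 [d10 h1]] := pvalP Ox hchi c2.
have [d2 [d20 h2]] := kerrem_close hchi c2.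
exists (Num.min d1 d2); split; first by rewrite lt_min d10.
move=> e e0 he.
have m1 : Num.min d1 d2 <= d1 by rewrite ge_min lexx.
have m2 : Num.min d1 d2 <= d2 by rewrite ge_min lexx orbT.
have k1 := h1 x e (sq_center x (ltW d10)) e0 (le_trans he m1).
have k2 := h2 x e (sq_center x (ltW d20)) e0 (le_trans he m2).
have dE := dd_decomp hchi x e0.
move: k1 k2; rewrite dE.
generalize (I (fun z => chi z * eta x e z)) (I (kerrem chi x e)) (I (kerrem chi x 0)) (4 * pi * pval x).
clear => a b l m /ler_normlP[? ?] /ler_normlP[? ?]; apply/ler_normlP; split; lra.
Qed.

(** The limit as e -> 0 of the pairing with [chi *: ker x e], a field in A with entries at most 1.
    With A = Omega it bounds point values; with A a small square [EA] is small and it determines the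
    remainder. *)
Lemma pval_estimate x chi A EA : Omega x -> cutoff Omega x chi -> A `<=` Omega ->
  (exists K, [/\ compact K, K `<=` A & forall z, ~ K z -> chi z = 0]) ->
  (forall F, tfield A F -> entries_le F 1 -> I (dd F) <= EA) ->
  `|4 * pi * pval x + I (kerrem chi x 0)| <= EA.
Proof.
move=> Ox hchi AO [K [cK KA hK]] hEA; apply/ler_addgt0Pr => c c0.
have [d [d0 hd]] := dd_ker_limit Ox hchi c0.
have dn : d != 0 by rewrite gt_eqF.
have := hd d dn; rewrite (ger0_norm (ltW d0)) lexx => /(_ isT) k.
have [sc c1 _ _] := hchi.
have tF : tfield A (fun z => chi z *: ker x d z).
  split; first exact: (smooth_fieldZ sc (smooth_ker x dn)).
  by exists K; split=> // z /hK ->; rewrite scale0r.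
have hF : entries_le (fun z => chi z *: ker x d z) 1.
  move=> z i j; rewrite mxZE normrM -[leRHS]mul1r.
  exact: (ler_pM (normr_ge0 _) (normr_ge0 _) (c1 z) (ker_le1 x dn i j z)).
have b1 := hEA _ tF hF.
have b2 : - I (dd (fun z => chi z *: ker x d z)) <= EA.
  rewrite -(tf_ddN tI (tfieldS AO tF)); apply: hEA; first exact: tfieldN.
  exact: entries_leN.
move: k b1 b2.
generalize (I (dd (fun z => chi z *: ker x d z))) (I (kerrem chi x 0)) (4 * pi * pval x).
clear => a l m /ler_normlP[? ?] ? ?; apply/ler_normlP; split; lra.
Qed.

End testform_at.
End point_values.

(** * Measurability on the plane and pairing with locally integrable functions *)

Section plane_measure.
Context {R : realType}.
Local Notation T2 := (R * R)%type.
Local Notation TM := (measurableTypeR R * measurableTypeR R)%type.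
Local Notation mu := (@lebesgue2 R).
Implicit Types (z x y : T2) (r s c : R) (K A Omega : set T2) (g h k : T2 -> R).

Lemma osq_measurable x r : measurable (osq x r : set TM).
Proof. by rewrite osqE; apply: measurableX; exact: measurable_itv. Qed.

Definition rat_osq (q : rat * rat * rat) : set T2 := osq (ratr q.1.1, ratr q.1.2) (ratr q.2).

Lemma rat_osq_basis A z : open A -> A z -> exists q, rat_osq q z /\ rat_osq q `<=` A.
Proof.
move=> oA Az; have [r [r0 hr]] := nbhs_sq (open_nbhs_nbhs (conj oA Az)).
have [a ha] := @rat_in_itvoo R (z.1 - r / 4) (z.1 + r / 4) ltac:(lra).
have [b hb] := @rat_in_itvoo R (z.2 - r / 4) (z.2 + r / 4) ltac:(lra).
have [c hc] := @rat_in_itvoo R (r / 4) (r / 2) ltac:(lra).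
move: ha hb hc; rewrite !in_itv /= => /andP[a1 a2] /andP[b1 b2] /andP[c1 c2].
exists (a, b, c); split; first by split; rewrite /= ltr_distl; apply/andP; split; lra.
move=> w [/= h1 h2]; apply: hr; move: h1 h2; rewrite !ltr_distl => /andP[? ?] /andP[? ?].
by split; rewrite ler_distl; apply/andP; split; lra.
Qed.

Definition nat_osq (P : rat * rat * rat -> Prop) (n : nat) : set T2 :=
  if unpickle n is Some q then if `[< P q >] then rat_osq q else set0 else set0.

Lemma nat_osqP P n : nat_osq P n = set0 \/ exists2 q, P q & nat_osq P n = rat_osq q.
Proof.
rewrite /nat_osq; case: unpickle => [q|]; last by left.
by case: asboolP => [h|_]; [right; exists q|left].
Qed.

Lemma nat_osq_cover P q : P q -> rat_osq q `<=` \bigcup_n nat_osq P n.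
Proof.
move=> Pq z hz; refine (ex_intro2 _ _ (pickle q) I _).
by rewrite /nat_osq (pickleK q) asboolT.
Qed.

(** The sigma-algebra is a product of Borel sigma-algebras, so an open set has to be exhibited as a
    countable union of squares, here with rational centre and radius. *)
Lemma open_measurableT2 A : open A -> measurable (A : set TM).
Proof.
move=> oA.
have -> : A = \bigcup_n nat_osq (fun q => rat_osq q `<=` A) n.
  apply/seteqP; split => [z Az|z [n _]].
    have [q [qz qA]] := rat_osq_basis oA Az.
    exact: (@nat_osq_cover (fun q => rat_osq q `<=` A) q qA).
  by case: (nat_osqP (fun q => rat_osq q `<=` A) n) => [->//|[q qA ->]]; exact: qA.
apply: bigcupT_measurable => n.
case: (nat_osqP (fun q => rat_osq q `<=` A) n) => [->//|[q qA ->]].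
exact: osq_measurable.
Qed.

Lemma closed_measurableT2 A : closed A -> measurable (A : set TM).
Proof.
move=> cA; rewrite -(setCK A); apply: measurableC; apply: open_measurableT2.
exact: closed_openC.
Qed.

Lemma compact_measurableT2 K : compact K -> measurable (K : set TM).
Proof. by move=> cK; apply: closed_measurableT2; exact: compact_closedT2. Qed.

Lemma continuous_measurableT2 Omega g : open Omega -> {in Omega, continuous g} ->
  measurable_fun (Omega : set TM) g.
Proof.
move=> oO cg; apply: (measurability _ (RGenOpens.measurableE R)).
move=> _ [_ [a [b ->] <-]]; apply: open_measurableT2.
rewrite openE => z [Oz gz]; rewrite /interior.
apply: filterI; first exact: (open_nbhs_nbhs (conj oO Oz)).
have := cg z (mem_set Oz); apply.
by apply: open_nbhs_nbhs; split; [exact: interval_open|exact: gz].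
Qed.

(** The rational squares on which [P] holds almost everywhere cover Omega, and there are countably
    many of them, so the exceptional sets add up to a null set. *)
Lemma ae_cover Omega (P : T2 -> Prop) :
  (forall z, Omega z -> exists2 r, 0 < r & {ae mu, forall w : TM, sq z r w -> P w}) ->
  {ae mu, forall w : TM, Omega w -> P w}.
Proof.
move=> H.
pose Q q := {ae mu, forall w : TM, rat_osq q w -> P w}.
have : mu.-negligible (\bigcup_n [set w : TM | nat_osq Q n w /\ ~ P w]).
  apply: negligible_bigcup => n.
  case: (nat_osqP Q n) => [->|[q Qq ->]].
    by apply: negligibleS (@negligible_set0 _ _ _ mu) => w [].
  by apply: negligibleS Qq => w [h nP] /(_ h).
apply: negligibleS => w /= /not_implyP [Ow nP].
have [r r0 hr] := H w Ow.
have [q [qw qr]] := rat_osq_basis (@osq_open _ w r) (osq_center w r0).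
have Qq : Q q.
  by apply: filterS hr => v h qv; apply: h; apply: osq_sub; exact: qr.
by have [n _ hn] := @nat_osq_cover Q q Qq w qw; exists n.
Qed.


Lemma continuous_measurableT2T g : continuous g -> measurable_fun (setT : set TM) g.
Proof.
by move=> cg; apply: continuous_measurableT2; [exact: openT|move=> z _; exact: cg].
Qed.

Definition ipair Omega g h : R := \int[mu]_(z in Omega) (g z * h z).

Section L1loc_pairing.
Variables (Omega : set T2) (g : T2 -> R).
Hypothesis oO : open Omega.
Hypothesis Lg : L1loc Omega g.

Lemma L1loc_integrable K : compact K -> K `<=` Omega -> mu.-integrable (K : set TM) (EFin \o g).
Proof.
move=> cK KO; have [mg ig] := Lg; apply/integrableP; split; last exact: ig.
apply/measurable_EFinP; apply: measurable_funS mg => //; exact: open_measurableT2.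
Qed.

Lemma pairing_restrict K h : compact K -> K `<=` Omega -> (forall z, ~ K z -> h z = 0) ->
  ipair Omega g h = \int[mu]_(z in K) (g z * h z).
Proof.
move=> cK KO hK; rewrite /ipair -[in RHS](setIidr KO) Rintegral_mkcondr.
apply: eq_Rintegral => z _; rewrite patchE; case: ifPn => // /negP nK.
by rewrite hK ?mulr0// => Kz; apply: nK; rewrite inE.
Qed.

Lemma pairing_integrable_compact K h s : compact K -> K `<=` Omega ->
  measurable_fun (K : set TM) h -> (forall z, K z -> `|h z| <= s) ->
  mu.-integrable (K : set TM) (EFin \o (fun z => g z * h z)).
Proof.
move=> cK KO mh hs.
have ig := L1loc_integrable cK KO.
apply: (le_integrable (compact_measurableT2 cK) (f := EFin \o (fun z => g z * h z)) (g := EFin \o (fun z => s * g z))).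
- apply/measurable_EFinP; apply: measurable_funM => //.
  by have /measurable_EFinP := measurable_int _ ig.
- move=> z Kz /=; rewrite lee_fin !normrM mulrC ler_wpM2r//.
  by apply: le_trans (hs z Kz) _; exact: ler_norm.
- exact: (integrableZl (compact_measurableT2 cK) s ig).
Qed.

Lemma testfun_integrable h : testfun Omega h ->
  mu.-integrable (Omega : set TM) (EFin \o (fun z => g z * h z)).
Proof.
move=> th; have [ch [K [cK KO hK]]] := th; have [s s0 hs] := testfun_bounded th.
have mK := compact_measurableT2 cK.
have mh := continuous_measurableT2T ch.
have iK : mu.-integrable (K : set TM) (EFin \o (fun z => g z * h z)).
  by apply: (@pairing_integrable_compact K h s) => //; exact: measurable_funTS.
have mO := open_measurableT2 oO.
apply/(integrable_mkcond _ mO).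
suff -> : (EFin \o (fun z => g z * h z)) \_ Omega = (EFin \o (fun z => g z * h z)) \_ K.
  by apply/(integrable_mkcond _ mK).
apply: funext => z; rewrite !patchE.
have [Kz|nK] := pselect (K z); first by rewrite !mem_set//; exact: KO.
by rewrite (memNset nK) /= hK// mulr0; case: ifP.
Qed.

Lemma pairing_bound K : compact K -> K `<=` Omega -> forall h s, measurable_fun (K : set TM) h ->
   (forall z, ~ K z -> h z = 0) -> (forall z, K z -> `|h z| <= s) ->
  `|ipair Omega g h| <= (\int[mu]_(z in K) `|g z|) * s.
Proof.
move=> cK KO h s mh hK hs; have mK := compact_measurableT2 cK.
rewrite (pairing_restrict cK KO hK).
have iK := pairing_integrable_compact cK KO mh hs.
have ig := L1loc_integrable cK KO.
apply: le_trans (le_normr_Rintegral mK iK) _.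
have iga : mu.-integrable (K : set TM) (EFin \o (fun z => `|g z|)).
  exact: (integrable_abse ig).
rewrite -RintegralZr//; apply: le_Rintegral => //.
- exact: (integrable_abse iK).
- have := integrableZl mK s iga; apply: eq_integrable => // z _ /=.
  by rewrite -EFinM mulrC.
- by move=> z Kz; rewrite normrM ler_wpM2l// hs.
Qed.

Lemma testform_ipair : testform Omega (ipair Omega g).
Proof.
have mO := open_measurableT2 oO.
split.
- move=> a h k th tk.
  have ih := testfun_integrable th; have ik := testfun_integrable tk.
  have iah : mu.-integrable (Omega : set TM) (EFin \o (fun z => a * (g z * h z))).
    exact: (integrableZl mO a ih).
  rewrite /ipair -(RintegralZl a mO ih) -(RintegralD mO iah ik).
  by apply: eq_Rintegral => z _; ring.
- move=> K cK KO; exists (\int[mu]_(z in K) `|g z|).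
    by apply: Rintegral_ge0.
  move=> h s ch hK hs; apply: pairing_bound => //.
  exact: (measurable_funTS (continuous_measurableT2T ch)).
Qed.

End L1loc_pairing.

End plane_measure.

(** * Two integrals over the line *)

Section one_dimensional_integrals.
Context {R : realType}.
Local Notation la := (@lebesgue_measure R).
Implicit Types (f F : R -> R) (a c e l s t u v : R).

Lemma even_integral f F l : (forall t, 0 <= f t) -> continuous f ->
  (forall t, f (- t) = f t) -> (forall t, is_derive t 1 F (f t)) -> F 0 = 0 ->
  F t @[t --> +oo] --> l -> (\int[la]_t (f t)%:E = (2 * l)%:E)%E.
Proof.
move=> f0 cf ef dF F0 Fl.
rewrite ge0_symfun_integralT//; last by move=> t /=; rewrite ef.
rewrite EFinM; congr (_ * _)%E.
rewrite (_ : [set x | 0 <= x] = `[0, +oo[%classic); last first.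
  by apply/seteqP; split => x /=; rewrite in_itv/= andbT.
rewrite (@ge0_continuous_FTC2y _ f F 0 l) ?F0 ?sube0//.
- exact: continuous_subspaceT.
- rewrite -[X in _ --> X]F0; apply: cvg_at_right_filter.
  by apply/differentiable_continuous/derivable1_diffP; have [] := dF 0.
- by move=> x _; rewrite derive1E; have [_ ->] := dF x.
Qed.

Lemma affine_substitution f a c : 0 < a -> continuous f -> (forall t, 0 <= f t) ->
  (\int[la]_t (f t)%:E = \int[la]_t (a * f (a * t + c))%:E)%E.
Proof.
move=> a0 cf f0.
have dF t : is_derive t 1 (fun t => a * t + c) a.
  apply: is_derive_eq (isdD (isdM (isdC a t 1) (is_derive_id t 1)) (isdC c t 1)) _.
  by rewrite mulr1 mulr0 !addr0.
have dFE : (fun t => a * t + c)^`()%classic = cst a.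
  by apply: funext => t; rewrite derive1E; have [_ ->] := dF t.
rewrite (@increasing_ge0_integration_by_substitutionT _ (fun t => a * t + c) f)//.
- by apply: eq_integral => t _; rewrite dFE /= mulrC.
- by move=> x y xy; rewrite ltrD2r ltr_pM2l.
- by rewrite dFE; exact: cst_continuous.
- by rewrite dFE; exact: is_cvg_cst.
- by rewrite dFE; exact: is_cvg_cst.
- apply/cvgrNyPle => A; near=> t.
  rewrite -lerBrDr mulrC -ler_pdivlMr//; near: t; apply: nbhs_ninfty_le; exact: num_real.
- apply/cvgryPge => A; near=> t.
  rewrite -lerBlDr mulrC -ler_pdivrMr//; near: t; apply: nbhs_pinfty_ge; exact: num_real.
Unshelve. all: by end_near. Qed.

Lemma continuous1M f F : continuous f -> continuous F -> continuous (fun t => f t * F t).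
Proof. by move=> cf cF t; apply: (@continuousM _ _ f F); [exact: cf|exact: cF]. Qed.

Lemma is_derive_continuous f (F : R -> R) : (forall t, is_derive t 1 F (f t)) -> continuous F.
Proof.
move=> dF t; apply/differentiable_continuous/derivable1_diffP.
by have [] := dF t.
Qed.

Definition osqr t : R := 1 + t ^+ 2.

Lemma osqr_gt0 t : 0 < osqr t. Proof. by rewrite ltr_pwDl// sqr_ge0. Qed.

Lemma osqr_ge0 t : 0 <= osqr t. Proof. exact/ltW/osqr_gt0. Qed.

Lemma osqr_neq0 t : osqr t != 0. Proof. by rewrite gt_eqF// osqr_gt0. Qed.

Lemma is_derive_osqr t : is_derive t 1 osqr (2 * t).
Proof.
apply: is_derive_eq (isdD (isdC 1 t 1) (isdX 2 (is_derive_id t 1))) _.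
by rewrite /= expr1; ring.
Qed.

Lemma is_derive_osqrV t : is_derive t 1 (fun t => (osqr t)^-1) (- (osqr t)^-1 ^+ 2 * (2 * t)).
Proof. by apply: isdV; [exact: osqr_neq0|exact: is_derive_osqr]. Qed.

Lemma cvg_osqrV : (osqr t)^-1 @[t --> +oo] --> (0 : R).
Proof.
apply/cvgrPdist_le => c c0; near=> t.
rewrite sub0r normrN ger0_norm ?invr_ge0 ?osqr_ge0//.
have t0 : 1 <= t by near: t; apply: nbhs_pinfty_ge; exact: num_real.
have tc : c^-1 <= t by near: t; apply: nbhs_pinfty_ge; exact: num_real.
rewrite invf_ple ?posrE ?osqr_gt0//; apply: (le_trans tc); rewrite /osqr; nra.
Unshelve. all: by end_near. Qed.

Lemma cvg_tosqrV : t * (osqr t)^-1 @[t --> +oo] --> (0 : R).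
Proof.
apply/cvgrPdist_le => c c0; near=> t.
have t0 : 0 < t by near: t; apply: nbhs_pinfty_gt; exact: num_real.
have tc : c^-1 <= t by near: t; apply: nbhs_pinfty_ge; exact: num_real.
rewrite sub0r normrN ger0_norm ?mulr_ge0 ?invr_ge0 ?osqr_ge0 ?(ltW t0)//.
apply: (@le_trans _ _ t^-1); last by rewrite invf_ple.
rewrite ler_pdivrMr ?osqr_gt0// /osqr mulrDr mulr1 expr2 mulKf ?gt_eqF//.
by rewrite lerDr invr_ge0 ltW.
Unshelve. all: by end_near. Qed.

Lemma integral_osqr3 : (\int[la]_t ((osqr t)^-1 ^+ 3)%:E = (3 / 8 * pi)%:E)%E.
Proof.
(* With t = tan a the integrand becomes cos^4 a, and [F] is its primitive 3/8 a + 3/8 sin a cos a +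
   1/4 sin a cos^3 a expressed in t. *)
pose F t : R := 3 / 8 * atan t + (3 / 8 * (t * (osqr t)^-1) + 1 / 4 * (t * (osqr t)^-1 * (osqr t)^-1)).
have dF t : is_derive t 1 F ((osqr t)^-1 ^+ 3).
  have d1 := isdM (is_derive_id t 1) (is_derive_osqrV t).
  apply: is_derive_eq (isdD (isdM (isdC (3 / 8) t 1) (is_derive1_atan t))
    (isdD (isdM (isdC (3 / 8) t 1) d1) (isdM (isdC (1 / 4) t 1) (isdM d1 (is_derive_osqrV t))))) _.
  rewrite /=; have := osqr_neq0 t; rewrite /osqr => h; field.
  by rewrite h.
rewrite (@even_integral _ F (3 / 8 * (pi / 2) + (3 / 8 * 0 + 1 / 4 * (0 * 0)))).
- by congr EFin; field.
- by move=> t; rewrite exprn_ge0// invr_ge0 osqr_ge0.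
- have cV := is_derive_continuous is_derive_osqrV.
  rewrite (_ : (fun t => _) = fun t => (osqr t)^-1 * ((osqr t)^-1 * (osqr t)^-1)).
    by do 2 apply: continuous1M => //.
  by apply: funext => t; rewrite !exprS expr0 mulr1.
- by move=> t; rewrite /osqr sqrrN.
- by rewrite /F atan0 !mul0r !mulr0 !addr0.
- apply: cvgD; first by apply: cvgMr; exact: cvgy_atan.
  apply: cvgD; first by apply: cvgMr; exact: cvg_tosqrV.
  apply: cvgMr; apply: cvgM; [exact: cvg_tosqrV|exact: cvg_osqrV].
Qed.

Lemma integral_osqr5 : (\int[la]_t ((Num.sqrt (osqr t))^-1 ^+ 5)%:E = (4 / 3)%:E)%E.
Proof.
pose q t : R := (Num.sqrt (osqr t))^-1.
have s0 t : 0 < Num.sqrt (osqr t) by rewrite sqrtr_gt0 osqr_gt0.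
have sn t : Num.sqrt (osqr t) != 0 by rewrite gt_eqF.
have s2 t : Num.sqrt (osqr t) ^+ 2 = osqr t by rewrite sqr_sqrtr// osqr_ge0.
have dq t : is_derive t 1 q (- q t ^+ 3 * t).
  have ds := @is_derive1_comp _ Num.sqrt osqr t _ _ (is_derive1_sqrt (osqr_gt0 t)) (is_derive_osqr t).
  apply: is_derive_eq (@isdV R R (fun t => Num.sqrt (osqr t)) t 1 _ (sn t) ds) _.
  by rewrite /q; have := sn t; move: (Num.sqrt (osqr t)) => a a0; field.
have cq := is_derive_continuous dq.
(* With t = tan a the integrand becomes cos^3 a and [t * q t] is sin a, which gives the primitive
   sin a - sin^3 a / 3. *)
pose F t : R := t * q t - 1 / 3 * (t * q t) ^+ 3.
have dF t : is_derive t 1 F (q t ^+ 5).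
  have d1 := isdM (is_derive_id t 1) (dq t).
  apply: is_derive_eq (isdB d1 (isdM (isdC (1 / 3) t 1) (isdX 3 d1))) _.
  rewrite /=; have : q t ^+ 2 * (1 + t ^+ 2) = 1.
    by rewrite /q exprVn s2 mulVf// osqr_neq0.
  move: (q t) => a h.
  have -> : t * (- a ^+ 3 * t) + a * 1 = a * (1 - a ^+ 2 * t ^+ 2) by ring.
  have -> : a ^+ 2 * t ^+ 2 = 1 - a ^+ 2 by lra.
  have e2 : (t * a) ^+ 2 = 1 - a ^+ 2 by rewrite exprMn; lra.
  by rewrite e2; field.
have lq : t * q t @[t --> +oo] --> (1 : R).
  apply/cvgrPdist_le => c c0.
  have := cvg_osqrV; move=> /cvgrPdist_le /(_ c c0); apply: filter_app; near=> t.
  have t0 : 0 < t by near: t; apply: nbhs_pinfty_gt; exact: num_real.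
  rewrite sub0r normrN ger0_norm ?invr_ge0 ?osqr_ge0// => hc.
  have q0 : 0 < q t by rewrite invr_gt0.
  have h : q t ^+ 2 * (1 + t ^+ 2) = 1 by rewrite /q exprVn s2 mulVf// osqr_neq0.
  have qV : (osqr t)^-1 = q t ^+ 2 by rewrite /q exprVn s2.
  rewrite qV in hc; move: (q t) q0 h hc {qV} => a a0 h hc.
  have tq0 : 0 < t * a by rewrite mulr_gt0.
  have tq1 : t * a <= 1.
    by rewrite -(@ler_pXn2r _ 2) ?nnegrE ?(ltW tq0)// expr1n exprMn; nra.
  rewrite ger0_norm ?subr_ge0//; nra.
rewrite (@even_integral _ F (1 - 1 / 3 * (1 * (1 * 1)))).
- by congr EFin; field.
- by move=> t; rewrite exprn_ge0// invr_ge0 sqrtr_ge0.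
- rewrite (_ : (fun t => _) = fun t => q t * (q t * (q t * (q t * q t)))).
    by do 4 apply: continuous1M => //.
  by apply: funext => t; rewrite !exprS expr0 mulr1.
- by move=> t; rewrite /osqr sqrrN.
- by rewrite /F !mul0r expr0n /= mulr0 subr0.
- apply: cvgB => //; apply: cvgMr.
  rewrite (_ : (fun t => _) = fun t => (t * q t) * ((t * q t) * (t * q t))).
    by apply: cvgM => //; exact: cvgM.
  by apply: funext => t; rewrite !exprS expr0 mulr1.
Unshelve. all: by end_near. Qed.

End one_dimensional_integrals.

(** * Integrals over the plane and the mass of [eta] *)

Section plane_integrals.
Context {R : realType}.
Local Notation T2 := (R * R)%type.
Local Notation TM := (measurableTypeR R * measurableTypeR R)%type.
Local Notation mu := (@lebesgue2 R).
Local Notation la := (@lebesgue_measure R).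
Implicit Types (z x y : T2) (r s c e t u v : R) (K A Omega : set T2) (g h f : T2 -> R).

Lemma Tonelli (f : T2 -> R) : (forall z, 0 <= f z) -> measurable_fun (setT : set TM) f ->
  (\int[mu]_z (f z)%:E = \int[la]_u \int[la]_v (f (u, v))%:E)%E.
Proof.
move=> f0 mf.
rewrite (@fubini_tonelli1 _ _ (measurableTypeR R) (measurableTypeR R) R la la (fun z => (f z)%:E))//.
exact/measurable_EFinP.
Qed.

Lemma integral_scale (k : R) (f : R -> R) (l : R) : 0 <= k -> measurable_fun setT f ->
  (forall t, 0 <= f t) -> (\int[la]_t (f t)%:E = l%:E)%E ->
  (\int[la]_t (k * f t)%:E = (k * l)%:E)%E.
Proof.
move=> k0 mf f0 fl.
under eq_integral do rewrite EFinM.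
rewrite ge0_integralZl_EFin ?fl//; first by move=> t _; rewrite lee_fin.
exact/measurable_EFinP.
Qed.

(** Iterated integrals, each scaled to a fixed profile. With A = sqrt((u - y_1)^2 + e^2) the
    substitution v = A t + y_2 gives 8 e^4 A^(-5) times 3 pi / 8, and u = e t + y_1 turns what
    remains into 3 pi times 4/3. *)
Lemma eta_integral y e : 0 < e -> (\int[mu]_z (eta y e z)%:E = (4 * pi)%:E)%E.
Proof.
move=> e0; have en : e != 0 by rewrite gt_eqF.
rewrite Tonelli; last 2 first.
- exact: eta_ge0.
- exact: (continuous_measurableT2T (smooth_continuous (smooth_eta y en))).
pose A u := Num.sqrt ((u - y.1) ^+ 2 + e ^+ 2).
have A2 u : A u ^+ 2 = (u - y.1) ^+ 2 + e ^+ 2.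
  by rewrite sqr_sqrtr// addr_ge0// sqr_ge0.
have A0 u : 0 < A u by rewrite sqrtr_gt0 ltr_wpDl ?sqr_ge0// exprn_gt0.
have cV : continuous (fun t : R => (osqr t)^-1) := is_derive_continuous is_derive_osqrV.
have inner u : (\int[la]_v (eta y e (u, v))%:E = (3 * pi * e ^+ 4 * (A u)^-1 ^+ 5)%:E)%E.
  have ce : continuous (fun v => eta y e (u, v)).
    move=> v; apply: (@continuous_comp R T2 R (fun v => (u, v)) (eta y e) v); last first.
      exact: (smooth_continuous (smooth_eta y en)).
    move=> U [[B C] [/= nB nC] hU].
    by apply: filterS nC => w Cw; apply: hU; split => //=; exact: nbhs_singleton nB.
  rewrite (@affine_substitution _ _ (A u) y.2 (A0 u) ce); last by move=> v; exact: eta_ge0.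
  transitivity (\int[la]_t (8 * e ^+ 4 * (A u)^-1 ^+ 5 * (osqr t)^-1 ^+ 3)%:E)%E.
    apply: eq_integral => t _; congr EFin; rewrite etaE qdenE /=.
    have -> : (u - y.1) ^+ 2 + (A u * t + y.2 - y.2) ^+ 2 + e ^+ 2 = A u ^+ 2 * osqr t.
      by rewrite addrK [X in X + _]addrC -addrA -A2 /osqr; ring.
    have := osqr_neq0 t; have : A u != 0 by rewrite gt_eqF.
    by move: (osqr t) (A u) => b a a0 b0; field; rewrite a0 b0.
  rewrite (@integral_scale _ _ (3 / 8 * pi)).
  - by congr EFin; field; rewrite gt_eqF.
  - by rewrite mulr_ge0 ?exprn_ge0 ?invr_ge0 ?(ltW (A0 u))// mulr_ge0 ?exprn_ge0 ?ltW.
  - apply: measurable_funX; exact: continuous_measurable_fun.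
  - by move=> t; rewrite exprn_ge0// invr_ge0 osqr_ge0.
  - exact: integral_osqr3.
under eq_integral do rewrite inner.
have cA : continuous A.
  move=> u; apply: (@continuous_comp R R R (fun u => (u - y.1) ^+ 2 + e ^+ 2) Num.sqrt); last first.
    exact: sqrt_continuous.
  apply: (@continuousD _ _ _ (fun u => (u - y.1) ^+ 2) (fun=> e ^+ 2)); last exact: cst_continuous.
  apply: (@continuousM _ _ (fun u => u - y.1) (fun u => u - y.1));
   by apply: (@continuousB _ _ _ id (fun=> y.1)); [exact: cvg_id|exact: cst_continuous].
have cAV : continuous (fun u => (A u)^-1).
  by move=> u; apply: (@continuousV _ _ A); [rewrite gt_eqF|exact: cA].
have cf : continuous (fun u => 3 * pi * e ^+ 4 * (A u)^-1 ^+ 5).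
  apply: continuous1M; first exact: cst_continuous.
  rewrite (_ : (fun t => _) = fun t => (A t)^-1 * ((A t)^-1 * ((A t)^-1 * ((A t)^-1 * (A t)^-1)))).
    by do 4 apply: continuous1M => //.
  by apply: funext => t; rewrite !exprS expr0 mulr1.
have pi0 : 0 <= pi :> R by exact: pi_ge0.
rewrite (@affine_substitution _ _ e y.1 e0 cf); last first.
  move=> t; rewrite mulr_ge0 ?exprn_ge0 ?invr_ge0 ?(ltW (A0 t))//.
  by apply: mulr_ge0; [exact: mulr_ge0|exact/exprn_ge0/ltW].
transitivity (\int[la]_t (3 * pi * ((Num.sqrt (osqr t))^-1 ^+ 5))%:E)%E.
  apply: eq_integral => t _; congr EFin.
  have -> : A (e * t + y.1) = e * Num.sqrt (osqr t).
    rewrite /A addrK (_ : (e * t) ^+ 2 + e ^+ 2 = e ^+ 2 * osqr t); last by rewrite /osqr; ring.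
    by rewrite sqrtrM ?sqr_ge0// sqrtr_sqr (ger0_norm (ltW e0)).
  have : Num.sqrt (osqr t) != 0 by rewrite gt_eqF// sqrtr_gt0 osqr_gt0.
  by move: (Num.sqrt _) => a a0; field; rewrite a0 en.
rewrite (@integral_scale _ _ (4 / 3)).
- by congr EFin; field.
- exact: mulr_ge0.
- apply: measurable_funX; apply: continuous_measurable_fun => t.
  apply: (@continuousV _ _ (fun t => Num.sqrt (osqr t))); first by rewrite gt_eqF// sqrtr_gt0 osqr_gt0.
  apply: (@continuous_comp R R R osqr Num.sqrt); last exact: sqrt_continuous.
  exact: (is_derive_continuous is_derive_osqr).
- by move=> t; rewrite exprn_ge0// invr_ge0 sqrtr_ge0.
- exact: integral_osqr5.
Qed.

Lemma sq_finite_measure x r : (mu (sq x r : set TM) < +oo)%E.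
Proof.
pose J c : set R := `[c - r, c + r]%classic.
have -> : mu (sq x r : set TM) = (la (J x.1) * la (J x.2))%E.
  by rewrite sqE; apply: product_measure1E; exact: measurable_itv.
have fin c : la (J c) \is a fin_num.
  rewrite ge0_fin_numE ?measure_ge0// lebesgue_measure_itv /=.
  by case: ifP => _; rewrite ltry.
by rewrite -(fineK (fin x.1)) -(fineK (fin x.2)) -EFinM ltry.
Qed.

Lemma compact_sub_sq K : compact K -> exists2 r : R, 0 < r & K `<=` sq 0 r.
Proof.
move=> /compact_bounded [M [_ /(_ (Num.max 1 (M + 1)))]] /= hM.
have M1 : M < Num.max 1 (M + 1) by rewrite lt_max ltrDl ltr01 orbT.
exists (Num.max 1 (M + 1)); first by rewrite lt_max ltr01.
move=> z /(hM M1); rewrite prod_normE ge_max => /andP[h1 h2].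
by split; rewrite subr0.
Qed.

Lemma compact_finite_measure K : compact K -> (mu (K : set TM) < +oo)%E.
Proof.
move=> cK; have [r _ hK] := compact_sub_sq cK.
apply: le_lt_trans (sq_finite_measure 0 r); apply: le_measure => //.
- by rewrite inE; exact: compact_measurableT2.
- by rewrite inE; apply: compact_measurableT2; exact: sq_compact.
Qed.

Lemma continuous_L1loc Omega f : open Omega -> {in Omega, continuous f} -> L1loc Omega f.
Proof.
move=> oO cf; split; first exact: continuous_measurableT2.
move=> K cK KO.
have : bounded_set (f @` K).
  apply: compact_bounded; apply: continuous_compact => //.
  apply: continuous_in_subspaceT => z; rewrite inE => Kz.
  by apply: cf; rewrite inE; exact: KO.
move=> [M [_ /(_ (M + 1))]] /= hM.
have {}hM z : K z -> `|f z| <= M + 1 by move=> Kz; apply: hM; [rewrite ltrDl|exists z].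
have mK := compact_measurableT2 cK.
apply: (@le_lt_trans _ _ (\int[mu]_(x in K) (M + 1)%:E)%E).
  apply: ge0_le_integral => //.
  - apply/measurable_EFinP; apply: measurableT_comp => //.
    apply: measurable_funS (continuous_measurableT2 oO cf) => //.
    exact: open_measurableT2.
rewrite integral_cst//.
have : (mu (K : set TM) \is a fin_num)%E by rewrite ge0_fin_numE// compact_finite_measure.
by move=> /fineK <-; rewrite -EFinM ltry.
Qed.


Lemma testfun_integrableT h : testfun setT h -> mu.-integrable (setT : set TM) (EFin \o h).
Proof.
move=> th; have L1 : L1loc (setT : set T2) (fun=> 1 : R).
  by apply: continuous_L1loc; [exact: openT|move=> z _; exact: cst_continuous].
have := testfun_integrable openT L1 th; apply: eq_integrable => // z _ /=.
by rewrite mul1r.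
Qed.

Lemma integral_derivative_compact (f df : R -> R) r : 0 < r ->
  (forall t, is_derive t 1 f (df t)) -> continuous df ->
  (forall t, r <= `|t| -> f t = 0) -> (forall t, r < `|t| -> df t = 0) ->
  (\int[la]_t (df t)%:E = 0)%E.
Proof.
move=> r0 dF cdf f0 df0.
have -> : (\int[la]_t (df t)%:E)%E = (\int[la]_(t in `[(- r)%R, r]%classic) (df t)%:E)%E.
  rewrite [RHS]integral_mkcond; apply: eq_integral => t _; rewrite patchE.
  case: ifPn => //; rewrite notin_setE /= in_itv /= -ler_norml => /negP.
  by rewrite -ltNge => /df0 ->.
rewrite (@continuous_FTC2 _ df f); last 4 first.
- by lra.
- exact: continuous_subspaceT.
- have cf := is_derive_continuous dF.
  by split; [move=> t _; have [] := dF t|apply: cvg_at_right_filter; exact: cf|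
    apply: cvg_at_left_filter; exact: cf].
- by move=> t _; rewrite derive1E; have [_ ->] := dF t.
by rewrite !f0 ?subee// ?normrN ger0_norm// ltW.
Qed.

(** The inner integral is taken in direction i, where the fundamental theorem of calculus gives zero
    on every line. *)
Lemma integral_partial i f : smooth f -> (exists2 K, compact K & forall z, ~ K z -> f z = 0) ->
  \int[mu]_(z in (setT : set TM)) partial i f z = 0.
Proof.
move=> sf [K cK hK]; have sd := smooth_partial i sf.
have clK := compact_closedT2 cK.
have tp : testfun setT (partial i f).
  split; first exact: smooth_continuous.
  by exists K; split=> //; exact: (@partial_off _ i _ _ clK hK).
have ip := testfun_integrableT tp.
have [r r0 hr] := compact_sub_sq cK.
have off z : ~ sq 0 r z -> f z = 0 by move=> h; apply: hK => /hr.
have doff z : ~ sq 0 r z -> partial i f z = 0.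
  exact: (@partial_off _ i _ _ (@sq_closed _ 0 r) off).
have coord z : r < `|z.1| \/ r < `|z.2| -> ~ sq 0 r z.
  by move=> h [h1 h2]; move: h1 h2; rewrite !subr0; case: h => ? ? ?; lra.
have r1 : 0 < r + 1 by rewrite addr_gt0.
have bd z : r + 1 <= `|z.1| \/ r + 1 <= `|z.2| -> f z = 0.
  by move=> h; apply/off/coord; case: h => h; [left|right]; lra.
have cp := smooth_continuous sd.
have cpair1 u : continuous (fun v => partial i f (u, v)).
  move=> v; apply: (@continuous_comp R T2 R (fun v => (u, v)) (partial i f) v); last exact: cp.
  move=> U [[B C] [/= nB nC] hU].
  by apply: filterS nC => w Cw; apply: hU; split => //=; exact: nbhs_singleton nB.
have cpair2 v : continuous (fun u => partial i f (u, v)).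
  move=> u; apply: (@continuous_comp R T2 R (fun u => (u, v)) (partial i f) u); last exact: cp.
  move=> U [[B C] [/= nB nC] hU].
  by apply: filterS nB => w Cw; apply: hU; split => //=; exact: nbhs_singleton nC.
rewrite /Rintegral; suff -> : (\int[mu]_z (partial i f z)%:E = 0)%E by [].
move: i ip {tp sd} doff cp cpair1 cpair2; elim/ord2_ind => ip doff cp cpair1 cpair2.
- rewrite -(@integral21_prod_meas1 _ _ (measurableTypeR R) (measurableTypeR R) R la la _ ip) /fubini_G /=.
  apply: integral0_eq => v _.
  apply: (@integral_derivative_compact (fun u => f (u, v)) _ (r + 1) r1) => //.
  + by move=> u; apply: (@derivable_slice_fst _ f (u, v)); exact: smooth_has_partial.
  + by move=> u hu; apply: bd; left.
  + by move=> u hu; apply/doff/coord; left; rewrite /=; lra.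
- rewrite -(@integral12_prod_meas1 _ _ (measurableTypeR R) (measurableTypeR R) R la la _ ip) /fubini_F /=.
  apply: integral0_eq => u _.
  apply: (@integral_derivative_compact (fun v => f (u, v)) _ (r + 1) r1) => //.
  + by move=> v; apply: (@derivable_slice_snd _ f (u, v)); exact: smooth_has_partial.
  + by move=> v hv; apply: bd; right.
  + by move=> v hv; apply/doff/coord; right; rewrite /=; lra.
Qed.

End plane_integrals.

(** * The approximate identity [eta] *)

Section mollification.
Context {R : realType}.
Local Notation T2 := (R * R)%type.
Local Notation TM := (measurableTypeR R * measurableTypeR R)%type.
Local Notation mu := (@lebesgue2 R).
Implicit Types (z x y : T2) (r s c d e t u v : R) (K A Omega : set T2) (g h f phi : T2 -> R).

Lemma eta_sym y e z : eta y e z = eta z e y.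
Proof. by rewrite !etaE !qdenE; congr (_ * _^-1 ^+ 3); ring. Qed.

Lemma measurable_eta y e : e != 0 -> measurable_fun (setT : set TM) (eta y e).
Proof. by move=> e0; exact: (continuous_measurableT2T (smooth_continuous (smooth_eta y e0))). Qed.

Lemma eta_integrable y e : 0 < e -> mu.-integrable (setT : set TM) (EFin \o eta y e).
Proof.
move=> e0; apply/integrableP; split.
  by apply/measurable_EFinP; apply: measurable_eta; rewrite gt_eqF.
under eq_integral do rewrite /= ger0_norm ?eta_ge0//.
by rewrite eta_integral// ltry.
Qed.

Lemma Rintegral_eta y e : 0 < e -> \int[mu]_z eta y e z = 4 * pi.
Proof. by move=> e0; rewrite /Rintegral eta_integral. Qed.

(** Off the square, q = |z - y|^2 is at least d^2, so q + 1 <= (1 + d^-2) q. The tail is thus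
    bounded by a multiple of e^4 times the fixed integrable profile [eta y 1]. *)
Lemma eta_tail y e d z : 0 < e -> 0 < d -> ~ sq y d z ->
  eta y e z <= e ^+ 4 * (1 + d^-1 ^+ 2) ^+ 3 * eta y 1 z.
Proof.
move=> e0 d0 nz; rewrite !etaE !qdenE !expr1n.
set q := (z.1 - y.1) ^+ 2 + (z.2 - y.2) ^+ 2.
have q0 : 0 <= q by rewrite addr_ge0 ?sqr_ge0.
have d2 : 0 < d ^+ 2 by rewrite exprn_gt0.
have qd : d ^+ 2 <= q.
  have [h1|h1] := leP `|z.1 - y.1| d.
    have [h2|h2] := leP `|z.2 - y.2| d; first by case: nz.
    apply: (@le_trans _ _ ((z.2 - y.2) ^+ 2)); last by rewrite lerDr sqr_ge0.
    by rewrite -[leRHS]real_normK ?num_real// ler_pXn2r ?nnegrE ?normr_ge0 ?(ltW d0) ?(ltW h2).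
  apply: (@le_trans _ _ ((z.1 - y.1) ^+ 2)); last by rewrite lerDl sqr_ge0.
  by rewrite -[leRHS]real_normK ?num_real// ler_pXn2r ?nnegrE ?normr_ge0 ?(ltW d0) ?(ltW h1).
have e2 : 0 < e ^+ 2 by rewrite exprn_gt0.
have qp : 0 < q by exact: lt_le_trans qd.
have h : (q + e ^+ 2)^-1 <= (1 + d^-1 ^+ 2) * (q + 1)^-1.
  rewrite ler_pdivlMr; last by rewrite ltr_wpDl.
  rewrite mulrC ler_pdivrMr; last exact: ltr_wpDl.
  have dq : 1 <= d^-1 ^+ 2 * q by rewrite exprVn mulrC ler_pdivlMr// mul1r.
  have d20 : 0 <= d^-1 ^+ 2 by exact: sqr_ge0.
  by move: dq d20 e2 q0; move: (d^-1 ^+ 2) (e ^+ 2) => a b; clear => *; nra.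
have -> : e ^+ 4 * (1 + d^-1 ^+ 2) ^+ 3 * (8 * 1 * (q + 1)^-1 ^+ 3) =
   8 * e ^+ 4 * ((1 + d^-1 ^+ 2) * (q + 1)^-1) ^+ 3 by ring.
apply: ler_wpM2l; first by rewrite mulr_ge0// exprn_ge0// ltW.
apply: lerXn2r => //; rewrite nnegrE.
  by rewrite invr_ge0 (addr_ge0 q0 (ltW e2)).
apply: mulr_ge0; first exact: (addr_ge0 ler01 (sqr_ge0 _)).
by rewrite invr_ge0 (addr_ge0 q0 ler01).
Qed.

Lemma testfun_uniform phi s : 0 < s -> testfun setT phi ->
  exists d, 0 < d /\ forall z y, sq z d y -> `|phi y - phi z| < s.
Proof.
move=> s0 [cp [K [cK _ hK]]]; have [r r0 hr] := compact_sub_sq cK.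
have : \forall w \near (0 : T2), forall z, sq 0 (r + 1) z -> `|phi (z + w) - phi z| < s.
  apply: (@near_uniform R T2 (nbhs (0 : T2)) (sq 0 (r + 1)) (fun z (w : T2) => phi (z + w)) phi s).
    exact: sq_compact.
  move=> z _; have s2 : 0 < s / 2 by rewrite divr_gt0.
  have c0 : (fun w : T2 * T2 => phi (w.1 + w.2)) @ (z, 0 : T2) --> phi z.
    rewrite -{2}[z]addr0.
    apply: (@continuous_comp _ _ _ (fun w : T2 * T2 => w.1 + w.2) phi (z, 0)); last exact: cp.
    by apply: (@continuousD _ _ _ fst snd); [exact: cvg_fst|exact: cvg_snd].
  move: c0 => /cvgrPdist_lt /(_ _ s2) [[U V] [/= nU nV] hUV].
  exists (U, V) => // -[z' h] [/= Uz' Vh].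
  have h1 := hUV (z', h) (conj Uz' Vh).
  have h2 := hUV (z', 0) (conj Uz' (nbhs_singleton nV)).
  rewrite /= addr0 in h1 h2; rewrite distrC in h1.
  rewrite -(subrKA (phi z)); apply: le_lt_trans (ler_normD _ _) _.
  by rewrite [s]splitr ltrD.
move=> /nbhs_sq [d [d0 hd]].
exists (Num.min d 1); split; first by rewrite lt_min d0 ltr01.
move=> z y hy; have [hz|hz] := pselect (sq 0 (r + 1) z).
  have -> : y = z + (y - z) by rewrite addrC subrK.
  apply: hd hz; apply: (@sqS _ _ (Num.min d 1)); first by rewrite ge_min lexx.
  by move: hy => [h1 h2]; split => /=; rewrite subr0.
rewrite !hK ?subrr ?normr0//.
  by move=> /hr h; apply: hz; apply: sqS h; rewrite lerDl.
move=> /hr h; apply: hz; apply: (sq_trans h); apply: sq_sym.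
by apply: sqS hy; rewrite ge_min lexx orbT.
Qed.

Lemma bounded_mul_integrable h f (M : R) : mu.-integrable (setT : set TM) (EFin \o h) ->
  measurable_fun (setT : set TM) f -> (forall z, `|f z| <= M) ->
  mu.-integrable (setT : set TM) (EFin \o (fun z => h z * f z)).
Proof.
move=> ih mf hM.
apply: (le_integrable (measurableT : measurable (setT : set TM)) (f := EFin \o (fun z => h z * f z)) (g := EFin \o (fun z => M * h z))).
- apply/measurable_EFinP; apply: measurable_funM => //.
  by have /measurable_EFinP := measurable_int _ ih.
- move=> z _ /=; rewrite lee_fin !normrM mulrC ler_wpM2r//.
  by apply: le_trans (hM z) _; exact: ler_norm.
- exact: (integrableZl measurableT M ih).
Qed.

Lemma eta_testfun_integrable phi z e : 0 < e -> testfun setT phi ->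
  mu.-integrable (setT : set TM) (EFin \o (fun y => eta z e y * phi y)).
Proof.
move=> e0 tp; have [M M0 hM] := testfun_bounded tp.
have ie := eta_integrable z e0.
apply: (bounded_mul_integrable ie) hM.
by case: tp => cp _; exact: continuous_measurableT2T.
Qed.

(** Near z the uniform continuity of [phi] is used, away from z the tail estimate together with e^4
    <= e; both are independent of z. The constant [B] collects the factors of the tail. *)
Lemma eta_approx phi s : 0 < s -> testfun setT phi ->
  exists d, 0 < d /\ forall e, 0 < e -> e <= d -> forall z,
  `|\int[mu]_y (eta y e z * phi y) - 4 * pi * phi z| <= s.
Proof.
move=> s0 tp; have [M M0 hM] := testfun_bounded tp.
have p0 : 0 < 4 * pi :> R := pi4_gt0.
have s1 : 0 < s / 2 / (4 * pi) by rewrite !divr_gt0.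
have [d [d0 hd]] := testfun_uniform s1 tp.
pose c := (1 + d^-1 ^+ 2) ^+ 3.
have c0 : 0 < c by rewrite exprn_gt0// ltr_pwDl// sqr_ge0.
pose B := 2 * M * c * (4 * pi) + 1.
have B0 : 0 < B.
  rewrite ltr_wpDl//; apply: mulr_ge0 (ltW p0); apply: mulr_ge0 (ltW c0).
  exact: mulr_ge0.
exists (Num.min 1 (s / 2 / B)); split; first by rewrite lt_min ltr01 !divr_gt0.
move=> e e0 he z; have en : e != 0 by rewrite gt_eqF.
have e1 : e <= 1 by apply: le_trans he _; rewrite ge_min lexx.
have eB : e <= s / 2 / B by apply: le_trans he _; rewrite ge_min lexx orbT.
have e4 : e ^+ 4 <= e.
  by rewrite -[leRHS]mulr1 exprS ler_wpM2l ?(ltW e0)// exprn_ile1 ?(ltW e0).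
have -> : \int[mu]_y (eta y e z * phi y) = \int[mu]_y (eta z e y * phi y).
  by apply: eq_Rintegral => y _; rewrite eta_sym.
have MC0 : 0 <= 2 * M * c * e := mulr_ge0 (mulr_ge0 (mulr_ge0 (ler0n _ 2) M0) (ltW c0)) (ltW e0).
have ie := eta_integrable z e0; have i1 := eta_integrable z (@ltr01 R).
have ip := eta_testfun_integrable z e0 tp.
have -> : 4 * pi * phi z = \int[mu]_y (eta z e y * phi z).
  by rewrite RintegralZr// Rintegral_eta.
have iz : mu.-integrable (setT : set TM) (EFin \o (fun y => eta z e y * phi z)).
  have := integrableZl measurableT (phi z) ie; apply: eq_integrable => // y _ /=.
  by rewrite -EFinM mulrC.
rewrite -RintegralB//.
have iD : mu.-integrable (setT : set TM) (EFin \o (fun y => eta z e y * phi y - eta z e y * phi z)).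
  by have := integrableB measurableT ip iz; apply: eq_integrable.
apply: le_trans (le_normr_Rintegral _ iD) _ => //.
have ia : mu.-integrable (setT : set TM) (EFin \o (fun y => s / 2 / (4 * pi) * eta z e y)).
  exact: (integrableZl measurableT _ ie).
have ib : mu.-integrable (setT : set TM) (EFin \o (fun y => 2 * M * c * e * eta z 1 y)).
  exact: (integrableZl measurableT _ i1).
have iab : mu.-integrable (setT : set TM) (EFin \o (fun y => s / 2 / (4 * pi) * eta z e y + 2 * M * c * e * eta z 1 y)).
  by have := integrableD measurableT ia ib; apply: eq_integrable.
apply: (@le_trans _ _ (\int[mu]_y (s / 2 / (4 * pi) * eta z e y + 2 * M * c * e * eta z 1 y))).
  apply: le_Rintegral => //; first exact: (integrable_abse iD).
  move=> y _; rewrite -mulrBr normrM ger0_norm ?eta_ge0//.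
  have [hy|hy] := pselect (sq z d y).
    apply: ler_wpDr; first exact: (mulr_ge0 MC0 (eta_ge0 _ _ _)).
    by rewrite mulrC ler_wpM2r ?eta_ge0// ltW// hd.
  apply: ler_wpDl; first by rewrite mulr_ge0 ?eta_ge0// ltW.
  have ht := eta_tail e0 d0 hy.
  have hb : `|phi y - phi z| <= 2 * M.
    by apply: le_trans (ler_normB _ _) _; rewrite mulr2n mulrDl !mul1r lerD.
  apply: (@le_trans _ _ (e ^+ 4 * c * eta z 1 y * (2 * M))).
    by apply: ler_pM => //; exact: eta_ge0.
  have -> : 2 * M * c * e * eta z 1 y = e * c * eta z 1 y * (2 * M) by ring.
  apply: ler_wpM2r; first exact: mulr_ge0.
  apply: ler_wpM2r; first exact: eta_ge0.
  by apply: ler_wpM2r; first exact: ltW.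
rewrite (RintegralD measurableT ia ib) (RintegralZl _ measurableT ie) (RintegralZl _ measurableT i1).
rewrite (Rintegral_eta z e0) (Rintegral_eta z ltr01).
rewrite divfK ?gt_eqF// [leRHS]splitr lerD2l.
have -> : 2 * M * c * e * (4 * pi) = e * (2 * M * c * (4 * pi)) by ring.
apply: (@le_trans _ _ (e * B)); last by rewrite -ler_pdivlMr.
by apply: ler_wpM2l; [exact: ltW|rewrite lerDl].
Qed.

Lemma plane_sigma_finite : sigma_finite (setT : set TM) mu.
Proof.
exists (fun n => sq (0 : T2) n%:R).
  apply/seteqP; split => // z _; exists (Num.truncn (Num.max `|z.1| `|z.2|)).+1 => //=.
  have h := truncnS_gt (Num.max `|z.1| `|z.2|); move: h.
  by rewrite gt_max => /andP[h1 h2]; split => /=; rewrite subr0 ltW.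
move=> n; split; last exact: sq_finite_measure.
exact: (closed_measurableT2 (@sq_closed _ _ _)).
Qed.

(* The library declares products of measures sigma-finite only for
   subprobabilities. *)
Definition plane_fun : set TM -> \bar R := mu.
HB.instance Definition _ := Measure.copy plane_fun mu.
HB.instance Definition _ :=
  Measure_isSigmaFinite.Build _ _ _ plane_fun plane_sigma_finite.
Definition plane : {sigma_finite_measure set TM -> \bar R} := plane_fun.

(** The integrand on the product of two planes is at most M |g| |phi|, hence integrable. The copy
    [plane] of the measure carries the sigma-finite structure under which Fubini's theorem is
    applied. *)
Lemma kernel_Fubini g phi (k : T2 -> T2 -> R) M : 0 <= M ->
  mu.-integrable (setT : set TM) (EFin \o g) -> mu.-integrable (setT : set TM) (EFin \o phi) ->
  (forall z y, `|k z y| <= M) ->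
  measurable_fun (setT : set (TM * TM)) (fun w => k w.1 w.2) ->
  mu.-integrable (setT : set TM) (EFin \o (fun z => g z * \int[mu]_y (k z y * phi y))) /\
  \int[mu]_y ((\int[mu]_z (g z * k z y)) * phi y) =
  \int[mu]_z (g z * \int[mu]_y (k z y * phi y)).
Proof.
move=> M0 ig ip kM mk.
have mg : measurable_fun (setT : set TM) g by have /measurable_EFinP := measurable_int _ ig.
have mp : measurable_fun (setT : set TM) phi by have /measurable_EFinP := measurable_int _ ip.
pose f (w : TM * TM) : \bar R := (g w.1 * k w.1 w.2 * phi w.2)%:E.
pose m := plane.
have mf : measurable_fun (setT : set (TM * TM)) f.
  apply/measurable_EFinP; apply: measurable_funM; first apply: measurable_funM => //.
    exact: (measurableT_comp mg (@measurable_fst _ _ TM TM)).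
  exact: (measurableT_comp mp (@measurable_snd _ _ TM TM)).
have igz y : mu.-integrable (setT : set TM) (EFin \o (fun z => g z * k z y)).
  apply: (bounded_mul_integrable ig) (kM^~ y).
  exact: (measurableT_comp mk (measurable_pair2 y)).
have ipy z : mu.-integrable (setT : set TM) (EFin \o (fun y => phi y * k z y)).
  apply: (bounded_mul_integrable ip) (kM z).
  exact: (measurableT_comp mk (measurable_pair1 z)).
have ipa := integrable_abse ip.
pose N := \int[mu]_y `|phi y|.
have NE : (\int[m]_y (`|phi y|)%:E = N%:E)%E.
  by rewrite /N /Rintegral fineK//; exact: (integrable_fin_num measurableT ipa).
have if_ : (m \x m)%E.-integrable setT f.
  apply/integrable12ltyP => //.
  apply: (@le_lt_trans _ _ (\int[m]_z (M * N * `|g z|)%:E)%E); last first.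
    have := integrableZl measurableT (M * N) (integrable_abse ig) => /integrableP[_].
    apply: le_lt_trans; apply: ge0_le_integral => //.
    - move=> z _; rewrite lee_fin mulr_ge0// mulr_ge0//.
      by apply: Rintegral_ge0.
    - by apply/measurable_EFinP; apply: measurable_funM => //; exact: measurableT_comp.
    - apply: measurableT_comp => //; apply: emeasurable_funM => //.
      by apply/measurable_EFinP; exact: measurableT_comp.
    - by move=> z _ /=; exact: lee_abs.
  apply: ge0_le_integral => //.
  - by move=> z _; exact: integral_ge0.
  - apply: (measurable_fun_fubini_tonelli_F (m2 := m) (abse \o f)).
      exact: measurableT_comp.
    by move=> ?; exact: abse_ge0.
  - by apply/measurable_EFinP; apply: measurable_funM => //; exact: measurableT_comp.
  - move=> z _.
    have -> : (M * N * `|g z|)%:E = (\int[m]_y (M * `|g z| * `|phi y|)%:E)%E.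
      under eq_integral do rewrite EFinM.
      rewrite ge0_integralZl_EFin//.
      + by rewrite NE -EFinM; congr EFin; ring.
      + by apply/measurable_EFinP; exact: measurableT_comp.
      + exact: mulr_ge0.
    apply: ge0_le_integral => //.
    - apply: measurableT_comp => //.
      exact: (measurableT_comp mf (measurable_pair1 z)).
    - by apply/measurable_EFinP; apply: measurable_funM => //; exact: measurableT_comp.
    - move=> y _; rewrite lee_fin !normrM; apply: ler_wpM2r => //.
      by rewrite mulrC ler_wpM2r.
have e1 y : ((\int[mu]_z (g z * k z y)) * phi y)%:E = (\int[m]_z f (z, y))%E.
  rewrite -(RintegralZr _ measurableT (igz y)) /Rintegral fineK//.
  apply: (integrable_fin_num measurableT).
  have := integrableZl measurableT (phi y) (igz y); apply: eq_integrable => // z _ /=.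
  by rewrite -EFinM mulrC.
have e2 z : (g z * \int[mu]_y (k z y * phi y))%:E = (\int[m]_y f (z, y))%E.
  have ikp : mu.-integrable (setT : set TM) (EFin \o (fun y => k z y * phi y)).
    by apply: eq_integrable (ipy z) => // y _ /=; rewrite mulrC.
  rewrite -(RintegralZl _ measurableT ikp).
  have -> : (\int[m]_y f (z, y) = \int[m]_y (g z * (k z y * phi y))%:E)%E.
    by apply: eq_integral => y _; rewrite /f /= mulrA.
  rewrite /Rintegral fineK//; apply: (integrable_fin_num measurableT).
  exact: (integrableZl measurableT (g z) ikp).
split.
  by apply: eq_integrable (@integrable_fubini_F _ _ TM TM R m m f if_) => // z _ /=; rewrite e2.
rewrite /Rintegral; congr fine.
transitivity (\int[m]_y \int[m]_z f (z, y))%E; first by apply: eq_integral => y _; rewrite -e1.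
rewrite -(@Fubini _ _ TM TM R m m f if_).
by apply: eq_integral => z _; rewrite -e2.
Qed.

End mollification.

(** * The point values represent the form *)

Section weak_identity.
Context {R : realType}.
Local Notation T2 := (R * R)%type.
Local Notation TM := (measurableTypeR R * measurableTypeR R)%type.
Local Notation mu := (@lebesgue2 R).
Implicit Types (z x y : T2) (r s c d e t u v : R) (K A Omega : set T2) (g h f phi chi : T2 -> R).

Lemma measurable_eta_joint e : e != 0 ->
  measurable_fun (setT : set (TM * TM)) (fun w => eta w.1 e w.2).
Proof.
move=> e0; have e2 : 0 < e ^+ 2 by rewrite lt0r sqrf_eq0 e0 sqr_ge0.
(* The absolute value makes [io] continuous on the whole line; it is only evaluated at non-negative
   arguments, where it is the inverse of [qden]. *)
pose io (t : R) := (`|t| + e ^+ 2)^-1.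
have cio : continuous io.
  move=> t; apply: cvgV; first by rewrite gt_eqF// ltr_wpDl.
  apply: cvgD; last exact: cvg_cst.
  by apply: cvg_norm; exact: cvg_id.
have mio := continuous_measurable_fun cio.
have m11 : measurable_fun (setT : set (TM * TM)) (fun w => w.1.1 : R).
  by apply: measurableT_comp => //; exact: measurable_fst.
have m12 : measurable_fun (setT : set (TM * TM)) (fun w => w.1.2 : R).
  by apply: measurableT_comp => //; exact: measurable_fst.
have m21 : measurable_fun (setT : set (TM * TM)) (fun w => w.2.1 : R).
  by apply: measurableT_comp => //; exact: measurable_snd.
have m22 : measurable_fun (setT : set (TM * TM)) (fun w => w.2.2 : R).
  by apply: measurableT_comp => //; exact: measurable_snd.
have mq : measurable_fun (setT : set (TM * TM))
    (fun w => io ((w.2.1 - w.1.1) ^+ 2 + (w.2.2 - w.1.2) ^+ 2)).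
  apply: (measurableT_comp mio); apply: measurable_funD; apply: measurable_funX;
    exact: measurable_funB.
rewrite (_ : (fun w : TM * TM => eta w.1 e w.2) =
   fun w => 8 * e ^+ 4 * io ((w.2.1 - w.1.1) ^+ 2 + (w.2.2 - w.1.2) ^+ 2) ^+ 3).
  by apply: measurable_funM; [exact: measurable_cst|exact: measurable_funX].
apply: funext => w; rewrite etaE qdenE /io ger0_norm//.
by rewrite addr_ge0 ?sqr_ge0.
Qed.

Lemma eta_le y e z : e != 0 -> eta y e z <= 8 * e ^+ 4 * (e ^+ 2)^-1 ^+ 3.
Proof.
move=> e0; have e2 : 0 < e ^+ 2 by rewrite lt0r sqrf_eq0 e0 sqr_ge0.
have q : e ^+ 2 <= qden y e z by rewrite qdenE lerDr addr_ge0 ?sqr_ge0.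
rewrite etaE; apply: ler_wpM2l.
  by apply: mulr_ge0 => //; rewrite (_ : 4 = 2 * 2)%N// exprM sqr_ge0.
apply: lerXn2r; rewrite ?nnegrE ?invr_ge0 ?(ltW e2)//.
  exact: le_trans (ltW e2) q.
by rewrite lef_pV2 ?posrE//; exact: lt_le_trans q.
Qed.

(** Fubini, after [g] has been restricted to the compact support of [chi], where it is integrable.
    The average over y of the pairings with [eta y e] is moved onto the test function [phi]. *)
Lemma mollify_pairing Omega g chi phi e : open Omega -> L1loc Omega g -> 0 < e ->
  testfun Omega chi -> (forall z, `|chi z| <= 1) -> testfun setT phi ->
  mu.-integrable (setT : set TM)
    (EFin \o (fun y => phi y * ipair Omega g (fun z => chi z * eta y e z))) /\
  \int[mu]_y (phi y * ipair Omega g (fun z => chi z * eta y e z)) =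
  ipair Omega g (fun z => chi z * \int[mu]_y (eta y e z * phi y)).
Proof.
move=> oO Lg ep [cchi [K [cK KO hK]]] chi1 tphi.
have e0 : e != 0 by rewrite gt_eqF.
have mK : measurable (K : set TM) := compact_measurableT2 cK.
pose G := g \_ K.
have iG : mu.-integrable (setT : set TM) (EFin \o G).
  have := L1loc_integrable oO Lg cK KO.
  by rewrite integrable_mkcond//; apply: eq_integrable => // z _; rewrite /= restrict_EFin.
have GE h : (forall z, ~ K z -> h z = 0) -> ipair Omega g h = \int[mu]_z (h z * G z).
  move=> h0; rewrite (pairing_restrict g cK KO h0) Rintegral_mkcond.
  apply: eq_Rintegral => z _; rewrite /G !patchE; case: ifPn => _; first exact: mulrC.
  by rewrite mulr0.
pose k y z := chi z * eta y e z.
have kM y z : `|k y z| <= 8 * e ^+ 4 * (e ^+ 2)^-1 ^+ 3.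
  rewrite /k normrM -[leRHS]mul1r; apply: ler_pM => //.
  by rewrite ger0_norm ?eta_ge0 ?eta_le.
have M0 : 0 <= 8 * e ^+ 4 * (e ^+ 2)^-1 ^+ 3 by apply: le_trans (kM 0 0).
have mk : measurable_fun (setT : set (TM * TM)) (fun w => k w.1 w.2).
  apply: measurable_funM; last exact: measurable_eta_joint.
  exact: (measurableT_comp (continuous_measurableT2T cchi) (@measurable_snd _ _ TM TM)).
have [ii ee] := kernel_Fubini M0 (testfun_integrableT tphi) iG kM mk.
have E y : ipair Omega g (k y) = \int[mu]_z (k y z * G z).
  by apply: GE => z nK; rewrite /k hK// mul0r.
split.
  by apply: eq_integrable ii => // y _ /=; rewrite -E.
transitivity (\int[mu]_y (phi y * \int[mu]_z (k y z * G z))).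
  by apply: eq_Rintegral => y _; rewrite -E.
rewrite -ee GE; last by move=> z nK; rewrite hK// mul0r.
apply: eq_Rintegral => z _; congr (_ * _).
rewrite -(RintegralZl _ measurableT).
  by apply: eq_Rintegral => y _; rewrite /k mulrCA (mulrC (phi y)).
apply: eq_integrable (eta_testfun_integrable z ep tphi) => // y _ /=.
by rewrite eta_sym.
Qed.

Lemma Rintegral_off K f : (forall z, ~ K z -> f z = 0) ->
  \int[mu]_z f z = \int[mu]_(z in K) f z.
Proof.
move=> h; rewrite [RHS]Rintegral_mkcond; apply: eq_Rintegral => z _.
by rewrite patchE; case: ifPn => //; rewrite notin_setE => /h.
Qed.

Lemma small_eq0 (t B : R) : 0 <= B -> (forall s, 0 < s -> `|t| <= s * B) -> t = 0.
Proof.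
move=> B0 h; apply/eqP; rewrite -normr_le0; apply/ler_addgt0Pr => s s0; rewrite add0r.
have B1 : 0 < B + 1 by rewrite ltr_wpDl.
apply: le_trans (h _ (divr_gt0 s0 B1)) _.
by rewrite mulrAC ler_pdivrMr// ler_pM2l// lerDl.
Qed.

Lemma eta_uniform x e K s : e != 0 -> 0 < s -> compact K ->
  \forall y \near x, forall z, K z -> `|eta y e z - eta x e z| < s.
Proof.
move=> e0 s0 cK.
apply: (@near_uniform R T2 (nbhs x) K (fun z y => eta y e z) (fun z => eta x e z) s) => //.
move=> z Kz; have s2 : 0 < s / 2 by rewrite divr_gt0.
have c0 : (fun w : T2 * T2 => eta w.2 e w.1) @ (z, x) --> eta x e z.
  apply: (@continuous_comp (T2 * T2)%type (T2 * (T2 * R))%type R (fun w => (w.1, (w.2, e)))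
     (fun w => eta w.2.1 w.2.2 w.1) (z, x)).
    apply: (@cvg_pair _ _ _ _ (nbhs z) (nbhs (x, e))); first exact: cvg_fst.
    by apply: (@cvg_pair _ _ _ _ (nbhs x) (nbhs e)); [exact: cvg_snd|exact: cvg_cst].
  by apply: cvg_at_eta; exact: qden_neq0.
move: c0 => /cvgrPdist_lt /(_ _ s2) [[U V] [/= nU nV] hUV].
exists (U, V) => // -[z' y] [/= Uz' Vy].
have h1 := hUV (z', y) (conj Uz' Vy).
have h2 := hUV (z', x) (conj Uz' (nbhs_singleton nV)).
rewrite /= in h1 h2; rewrite distrC in h1.
rewrite -(subrKA (eta x e z)); apply: le_lt_trans (ler_normD _ _) _.
by rewrite [s]splitr ltrD.
Qed.

Lemma mollify_continuous phi e : 0 < e -> testfun setT phi ->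
  continuous (fun z => \int[mu]_y (eta y e z * phi y)).
Proof.
move=> e0 tp z; have en : e != 0 by rewrite gt_eqF.
have [cp [K [cK _ hK]]] := tp.
have ip := integrable_abse (testfun_integrableT tp).
have N0 : 0 <= \int[mu]_y `|phi y| by exact: Rintegral_ge0.
have N1 : 0 < \int[mu]_y `|phi y| + 1 by rewrite ltr_wpDl.
apply/cvgrPdist_le => s s0.
have s1 : 0 < s / (\int[mu]_y `|phi y| + 1) by rewrite divr_gt0.
near=> z'.
have hz y : K y -> `|eta z' e y - eta z e y| < s / (\int[mu]_y `|phi y| + 1).
  by move: y; near: z'; exact: eta_uniform.
have ie w : mu.-integrable (setT : set TM) (EFin \o (fun y => eta y e w * phi y)).
  by apply: eq_integrable (eta_testfun_integrable w e0 tp) => // y _ /=; rewrite eta_sym.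
rewrite -(RintegralB measurableT (ie z) (ie z')).
have iB : mu.-integrable (setT : set TM) (EFin \o (fun y => eta y e z * phi y - eta y e z' * phi y)).
  by apply: eq_integrable (integrableB measurableT (ie z) (ie z')).
apply: le_trans (le_normr_Rintegral measurableT iB) _.
apply: (@le_trans _ _ (\int[mu]_y (s / (\int[mu]_y `|phi y| + 1) * `|phi y|))).
  apply: le_Rintegral => //.
  - exact: (integrable_abse iB).
  - exact: (integrableZl measurableT _ ip).
  move=> y _; rewrite -mulrBl normrM.
  have [Ky|nK] := pselect (K y); last by rewrite hK// normr0 !mulr0.
  by apply: ler_wpM2r => //; rewrite distrC eta_sym (eta_sym y) ltW// hz.
rewrite RintegralZl// mulrAC ler_pdivrMr// ler_pM2l//.
by rewrite lerDl.
Unshelve. all: by end_near.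
Qed.

Section limit_functional.
Variables (Omega : set T2) (I : (T2 -> R) -> R) (E : R).
Hypothesis oO : open Omega.
Hypothesis tI : testform Omega I.
Hypothesis hE : hessian_bound Omega I E.
Variables (P : Type) (F : set_system P) (g : P -> T2 -> R).
Context {FF : ProperFilter F}.
Hypothesis Lg : forall n, L1loc Omega (g n).
Hypothesis ubnd : forall K, compact K -> K `<=` Omega -> exists2 C, 0 <= C &
  forall n h s, continuous h -> (forall z, ~ K z -> h z = 0) ->
    (forall z, `|h z| <= s) -> `|ipair Omega (g n) h| <= C * s.
Hypothesis gI : forall h, testfun Omega h -> ipair Omega (g n) h @[n --> F] --> I h.

(** For a single y this is the convergence of the pairings. It is uniform in y because
    [chi * eta y e] depends continuously on y in the sup norm and the pairings are bounded uniformly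
    in n. *)
Lemma pairing_eta_uniform chi e A s : e != 0 -> 0 < s -> testfun Omega chi ->
  smooth chi -> (forall z, `|chi z| <= 1) -> compact A ->
  \forall n \near F, forall y, A y ->
    `|ipair Omega (g n) (fun z => chi z * eta y e z) - I (fun z => chi z * eta y e z)| < s.
Proof.
move=> e0 s0 [cchi [K [cK KO hK]]] sc chi1 cA.
have [C C0 hC] := ubnd cK KO; have [D D0 hD] := tf_bnd tI cK KO.
have B0 : 0 < C + D + 1 by rewrite ltr_wpDl// addr_ge0.
have s2 : 0 < s / 2 by rewrite divr_gt0.
have s4 : 0 < s / 2 / (C + D + 1) by rewrite divr_gt0.
have tce y : testfun Omega (fun z => chi z * eta y e z).
  split; first exact: (smooth_continuous (smoothM sc (smooth_eta y e0))).
  by exists K; split => // z nK; rewrite hK// mul0r.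
apply: (@near_uniform R P F A
  (fun y n => ipair Omega (g n) (fun z => chi z * eta y e z))
  (fun y => I (fun z => chi z * eta y e z)) s) => // y Ay.
have /cvgrPdist_lt /(_ _ s2) hV := gI (tce y).
exists ([set y' | forall z, K z -> `|eta y' e z - eta y e z| < s / 2 / (C + D + 1)],
  [set n | `|I (fun z => chi z * eta y e z) - ipair Omega (g n) (fun z => chi z * eta y e z)| < s / 2]).
  by split => //; exact: eta_uniform.
move=> [y' n] [/= hy hn].
have cd : continuous (fun z => chi z * eta y' e z - chi z * eta y e z).
  by case: (testfunB (tce y') (tce y)).
have zd z : ~ K z -> chi z * eta y' e z - chi z * eta y e z = 0.
  by move=> nK; rewrite hK// !mul0r subrr.
have bd z : `|chi z * eta y' e z - chi z * eta y e z| <= s / 2 / (C + D + 1).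
  have [Kz|nK] := pselect (K z); last by rewrite zd// normr0 ltW.
  rewrite -mulrBr normrM -[leRHS]mul1r.
  exact: (ler_pM (normr_ge0 _) (normr_ge0 _) (chi1 z) (ltW (hy z Kz))).
have h1 := hC n _ _ cd zd bd; have h2 := hD _ _ cd zd bd.
rewrite (tfB (testform_ipair oO (Lg n)) (tce y') (tce y)) in h1.
rewrite (tfB tI (tce y') (tce y)) in h2.
have hs : (C + D) * (s / 2 / (C + D + 1)) < s / 2.
  by rewrite mulrCA gtr_pMr// ltr_pdivrMr// mul1r ltrDl.
move: hn h1 h2 hs.
move: (s / 2 / _) (ipair _ _ _) (ipair _ _ _) (I _) (I _) => t a b i j.
rewrite [s in _ -> _ -> _ -> _ -> _ < s]splitr; move: (s / 2) => h.
clear => /ltr_normlP[h1 h2] /ler_normlP[h3 h4] /ler_normlP[h5 h6] h7; apply/ltr_normlP; split; lra.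
Qed.

(** The limit that defines a point value is joint in position and e, hence locally uniform in y, and
    the point values are continuous; compactness of the square makes the statement uniform. *)
Lemma eta_pval_uniform x r s : 0 < r -> sq x (2 * r) `<=` Omega -> 0 < s ->
  \forall e \near 0^'+, forall y, sq x (r / 2) y ->
    `|I (fun z => cut x r z * eta y e z) - 4 * pi * pval Omega I y| < s.
Proof.
move=> r0 hr s0; have p0 : 0 < 4 * pi :> R := pi4_gt0.
have s2 : 0 < s / 2 by rewrite divr_gt0.
have s3 : 0 < s / 2 / (4 * pi) by rewrite divr_gt0.
apply: (@near_uniform R R 0^'+ (sq x (r / 2))
  (fun y e => I (fun z => cut x r z * eta y e z))
  (fun y => 4 * pi * pval Omega I y) s); first exact: sq_compact.
move=> y Ay; have oy : osq x r y.
  by case: Ay => a1 a2; split; [apply: le_lt_trans a1 _|apply: le_lt_trans a2 _];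
    rewrite gtr_pMr// invf_lt1// ltr1n.
have Oy : Omega y.
  by apply: hr; apply: sqS (osq_sub oy); rewrite ler_pMl// ler1n.
have [d [d0 hd]] := pvalP oO tI hE Oy (cutoff_cut r0 hr oy) s2.
have /cvgrPdist_lt /(_ _ s3) hc := pval_continuous oO tI hE (mem_set Oy).
exists (sq y d `&` [set y' | `|pval Omega I y - pval Omega I y'| < s / 2 / (4 * pi)],
   [set e | 0 < e /\ e <= d]).
  split => /=; first by apply: filterI => //; exact: sq_nbhs.
  by near=> e; split; near: e; [exact: nbhs_right_gt|exact: nbhs_right_le].
move=> [y' e] [/= [h1 h2] [e0 ed]].
have := hd y' e h1; rewrite gt_eqF// ger0_norm ?(ltW e0)// => /(_ isT ed) h3.
have h4 : `|4 * pi * pval Omega I y - 4 * pi * pval Omega I y'| < s / 2.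
  by rewrite -mulrBr normrM ger0_norm ?(ltW p0)// mulrC -ltr_pdivlMr.
rewrite -(subrKA (4 * pi * pval Omega I y)) [s]splitr.
by apply: le_lt_trans (ler_normD _ _) _; exact: ler_ltD.
Unshelve. all: by end_near.
Qed.

(** Write m for the average of [phi] against [eta] and <g, h> for the pairing. Then 4 pi I(phi) is
    close to 4 pi <g_n, phi> and to <g_n, cut m>, which equals the integral of phi(y) <g_n, cut
    eta_y>; this is close to the integral of phi(y) I(cut eta_y), and that to 4 pi times the
    integral of phi against [pval]. The detour through g_n is what makes Fubini applicable. Here e
    is fixed before n is chosen. *)
Lemma pval_pairing_local x r phi : 0 < r -> sq x (2 * r) `<=` Omega ->
  testfun (sq x (r / 2)) phi -> ipair Omega (pval Omega I) phi = I phi.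
Proof.
move=> r0 hr tp; have p0 : 0 < 4 * pi :> R := pi4_gt0.
have [r1 r2] : r / 2 <= 2 * r /\ r / 2 <= r by split; lra.
have AK : sq x (r / 2) `<=` sq x (2 * r) := sqS r1.
have A1 : sq x (r / 2) `<=` sq x r := sqS r2.
have AO : sq x (r / 2) `<=` Omega by move=> z /AK /hr.
pose A := sq x (r / 2); have cA : compact A := @sq_compact _ _ _.
have mA : measurable (A : set TM) := compact_measurableT2 cA.
have pA z : ~ A z -> phi z = 0.
  by case: tp => _ [K [_ KA hK]] nA; apply: hK => /KA.
have tpT : testfun setT phi := testfunS (@subsetT _ _) tp.
have tpO : testfun Omega phi := testfunS AO tp.
have cK : compact (sq x (2 * r)) := @sq_compact _ _ _.
have [C C0 hC] := ubnd cK hr.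
have tchi : testfun Omega (cut x r).
  split; first exact: smooth_continuous (smooth_cut x r).
  by exists (sq x (2 * r)); split => // z; exact: cut_eq0.
have cp : 0 <= \int[mu]_(z in A) `|phi z| by exact: Rintegral_ge0.
have Lp : L1loc Omega (pval Omega I) := continuous_L1loc oO (pval_continuous oO tI hE).
apply/eqP; rewrite -subr_eq0 -(mulrI_eq0 _ (mulfI (lt0r_neq0 p0))); apply/eqP.
apply: (@small_eq0 _ (2 * \int[mu]_(z in A) `|phi z| + C + 4 * pi)).
  exact: (addr_ge0 (addr_ge0 (mulr_ge0 (ler0n _ _) cp) C0) (ltW p0)).
move=> s s0.
have [d [d0 hd]] := eta_approx s0 tpT.
have [e [[e0 ed] he]] : exists e, (0 < e /\ e <= d) /\ forall y, A y ->
    `|I (fun z => cut x r z * eta y e z) - 4 * pi * pval Omega I y| < s.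
  apply: (@filter_ex _ 0^'+); near=> e; split; last first.
    by near: e; exact: eta_pval_uniform.
  by split; near: e; [exact: nbhs_right_gt|exact: nbhs_right_le].
have en : e != 0 by rewrite gt_eqF.
have [n [hn1 hn2]] : exists n, (forall y, A y ->
    `|ipair Omega (g n) (fun z => cut x r z * eta y e z) - I (fun z => cut x r z * eta y e z)| < s)
    /\ `|I phi - ipair Omega (g n) phi| < s.
  apply: (@filter_ex _ F); near=> n; split; near: n.
    apply: pairing_eta_uniform => //; first exact: smooth_cut.
    exact: cut_norm.
  by move: (gI tpO) => /cvgrPdist_lt /(_ _ s0).
pose a y := ipair Omega (g n) (fun z => cut x r z * eta y e z).
have [ia Ea] := mollify_pairing oO (Lg n) e0 tchi (@cut_norm _ x r) tpT.
have b1 : `|ipair Omega (g n) (fun z => cut x r z * \int[mu]_y (eta y e z * phi y))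
    - 4 * pi * ipair Omega (g n) phi| <= C * s.
  have tM : testfun Omega (fun z => cut x r z * \int[mu]_y (eta y e z * phi y)).
    exact: (testfun_cut r0 hr (mollify_continuous e0 tpT)).
  have t4 := testfunZ (4 * pi) tpO.
  have tg := testform_ipair oO (Lg n).
  rewrite -(tfZ tg (4 * pi) tpO) -(tfB tg tM t4).
  have [cD _] := testfunB tM t4.
  apply: (hC n _ _ cD) => z.
    by move=> nK; rewrite cut_eq0// mul0r pA ?mulr0 ?subrr// => /AK.
  have -> : cut x r z * \int[mu]_y (eta y e z * phi y) - 4 * pi * phi z =
      cut x r z * (\int[mu]_y (eta y e z * phi y) - 4 * pi * phi z).
    rewrite mulrBr; congr (_ - _); have [Az|nA] := pselect (A z).
      by rewrite cut_eq1 ?mul1r//; exact: A1.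
    by rewrite pA// !mulr0.
  rewrite normrM -[leRHS]mul1r.
  exact: (ler_pM (normr_ge0 _) (normr_ge0 _) (cut_norm _ _ _) (hd e e0 ed z)).
have b2 : `|4 * pi * ipair Omega (pval Omega I) phi - \int[mu]_y (phi y * a y)|
   <= 2 * s * \int[mu]_(z in A) `|phi z|.
  rewrite (pairing_restrict _ cA AO pA) (@Rintegral_off A); last first.
    by move=> z /pA ->; rewrite mul0r.
  have i1 : mu.-integrable (A : set TM) (EFin \o (fun z => pval Omega I z * phi z)).
    exact: (integrableS (open_measurableT2 oO) mA AO (testfun_integrable oO Lp tpO)).
  have i1' : mu.-integrable (A : set TM) (EFin \o (fun z => 4 * pi * (pval Omega I z * phi z))).
    exact: (integrableZl mA _ i1).
  have i2 : mu.-integrable (A : set TM) (EFin \o (fun z => phi z * a z)).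
    exact: (integrableS measurableT mA (@subsetT _ _) ia).
  have i3 : mu.-integrable (A : set TM) (EFin \o (fun z => `|phi z|)).
    apply: (integrable_abse (integrableS measurableT mA (@subsetT _ _) (testfun_integrableT tpT))).
  rewrite -(RintegralZl _ mA i1) -(RintegralB mA i1' i2) -(RintegralZl _ mA i3).
  have i4 : mu.-integrable (A : set TM) (EFin \o (fun z => 4 * pi * (pval Omega I z * phi z) - phi z * a z)).
    by apply: eq_integrable (integrableB mA i1' i2).
  apply: le_trans (le_normr_Rintegral mA i4) _.
  apply: le_Rintegral => //.
  - exact: (integrable_abse i4).
  - exact: (integrableZl mA _ i3).
  move=> z Az; rewrite mulrA (mulrC (phi z)) -mulrBl normrM; apply: ler_wpM2r => //.
  have /ltr_normlP[h1 h2] := he z Az; have /ltr_normlP[h3 h4] := hn1 z Az.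
  rewrite -/(a z) in h3 h4; move: h1 h2 h3 h4; clear.
  by move: (I _) (a z) (4 * pi * _) => i j k *; apply/ler_normlP; split; lra.
rewrite -/a Ea in b2.
rewrite mulrBr; move: b1 b2 hn2 p0.
move: (ipair _ _ _) (ipair _ _ _) (ipair _ _ _) (I phi) (Rintegral _ _ _) (4 * pi) => j k l i N q.
clear => /ler_normlP[h1 h2] /ler_normlP[h3 h4] /ltr_normlP[h5 h6] q0.
have h7 : q * k - q * i <= q * s by rewrite -mulrBr ler_pM2l//; lra.
have h8 : q * i - q * k <= q * s by rewrite -mulrBr ler_pM2l//; lra.
by apply/ler_normlP; split; lra.
Unshelve. all: by end_near.
Qed.

End limit_functional.
End weak_identity.

(** * The fundamental lemma of the calculus of variations *)

Section fundamental_lemma.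
Context {R : realType}.
Local Notation T2 := (R * R)%type.
Local Notation TM := (measurableTypeR R * measurableTypeR R)%type.
Local Notation mu := (@lebesgue2 R).
Implicit Types (z x y : T2) (r s c d e t u v : R) (K A Omega : set T2) (g h f phi chi : T2 -> R).

Definition conts (l : seq (T2 -> R)) := forall i, continuous (nth (cst 1) l i).

Lemma conts_cons a l : continuous a -> conts l -> conts (a :: l).
Proof. by move=> ca cl [|i]; [exact: ca|exact: cl]. Qed.

Lemma conts_nil : conts [::].
Proof. by move=> i z; rewrite nth_nil; exact: cvg_cst. Qed.

Lemma conts_cat l m : conts l -> conts m -> conts (l ++ m).
Proof. by move=> cl cm i; rewrite nth_cat; case: ifP => _; [exact: cl|exact: cm]. Qed.

(** Finite intersections of positivity sets of continuous functions. They form a pi-system that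
    generates the Borel sets, and their indicators are pointwise limits of the continuous functions
    [approx_pos]. *)
Definition pos_set (l : seq (T2 -> R)) : set T2 := [set z | all (fun a => 0 < a z) l].
Definition pos_sets : set (set T2) :=
  [set A | exists2 l, conts l & A = pos_set l].

Lemma pos_sets_open A : pos_sets A -> open A.
Proof.
move=> [l cl ->]; elim: l cl => [|a l IH] cl.
  by rewrite (_ : pos_set [::] = setT); [exact: openT|apply/seteqP; split].
rewrite (_ : pos_set (a :: l) = a @^-1` [set t | 0 < t] `&` pos_set l); last first.
  by apply/seteqP; split => z /=; [move=> /andP|move=> h; apply/andP].
apply: openI; last by apply: IH => i; exact: (cl i.+1).
apply: open_comp; last exact: open_gt.
by move=> z _; exact: (cl 0).
Qed.

Lemma step_cvg t : step (n%:R * t) @[n --> \oo] --> ((0 < t)%R%:R : R).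
Proof.
apply: cvg_near_cst; have [t0|t0] := ltP 0 t; last first.
  by apply: nearW => n; rewrite step_eq0// mulr_ge0_le0.
near=> n; rewrite step_eq1// -ler_pdivrMr// mul1r.
by near: n; exact: nbhs_infty_ger.
Unshelve. all: by end_near.
Qed.

Definition approx_pos (l : seq (T2 -> R)) (n : nat) z := \prod_(a <- l) step (n%:R * a z).

Lemma approx_pos_cvg l z : approx_pos l n z @[n --> \oo] --> ((all (fun a => 0 < a z) l)%:R : R).
Proof.
rewrite /approx_pos; elim: l => [|a l IH] /=.
  by under eq_cvg do rewrite big_nil; exact: cvg_cst.
under eq_cvg do rewrite big_cons.
by rewrite -mulnb natrM; apply: cvgM => //; exact: step_cvg.
Qed.

Lemma continuous_step : continuous (@step R).
Proof.
move=> t; have cs := smooth_continuous (smooth_step (@smooth_fst R)).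
apply: (@continuous_comp R T2 R (fun u => (u, 0)) (fun z => step z.1)); last exact: cs.
by apply: (@cvg_pair _ _ _ _ (nbhs t) (nbhs 0)); [exact: cvg_id|exact: cvg_cst].
Qed.

Lemma approx_pos_continuous l n : conts l ->
  continuous (approx_pos l n).
Proof.
elim: l => [|a l IH] cl.
  rewrite (_ : approx_pos [::] n = fun=> 1); first by move=> z; exact: cvg_cst.
  by apply: funext => z; rewrite /approx_pos big_nil.
rewrite (_ : approx_pos (a :: l) n = fun z => step (n%:R * a z) * approx_pos l n z); last first.
  by apply: funext => z; rewrite /approx_pos big_cons.
apply: continuousT2M; last by apply: IH => i; exact: (cl i.+1).
move=> z; apply: (@continuous_comp _ _ _ (fun z => n%:R * a z) step); last exact: continuous_step.
by apply: cvgM; [exact: cvg_cst|exact: (cl 0)].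
Qed.

Lemma approx_pos_eq0 l n z : ~ pos_set l z -> approx_pos l n z = 0.
Proof.
rewrite /pos_set /approx_pos /=; elim: l => [|a l IH] //=; rewrite big_cons.
have [a0|a0] := ltP 0 (a z); first by move=> /IH ->; rewrite mulr0.
by rewrite step_eq0 ?mul0r// mulr_ge0_le0.
Qed.

Lemma approx_pos_le1 l n z : 0 <= approx_pos l n z <= 1.
Proof.
rewrite /approx_pos; elim: l => [|a l /andP[IH1 IH2]]; first by rewrite big_nil ler01 lexx.
rewrite big_cons mulr_ge0 ?step_ge0//=.
by rewrite -[leRHS]mul1r; apply: ler_pM; rewrite ?step_ge0 ?step_le1.
Qed.

Lemma pos_sets_sigma : @measurable _ TM = <<s pos_sets >>.
Proof.
rewrite eqEsubset; split; last first.
  apply: smallest_sub; first exact: sigma_algebra_measurable.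
  by move=> A /pos_sets_open; exact: open_measurableT2.
pose TG := g_sigma_algebraType pos_sets.
have m1 : measurable_fun (setT : set TG) (fst : T2 -> R).
  apply: (measurability _ (RGenOInfty.measurableE R)) => _ [_ [a ->] <-].
  rewrite setTI; apply: sub_sigma_algebra.
  exists [:: fun z : T2 => z.1 - a]; last first.
    by apply/seteqP; split => z; rewrite /pos_set /= in_itv /= !andbT subr_gt0.
  by apply: conts_cons conts_nil => z; apply: cvgB; [exact: cvg_fst|exact: cvg_cst].
have m2 : measurable_fun (setT : set TG) (snd : T2 -> R).
  apply: (measurability _ (RGenOInfty.measurableE R)) => _ [_ [a ->] <-].
  rewrite setTI; apply: sub_sigma_algebra.
  exists [:: fun z : T2 => z.2 - a]; last first.
    by apply/seteqP; split => z; rewrite /pos_set /= in_itv /= !andbT subr_gt0.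
  by apply: conts_cons conts_nil => z; apply: cvgB; [exact: cvg_snd|exact: cvg_cst].
rewrite measurable_prod_measurableType; apply: smallest_sub.
  exact: (@sigma_algebra_measurable _ TG).
move=> _ [A mA [B mB <-]].
have -> : A `*` B = (setT `&` fst @^-1` A) `&` (setT `&` snd @^-1` B).
  by rewrite !setTI; apply/seteqP; split.
by apply: (@measurableI _ TG); [exact: m1|exact: m2].
Qed.

Definition osq_ends x r : seq (T2 -> R) :=
  [:: fun z => z.1 - x.1 + r; fun z => r - (z.1 - x.1);
      fun z => z.2 - x.2 + r; fun z => r - (z.2 - x.2)].

Lemma pos_osq_ends x r : pos_set (osq_ends x r) = osq x r.
Proof.
apply/seteqP; split => z; rewrite /pos_set /= andbT.
  by move=> /and4P[h1 h2 h3 h4]; split; rewrite ltr_norml; apply/andP; split; lra.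
by move=> [/ltr_normlP[h1 h2] /ltr_normlP[h3 h4]]; apply/and4P; split; lra.
Qed.

Lemma osq_ends_continuous x r : conts (osq_ends x r).
Proof.
have c1 : continuous (fun z : T2 => z.1 - x.1) by move=> z; apply: cvgB; [exact: cvg_fst|exact: cvg_cst].
have c2 : continuous (fun z : T2 => z.2 - x.2) by move=> z; apply: cvgB; [exact: cvg_snd|exact: cvg_cst].
apply: conts_cons; last (apply: conts_cons; last (apply: conts_cons; last (apply: conts_cons; last exact: conts_nil))).
- by move=> z; apply: cvgD; [exact: c1|exact: cvg_cst].
- by move=> z; apply: cvgB; [exact: cvg_cst|exact: c1].
- by move=> z; apply: cvgD; [exact: c2|exact: cvg_cst].
- by move=> z; apply: cvgB; [exact: cvg_cst|exact: c2].
Qed.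

Section vanishing.
Variables (Omega : set T2) (f : T2 -> R).
Hypothesis oO : open Omega.
Hypothesis Lf : L1loc Omega f.
Hypothesis f0 : forall phi, testfun Omega phi -> ipair Omega f phi = 0.
Variables (x : T2) (r : R).
Hypothesis xr : sq x r `<=` Omega.

Let w z : \bar R := ((f \_ (osq x r)) z)%:E.

Let iw : mu.-integrable (setT : set TM) w.
Proof.
have := integrableS (compact_measurableT2 (@sq_compact _ x r)) (osq_measurable x r)
  (@osq_sub _ x r) (L1loc_integrable oO Lf (@sq_compact _ x r) xr).
rewrite integrable_mkcond; last exact: osq_measurable.
by apply: eq_integrable => // z _; rewrite restrict_EFin.
Qed.

(** The four functions [osq_ends] are added to the list, so that the approximations are supported in
    the closed square and hence are test functions. They lie between 0 and 1 and tend to the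
    indicator of A within the open square; dominated convergence applies with majorant |w|. *)
Lemma vanishing_pos A : pos_sets A -> (\int[mu]_(z in A) w z = 0)%E.
Proof.
move=> pA; have mA := open_measurableT2 (pos_sets_open pA).
have [l cl AE] := pA; pose m := osq_ends x r ++ l.
have cm : conts m := conts_cat (@osq_ends_continuous x r) cl.
have tm n : testfun Omega (approx_pos m n).
  split; first exact: approx_pos_continuous.
  exists (sq x r); split => //; first exact: sq_compact.
  move=> z nz; apply: approx_pos_eq0; rewrite /pos_set /mkset /m all_cat => /andP[h _].
  by apply/nz/osq_sub; rewrite -pos_osq_ends.
have mE : pos_set m = osq x r `&` A.
  rewrite AE -pos_osq_ends; apply/seteqP; split => z; rewrite /pos_set /mkset /m all_cat.
    by move=> /andP.
  by move=> h; apply/andP.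
have wE n z : (w z * (approx_pos m n z)%:E = (f z * approx_pos m n z)%:E)%E.
  rewrite /w patchE; case: ifPn => //; rewrite notin_setE => nz.
  rewrite approx_pos_eq0 ?mule0 ?mulr0// /pos_set /mkset /m all_cat => /andP[h _].
  by apply: nz; rewrite -pos_osq_ends.
have w_ n : (\int[mu]_z (w z * (approx_pos m n z)%:E) = 0)%E.
  under eq_integral do rewrite wE.
  have i1 := testfun_integrable oO Lf (tm n).
  have -> : (\int[mu]_z (f z * approx_pos m n z)%:E = \int[mu]_(z in Omega) (f z * approx_pos m n z)%:E)%E.
    rewrite [RHS]integral_mkcond; apply: eq_integral => z _; rewrite patchE; case: ifPn => //.
    rewrite notin_setE => nz; case: (tm n) => _ [K [_ KO ->]] //; first by rewrite mulr0.
    by move=> /KO.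
  have := f0 (tm n); rewrite /ipair /Rintegral => h.
  rewrite -[LHS]fineK ?h//.
  by apply: integrable_fin_num => //; exact: open_measurableT2.
have wA : (w \_ A)%E = (fun z => w z * ((all (fun a => 0 < a z) m)%R%:R)%:E)%E.
  apply: funext => z; rewrite patchE; case: ifPn => [|].
    rewrite inE => Az; have [oz|noz] := pselect (osq x r z).
      have -> : all (fun a => 0 < a z) m; last by rewrite mule1.
      by have : pos_set m z by rewrite mE.
    by rewrite /w patchE memNset// mul0e.
  rewrite notin_setE => nA.
  have -> : all (fun a => 0 < a z) m = false; last by rewrite mule0.
  by apply/negP => h; apply: nA; have [] : (osq x r `&` A) z by rewrite -mE.
have mw : measurable_fun (setT : set TM) w := measurable_int _ iw.
have mf n : measurable_fun (setT : set TM) (fun z => w z * (approx_pos m n z)%:E)%E.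
  apply: emeasurable_funM => //; apply/measurable_EFinP.
  by apply: continuous_measurableT2T; case: (tm n).
have mwA : measurable_fun (setT : set TM) (w \_ A)%E.
  exact/(measurable_restrictT _ mA)/measurable_funTS.
have [] := @dominated_convergence _ TM R mu setT measurableT
  (fun n z => w z * (approx_pos m n z)%:E)%E (w \_ A)%E (abse \o w) mf mwA _ (integrable_abse iw) _.
- apply: aeW => z _; rewrite wA; apply: cvgeZl => //.
  by apply: cvg_EFin; [exact: nearW|exact: approx_pos_cvg].
- apply: aeW => z n _; rewrite abseM -[leRHS]mule1; apply: lee_wpmul2l => //.
  by rewrite lee_fin ger0_norm; have /andP[] := approx_pos_le1 m n z.
move=> _ _; rewrite -integral_mkcond => h.
rewrite (_ : [sequence _]_n = fun=> 0%E) in h; last by apply: funext => n; exact: w_.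
exact: (cvg_unique (@ereal_hausdorff R) h (cvg_cst _)).
Qed.

(** Dynkin's theorem extends the previous statement from the pi-system. Complements are handled by
    subtracting from the integral over the whole plane, which is zero too. *)
Lemma vanishing_measurable A : measurable (A : set TM) -> (\int[mu]_(z in A) w z = 0)%E.
Proof.
have pT : pos_sets setT by exists [::]; [exact: conts_nil|by apply/seteqP; split].
rewrite pos_sets_sigma; move: A.
apply: (dynkin_induction (G := pos_sets) (P := fun A => (\int[mu]_(z in A) w z = 0)%E)).
- exact: pos_sets_sigma.
- move=> A B [l cl ->] [m cm ->]; exists (l ++ m).
    exact: conts_cat.
  apply/seteqP; split => z; rewrite /pos_set /= all_cat; first by move=> h; apply/andP.
  by move=> /andP.
- exact: vanishing_pos.
- exact: vanishing_pos.
- move=> S mS S0; have := vanishing_pos pT.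
  rewrite -(setUv S) (@integral_setU_EFin _ TM _ _ _ _ (f \_ (osq x r)))//.
  + by rewrite S0 add0e.
  + exact: measurableC.
  + by rewrite setUv; have /measurable_EFinP := measurable_int _ iw.
  + by apply/disj_setPS => z [].
- move=> F mF tF F0.
  have := @charge_semi_sigma_additive _ _ _ (induced_charge iw) F mF tF (bigcupT_measurable F mF).
  rewrite /induced_charge => h.
  rewrite (_ : (fun n => _) = fun=> 0%E) in h; last first.
    by apply: funext => n; apply: big1 => i _; exact: F0.
  exact: (cvg_unique (@ereal_hausdorff R) h (cvg_cst _)).
Qed.

Lemma vanishing_ae : {ae mu, forall z : TM, osq x r z -> f z = 0}.
Proof.
have mo := osq_measurable x r.
have io : mu.-integrable (osq x r : set TM) (EFin \o f).
  exact: (integrableS (compact_measurableT2 (@sq_compact _ x r)) mo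
    (@osq_sub _ x r) (L1loc_integrable oO Lf (@sq_compact _ x r) xr)).
have := @integral_ae_eq _ TM R mu (osq x r) mo (cst 0%E) (EFin \o f) io.
move=> /(_ (measurable_cst _)) h; have {}h : ae_eq mu (osq x r : set TM) (EFin \o f) (cst 0%E).
  apply: h => A Ao mA; rewrite integral0 -[RHS](vanishing_measurable mA).
  by apply: eq_integral => z /set_mem Az; rewrite /w patchE mem_set//; exact: Ao.
by apply: filterS h => z h /h [].
Qed.

End vanishing.

Lemma fundamental_lemma Omega f g : open Omega -> L1loc Omega f -> L1loc Omega g ->
  (forall phi, testfun Omega phi -> ipair Omega f phi = ipair Omega g phi) ->
  {ae mu, forall z : TM, Omega z -> f z = g z}.
Proof.
move=> oO Lf Lg fg.
have LB : L1loc Omega (fun z => f z - g z).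
  split; first by apply: measurable_funB; [case: Lf|case: Lg].
  move=> K cK KO; have mK : measurable (K : set TM) := compact_measurableT2 cK.
  have := integrableB mK (L1loc_integrable oO Lf cK KO) (L1loc_integrable oO Lg cK KO).
  by move=> /integrableP[].
have h0 phi : testfun Omega phi -> ipair Omega (fun z => f z - g z) phi = 0.
  move=> tp; apply/eqP; rewrite -(subrr (ipair Omega f phi)) {2}fg// /ipair -RintegralB.
  - by apply/eqP; apply: eq_Rintegral => z _; rewrite mulrBl.
  - exact: open_measurableT2.
  - exact: testfun_integrable.
  - exact: testfun_integrable.
suff : {ae mu, forall z : TM, Omega z -> f z - g z = 0}.
  by apply: filterS => z h /h /eqP; rewrite subr_eq0 => /eqP.
apply: ae_cover => z Oz.
have [r [r0 hr]] := nbhs_sq (open_nbhs_nbhs (conj oO Oz)).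
exists (r / 2); first by rewrite divr_gt0.
have := vanishing_ae oO LB h0 hr; apply: filterS => w h [h1 h2]; apply: h.
by split; [apply: le_lt_trans h1 _|apply: le_lt_trans h2 _]; rewrite gtr_pMr// invf_lt1// ltr1n.
Qed.

End fundamental_lemma.

(** * Gluing and continuous representatives *)

Section continuous_representatives.
Context {R : realType}.
Local Notation T2 := (R * R)%type.
Local Notation TM := (measurableTypeR R * measurableTypeR R)%type.
Local Notation mu := (@lebesgue2 R).
Local Notation la := (@lebesgue_measure R).
Implicit Types (z x y : T2) (r s c d e t u v : R) (K A Omega : set T2) (g h f phi chi : T2 -> R).

Lemma compact_sq_cover K (D : T2 * R -> Prop) : compact K ->
  (forall z, K z -> exists r, 0 < r /\ D (z, r)) ->
  exists l : seq (T2 * R), (forall p, p \in l -> D p) /\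
    forall z, K z -> exists2 p : T2 * R, p \in l & sq p.1 p.2 z.
Proof.
move=> cK loc.
pose subD (l : seq (T2 * R)) := forall p, p \in l -> D p.
(* A filter on finite lists of admissible squares: a property holds eventually if it holds for every
   list extending some given one. The covering form of compactness then produces one list that
   covers K. *)
pose F : set_system (seq (T2 * R)) :=
  [set A | exists2 l0, subD l0 & forall l, subD l -> {subset l0 <= l} -> A l].
have FF : Filter F.
  split; first by exists [::].
    move=> A B [l Dl hA] [m Dm hB]; exists (l ++ m).
      by move=> p; rewrite mem_cat => /orP[/Dl|/Dm].
    move=> k Dk lmk; split; [apply: hA|apply: hB] => // p pl; apply: lmk;
      by rewrite mem_cat pl ?orbT.
  by move=> A B AB [l Dl hA]; exists l => // k Dk lk; exact/AB/hA.
have [l Dl hl] : F [set l : seq (T2 * R) | forall z, K z -> exists2 p : T2 * R, p \in l & sq p.1 p.2 z].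
  move/compact_near_coveringP : cK => /(_ _ F (fun l z => exists2 p : T2 * R, p \in l & sq p.1 p.2 z) FF); apply => z Kz.
  have [r [r0 hr]] := loc z Kz.
  exists (osq z r, [set l : seq (T2 * R) | (z, r) \in l]).
    split; first exact: open_nbhs_nbhs (conj (@osq_open _ z r) (osq_center z r0)).
    exists [:: (z, r)]; first by move=> p; rewrite inE => /eqP ->.
    by move=> k _; apply; rewrite mem_head.
  by move=> [z' k] [/= oz zk]; exists (z, r) => //; exact: osq_sub.
by exists l; split => //; exact: hl.
Qed.

(** Instead of a partition of unity, squares of a finite cover are peeled off one after the other:
    [phi] is [cut * phi], which lives in the doubled square, plus a rest that vanishes on the square
    itself and is covered by the remaining ones. *)
Lemma testform_eq_local Omega I J : testform Omega I -> testform Omega J ->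
  (forall x, Omega x -> exists r, [/\ 0 < r, sq x (2 * r) `<=` Omega &
    forall phi, testfun (sq x (2 * r)) phi -> I phi = J phi]) ->
  forall phi, testfun Omega phi -> I phi = J phi.
Proof.
move=> tI tJ loc.
pose D : set (T2 * R) := [set p | [/\ 0 < p.2, sq p.1 (2 * p.2) `<=` Omega &
    forall phi, testfun (sq p.1 (2 * p.2)) phi -> I phi = J phi]].
have ind (l : seq (T2 * R)) : (forall p, p \in l -> D p) -> forall phi, testfun Omega phi ->
    (forall z, phi z <> 0 -> exists2 p, p \in l & sq p.1 p.2 z) -> I phi = J phi.
  elim: l => [|p l IH] hl phi tp hp.
    rewrite (_ : phi = fun=> 0); first by rewrite (tf0 tI) (tf0 tJ).
    by apply: funext => z; apply: contrapT => /hp [].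
  have [r0 hr hIJ] := hl p (mem_head _ _).
  have cp : continuous phi by case: tp.
  have t1 : testfun (sq p.1 (2 * p.2)) (fun z => cut p.1 p.2 z * phi z).
    by apply: testfun_cut.
  have t1' := testfunS hr t1.
  have t2 := testfunB tp t1'.
  have E : phi = fun z => cut p.1 p.2 z * phi z + (phi z - cut p.1 p.2 z * phi z).
    by apply: funext => z; rewrite addrC subrK.
  rewrite E (tfD tI t1' t2) (tfD tJ t1' t2) (hIJ _ t1); congr (_ + _).
  apply: IH => //; first by move=> q ql; apply: hl; rewrite in_cons ql orbT.
  move=> z hz; have nz : ~ sq p.1 p.2 z.
    by move=> sz; apply: hz; rewrite cut_eq1// mul1r subrr.
  have [|q] := hp z; first by move=> p0; apply: hz; rewrite p0 mulr0 subrr.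
  by rewrite in_cons => /predU1P[->//|ql] sz; exists q.
move=> phi tp; have [_ [K [cK KO hK]]] := tp.
have [|l [Dl hl]] := @compact_sq_cover K D cK.
  move=> z Kz; have [r hr] := loc z (KO z Kz); exists r; split => //.
  by case: hr.
apply: (ind l) => // z nz; apply: hl.
by apply: contrapT => /hK.
Qed.

(** The same peeling, but with the cut-offs multiplying [F] rather than [dd F], so that all pieces
    remain double divergences. *)
Lemma testform_dd_local Omega J : testform Omega J ->
  (forall x, Omega x -> exists r, [/\ 0 < r, sq x (2 * r) `<=` Omega &
    forall F, tfield (sq x (2 * r)) F -> J (dd F) = 0]) ->
  forall F, tfield Omega F -> J (dd F) = 0.
Proof.
move=> tJ loc.
pose D : set (T2 * R) := [set p | [/\ 0 < p.2, sq p.1 (2 * p.2) `<=` Omega &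
    forall F, tfield (sq p.1 (2 * p.2)) F -> J (dd F) = 0]].
have ind (l : seq (T2 * R)) : (forall p, p \in l -> D p) -> forall F, tfield Omega F ->
    (forall z, F z <> 0 -> exists2 p, p \in l & sq p.1 p.2 z) -> J (dd F) = 0.
  elim: l => [|p l IH] hl F tF hF.
    rewrite (_ : F = fun=> 0); first by rewrite dd0 (tf0 tJ).
    by apply: funext => z; apply: contrapT => /hF [].
  have [r0 hr hJ] := hl p (mem_head _ _).
  have sc : smooth (fun z => 1 - cut p.1 p.2 z) by exact: smoothB (smooth_cst _) (smooth_cut _ _).
  have t1 : tfield (sq p.1 (2 * p.2)) (fun z => cut p.1 p.2 z *: F z).
    exact: tfield_cut r0 (@subset_refl _ _) tF.1.
  have t1' := tfieldS hr t1.
  have t2 := tfieldZ sc tF.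
  have -> : F = fun z => cut p.1 p.2 z *: F z + (1 - cut p.1 p.2 z) *: F z.
    by apply: funext => z; rewrite -scalerDl addrC subrK scale1r.
  apply: (etrans (tf_ddD tJ t1' t2)); apply: (etrans (congr1 (+%R^~ _) (hJ _ t1))).
  rewrite add0r; apply: IH.
  - by move=> q ql; apply: hl; rewrite in_cons ql orbT.
  - exact: t2.
  move=> z hz; have nz : ~ sq p.1 p.2 z.
    by move=> sz; apply: hz; rewrite cut_eq1// subrr scale0r.
  have [|q] := hF z; first by move=> F0; apply: hz; rewrite F0 scaler0.
  by rewrite in_cons => /predU1P[->//|ql] sz; exists q.
move=> F tF; have [_ [K [cK KO hK]]] := tF.
have [|l [Dl hl]] := @compact_sq_cover K D cK.
  move=> z Kz; have [r hr] := loc z (KO z Kz); exists r; split => //.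
  by case: hr.
apply: (ind l) => // z nz; apply: hl.
by apply: contrapT => /hK.
Qed.

Section limit.
Variables (Omega : set T2) (I : (T2 -> R) -> R) (E : R).
Hypothesis oO : open Omega.
Hypothesis tI : testform Omega I.
Hypothesis hE : hessian_bound Omega I E.
Variables (P : Type) (F : set_system P) (g : P -> T2 -> R).
Context {FF : ProperFilter F}.
Hypothesis Lg : forall n, L1loc Omega (g n).
Hypothesis ubnd : forall K, compact K -> K `<=` Omega -> exists2 C, 0 <= C &
  forall n h s, continuous h -> (forall z, ~ K z -> h z = 0) ->
    (forall z, `|h z| <= s) -> `|ipair Omega (g n) h| <= C * s.
Hypothesis gI : forall h, testfun Omega h -> ipair Omega (g n) h @[n --> F] --> I h.

Lemma pval_pairing phi : testfun Omega phi -> ipair Omega (pval Omega I) phi = I phi.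
Proof.
apply: testform_eq_local => //.
  exact: (testform_ipair oO (continuous_L1loc oO (pval_continuous oO tI hE))).
move=> x Ox; have [r [r0 hr]] := nbhs_sq (open_nbhs_nbhs (conj oO Ox)).
have r8 : 0 < r / 8 by rewrite divr_gt0.
have r2 : 0 < r / 2 by rewrite divr_gt0.
(* The radius r/8 is chosen so that its double is half of r/2, which is the shape in which the local
   statement is available. *)
have E1 : 2 * (r / 8) = r / 2 / 2 by field.
have E2 : 2 * (r / 2) = r by field.
exists (r / 8); split => //.
  by apply: subset_trans hr; apply: sqS; rewrite E1; lra.
move=> psi; rewrite E1; apply: (pval_pairing_local oO tI hE Lg ubnd gI r2).
by rewrite E2.
Qed.

End limit.

Section representative.
Variables (Omega : set T2) (f : T2 -> R) (E : R).
Hypothesis oO : open Omega.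
Hypothesis Lf : L1loc Omega f.
Hypothesis hE : hessian_bound Omega (ipair Omega f) E.

(** [f] is regarded as the limit of the constant sequence [f]. Its point values then pair with test
    functions exactly as [f] does, and the fundamental lemma turns this into equality almost
    everywhere. *)
Lemma pval_representative :
  is_continuous_representative Omega f (pval Omega (ipair Omega f)).
Proof.
have tI := testform_ipair oO Lf.
have cp := pval_continuous oO tI hE.
split => //; apply: fundamental_lemma => //; first exact: continuous_L1loc.
apply: (@pval_pairing _ _ E oO tI hE nat \oo (fun=> f)) => //.
  by move=> K cK KO; have [C C0 hC] := tf_bnd tI cK KO; exists C.
by move=> h _; exact: cvg_cst.
Qed.

End representative.

Lemma sq_measure_gt0 x r : 0 < r -> (0 < mu (sq x r : set TM))%E.
Proof.
move=> r0; pose J c : set R := `[c - r, c + r]%classic.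
have -> : mu (sq x r : set TM) = (la (J x.1) * la (J x.2))%E.
  by rewrite sqE; apply: product_measure1E; exact: measurable_itv.
have fin c : (0 < la (J c))%E.
  by rewrite lebesgue_measure_itv /= lte_fin ifT -?EFinB ?lte_fin; lra.
by apply: mule_gt0.
Qed.

(** Continuous functions that differ at a point differ on a whole square around it, and squares have
    positive measure. *)
Lemma representative_unique Omega f g h : open Omega ->
  is_continuous_representative Omega f g -> is_continuous_representative Omega f h ->
  forall x, Omega x -> g x = h x.
Proof.
move=> oO [cg ag] [ch ah] x Ox; apply: contrapT => ne.
have c : {for x, continuous (fun z => g z - h z)}.
  by apply: cvgB; [exact: cg (mem_set Ox)|exact: ch (mem_set Ox)].
have n0 : `|g x - h x| > 0 by rewrite normr_gt0 subr_eq0; apply/eqP.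
have [r [r0 hr]] : exists r, 0 < r /\ sq x r `<=` [set z | Omega z /\ g z <> h z].
  apply: nbhs_sq; move/cvgrPdist_lt: c => /(_ _ n0) hc.
  apply: filterS2 (open_nbhs_nbhs (conj oO Ox)) hc => z Oz hz; split => // e.
  by move: hz; rewrite /= e subrr subr0 ltxx.
have [N [mN N0 hN]] : {ae mu, forall z : TM, Omega z -> g z = h z}.
  have FF := @ae_filter_ringOfSetsType _ TM R mu.
  apply: (@filterS2 _ (almost_everywhere mu) FF _ _ _ _ ag ah) => z h1 h2 Oz.
  by rewrite h1// h2.
have := sq_measure_gt0 x r0; rewrite ltNge => /negP; apply.
rewrite -N0; apply: le_measure; rewrite ?inE//.
  exact: closed_measurableT2 (@sq_closed _ _ _).
move=> z /hr [Oz nz]; apply: hN => /= /(_ Oz); exact: nz.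
Qed.

Lemma continuous_representativeE Omega f g : open Omega ->
  is_continuous_representative Omega f g ->
  forall x, Omega x -> continuous_representative Omega f x = g x.
Proof.
move=> oO hg; apply: (representative_unique oO _ hg).
by rewrite /continuous_representative; case: xgetP => [h _ //|/(_ g)].
Qed.

End continuous_representatives.

#[local] Opaque powR.

(** * The norms of the fidelity term *)

Section lpnorms.
Context {R : realType}.
Implicit Types (q : \bar R) (r s t : R).

Lemma lpnorm_ge0 n q (v : 'rV[R]_n) : 0 <= lpnorm q v.
Proof.
by case: q => [r| |]; rewrite /lpnorm; [exact: powR_ge0|exact: bigmax_ge_id..].
Qed.

Lemma powR_le_self r t : 1 <= r -> 0 <= t -> t <= 1 -> t `^ r <= t.
Proof.
move=> r1 t0 t1; have [->|tn] := eqVneq t 0; last by apply: ge1r_powR; rewrite // lt0r tn t0.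
by rewrite powR0// gt_eqF// (lt_le_trans ltr01).
Qed.

Lemma lpnorm_entry n q (v : 'rV[R]_n) i : (1 <= q)%E -> `|v 0 i| <= lpnorm q v.
Proof.
case: q => [r| |]//; rewrite /lpnorm => r1; last exact: (le_bigmax _ (fun i => `|v 0 i|) i).
have r0 : 0 < r by rewrite (lt_le_trans ltr01)// -lee_fin.
rewrite -[leLHS]powRr1// -(mulfV (lt0r_neq0 r0)) powRrM.
apply: ge0_ler_powR; rewrite ?nnegrE ?invr_ge0 ?(ltW r0)// ?powR_ge0//.
  by apply: sumr_ge0 => j _; exact: powR_ge0.
by rewrite (bigD1 i)//= lerDl sumr_ge0// => j _; exact: powR_ge0.
Qed.

(** The perturbation is measured in l^1 because the jump at each data point is paid for separately.
    Let A be the norm of u and B the l^1 norm of w. By convexity of t^r the r-th powers of (|u_i| +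
    |w_i|)/(A + B) sum to at most 1: those of |u_i|/A sum to 1, and those of |w_i|/B are at most
    |w_i|/B, which sum to 1. *)
Lemma lpnorm_add n q (u w : 'rV[R]_n) : (1 <= q)%E ->
  lpnorm q (u + w) <= lpnorm q u + \sum_i `|w 0 i|.
Proof.
move=> q1; have B0 : 0 <= \sum_i `|w 0 i| by exact: sumr_ge0.
have wB i : `|w 0 i| <= \sum_i `|w 0 i|.
  by rewrite (bigD1 i)//= lerDl sumr_ge0.
have [B00|Bn] := eqVneq (\sum_i `|w 0 i|) 0.
  rewrite B00 addr0; have w0 : w = 0; last by rewrite w0 addr0.
  apply/rowP => i; apply/eqP; rewrite mxE -normr_le0 -B00; exact: wB.
have Bp : 0 < \sum_i `|w 0 i| by rewrite lt0r Bn.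
have A0 := lpnorm_ge0 q u; have Au i := lpnorm_entry u i q1.
case: q q1 A0 Au => [r| |]// q1 A0 Au; last first.
  rewrite /lpnorm; apply: bigmax_le; first by rewrite addr_ge0.
  by move=> i _; rewrite mxE; apply: le_trans (ler_normD _ _) _; exact: lerD (Au i) (wB i).
have r1 : 1 <= r by rewrite -lee_fin.
have r0 : 0 < r by rewrite (lt_le_trans ltr01).
set A := lpnorm _ u in A0 Au *; set B := \sum_i _ in B0 wB Bn Bp *.
have AB : 0 < A + B by rewrite ltr_wpDl.
have AE : \sum_i `|u 0 i| `^ r = A `^ r.
  rewrite /A /lpnorm -powRrM mulVf ?gt_eqF// powRr1//.
  by apply: sumr_ge0 => i _; exact: powR_ge0.
have key : \sum_i ((`|u 0 i| + `|w 0 i|) / (A + B)) `^ r <= 1.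
  (* For A = 0 the quotients |u_i|/A have no meaning, but then every u_i is 0. *)
  have [A00|An] := eqVneq A 0.
    have u0 i : `|u 0 i| = 0 by apply/eqP; rewrite -A00 eq_le Au A00 normr_ge0.
    apply: (@le_trans _ _ (\sum_i `|w 0 i| / B)); last by rewrite -mulr_suml divff.
    apply: ler_sum => i _; rewrite u0 A00 !add0r; apply: powR_le_self => //.
      by rewrite divr_ge0.
    by rewrite ler_pdivrMr// mul1r.
  have Ap : 0 < A by rewrite lt0r An.
  have lam : 0 <= A / (A + B) <= 1.
    by rewrite divr_ge0 ?(ltW AB)//= ler_pdivrMr// mul1r lerDl.
  pose t := Itv01 (andP lam).1 (andP lam).2.
  have onem : 1 - A / (A + B) = B / (A + B).
    by field; rewrite gt_eqF.
  apply: (@le_trans _ _ (\sum_i (A / (A + B) * (`|u 0 i| / A) `^ r + B / (A + B) * (`|w 0 i| / B)))).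
    apply: ler_sum => i _.
    have h := @convex_powR R r r1 t (`|u 0 i| / A) (`|w 0 i| / B).
    have uA : 0 <= `|u 0 i| / A by rewrite divr_ge0.
    have wB' : 0 <= `|w 0 i| / B by rewrite divr_ge0.
    have {}h := h _ _; rewrite !inE /= !in_itv /= !andbT in h.
    have {}h := h uA wB'; rewrite !convRE /= /unstable.onem onem in h.
    have E : A / (A + B) * (`|u 0 i| / A) + B / (A + B) * (`|w 0 i| / B) =
        (`|u 0 i| + `|w 0 i|) / (A + B).
      by field; rewrite An Bn gt_eqF.
    rewrite [X in X `^ r <= _](_ : _ = (`|u 0 i| + `|w 0 i|) / (A + B)) in h; last first.
      by rewrite -E -onem; exact: convRE.
    apply: (le_trans h); rewrite lerD2l; apply: ler_wpM2l.
      by rewrite divr_ge0// ltW.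
    by apply: powR_le_self => //; rewrite ler_pdivrMr// mul1r.
  rewrite big_split /= -!mulr_sumr -mulr_suml divff// mulr1.
  have -> : \sum_i (`|u 0 i| / A) `^ r = 1.
    under eq_bigr => i _ do rewrite powRM ?invr_ge0//.
    rewrite -mulr_suml AE -powRM ?invr_ge0// divff ?gt_eqF//.
    by rewrite powR1.
  by rewrite mulr1 -mulrDl divff// gt_eqF.
have -> : lpnorm r%:E (u + w) = (\sum_i `|u 0 i + w 0 i| `^ r) `^ r^-1.
  by rewrite /lpnorm; congr (_ `^ _); apply: eq_bigr => i _; rewrite mxE.
rewrite -[leRHS]powRr1 ?(ltW AB)// -(mulfV (lt0r_neq0 r0)) powRrM.
apply: ge0_ler_powR; rewrite ?nnegrE ?invr_ge0 ?(ltW r0)// ?powR_ge0//.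
  by apply: sumr_ge0 => i _; exact: powR_ge0.
rewrite -[leRHS]mul1r -ler_pdivrMr ?powR_gt0//.
apply: le_trans key; rewrite mulr_suml; apply: ler_sum => i _.
have V : (A + B)^-1 `^ r = ((A + B) `^ r)^-1.
  by rewrite -(powR_inv1 (ltW AB)) -powRrM mulN1r; exact: powRN.
have V0 : 0 <= (A + B)^-1 by rewrite invr_ge0 (ltW AB).
have uw : 0 <= `|u 0 i| + `|w 0 i| := addr_ge0 (normr_ge0 _) (normr_ge0 _).
rewrite (powRM _ uw V0) V.
apply: ler_wpM2r; first by rewrite invr_ge0 powR_ge0.
by apply: (ge0_ler_powR (ltW r0)); rewrite ?nnegrE ?uw// ler_normD.
Qed.

End lpnorms.

(** * Singular values of matrices of size two *)

Section schatten.
Context {R : realType}.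
Implicit Types (M : 'M[R]_2) (p : \bar R) (a b s t : R).

Definition frob2 M := M o0 o0 ^+ 2 + M o0 o1 ^+ 2 + M o1 o0 ^+ 2 + M o1 o1 ^+ 2.
Definition det2 M := M o0 o0 * M o1 o1 - M o0 o1 * M o1 o0.

Lemma prod_ord2 (A : comNzRingType) (h : 'I_2 -> A) : \prod_(i < 2) h i = h o0 * h o1.
Proof.
rewrite big_ord_recl big_ord1; congr (h _ * h _); exact: val_inj.
Qed.

Lemma det2E M : \det M = det2 M.
Proof.
rewrite (expand_det_row _ o0) sum_ord2 /cofactor !det_mx11 !mxE /det2 /=.
have -> : lift o0 0 = o1 by exact: val_inj.
have -> : lift o1 0 = o0 by exact: val_inj.
by rewrite (_ : (o0 + o1)%N = 1%N)// (_ : (o0 + o0)%N = 0%N)//; ring.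
Qed.

(** Trace and determinant of M^T M are coefficients of its characteristic polynomial, so the
    symmetric functions of the squared singular values are polynomials in the entries. *)
Lemma singular_values_frob M : let s := singular_values M in
  [/\ 0 <= s 0 o1, s 0 o1 <= s 0 o0, s 0 o0 ^+ 2 + s 0 o1 ^+ 2 = frob2 M &
   s 0 o0 ^+ 2 * s 0 o1 ^+ 2 = det2 M ^+ 2].
Proof.
move=> s; have [s0 sm cE] := singular_valuesP M.
have e1 := char_poly_trace (M^T *m M) (isT : 0 < 2)%N.
have e0 := char_poly_det (M^T *m M).
rewrite -/s cE prod_ord2 in e0 e1.
have P : ('X - (s 0 o0 ^+ 2)%:P) * ('X - (s 0 o1 ^+ 2)%:P) =
    'X^2 - (s 0 o0 ^+ 2 + s 0 o1 ^+ 2) *: 'X + (s 0 o0 ^+ 2 * s 0 o1 ^+ 2)%:P.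
  by rewrite -mul_polyC (polyCM (s 0 o0 ^+ 2)) (polyCD (s 0 o0 ^+ 2)); ring.
rewrite P !coefE /= in e0 e1.
split; [exact: s0|exact: sm| |].
- move: e1; rewrite /mxtrace sum_ord2 !mxE !sum_ord2 !mxE /frob2.
  move: (s _ _) (s _ _) (M _ _) (M _ _) (M _ _) (M _ _) => *; lra.
- move: e0; rewrite det_mulmx det_tr det2E.
  move: (s _ _) (s _ _) (det2 M) => *; lra.
Qed.

(** Sum and product determine the two squares up to order, and the ordering fixes the rest: S - T is
    the non-negative root of (S + T)^2 - 4 S T. *)
Lemma singular_values_eq M a b : 0 <= b -> b <= a -> a ^+ 2 + b ^+ 2 = frob2 M ->
  a ^+ 2 * b ^+ 2 = det2 M ^+ 2 ->
  singular_values M 0 o0 = a /\ singular_values M 0 o1 = b.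
Proof.
move=> b0 ba eab dab; have [t0 ts e1 e2] := singular_values_frob M.
rewrite -eab in e1; rewrite -dab in e2; move: t0 ts e1 e2.
move: (singular_values M 0 o0) (singular_values M 0 o1) => s t /= t0 ts e1 e2.
have a0 := le_trans b0 ba; have s0 := le_trans t0 ts.
have ba2 : b ^+ 2 <= a ^+ 2 by rewrite ler_pXn2r ?nnegrE.
have ts2 : t ^+ 2 <= s ^+ 2 by rewrite ler_pXn2r ?nnegrE.
suff [h1 h2] : s ^+ 2 = a ^+ 2 /\ t ^+ 2 = b ^+ 2.
  by split; apply/eqP; rewrite -(eqrXn2 (n := 2))//; apply/eqP.
move: ba2 ts2 e1 e2; move: (s ^+ 2) (t ^+ 2) (a ^+ 2) (b ^+ 2) => S T A B BA TS e1 e2.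
have E : S - T = A - B.
  apply/eqP; rewrite -(eqrXn2 (n := 2)) ?subr_ge0//; apply/eqP.
  transitivity ((S + T) ^+ 2 - 4 * (S * T)); first by ring.
  by rewrite e1 e2; ring.
by split; lra.
Qed.

#[local] Opaque singular_values.

Lemma schatten2E p M : (1 <= p)%E -> let s := singular_values M in
  schatten_norm p M = if p is r%:E then (s 0 o0 `^ r + s 0 o1 `^ r) `^ r^-1 else s 0 o0.
Proof.
move=> p1 s; have [t0 ts _ _] := singular_values_frob M; rewrite -/s in t0 ts.
have s0 := le_trans t0 ts.
rewrite /schatten_norm /lpnorm -/s; case: p p1 => [r| |]// _.
  by rewrite sum_ord2 !ger0_norm.
apply/eqP; rewrite eq_le; apply/andP; split; last first.
  by have := le_bigmax 0 (fun i => `|s 0 i|) o0; rewrite ger0_norm.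
by apply: bigmax_le => //; apply: ord2_ind => _; rewrite ger0_norm.
Qed.

(** The squares of the entries sum to at most 1/4, so both singular values are at most 1/2. As t^r
    <= t for t in [0, 1] and r >= 1, the sum of their powers is at most 1, whatever the exponent. *)
Lemma schatten_le1 p M : (1 <= p)%E -> (forall i j, `|M i j| <= 4^-1) ->
  schatten_norm p M <= 1.
Proof.
move=> p1 hM; rewrite (schatten2E _ p1).
have [t0 ts e _] := singular_values_frob M; move: t0 ts e.
move: (singular_values M 0 o0) (singular_values M 0 o1) => s t /= t0 ts e.
have sq i j : M i j ^+ 2 <= 16^-1.
  have -> : (16^-1 : R) = 4^-1 ^+ 2 by rewrite exprVn -natrX.
  by rewrite -[leLHS]real_normK ?num_real// lerXn2r ?nnegrE.
have s0 := le_trans t0 ts.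
have s2 : s ^+ 2 <= 2^-1 ^+ 2.
  have := sq o0 o0; have := sq o0 o1; have := sq o1 o0; have := sq o1 o1.
  have := sqr_ge0 t; move: e; rewrite /frob2 exprVn.
  by move: (M _ _ ^+ 2) (M _ _ ^+ 2) (M _ _ ^+ 2) (M _ _ ^+ 2) (s ^+ 2) (t ^+ 2) => *; lra.
have hs : s <= 2^-1 by rewrite -(ler_pXn2r (n := 2)) ?nnegrE// invr_ge0.
have ht := le_trans ts hs.
case: p p1 => [r| |]//; last by move=> _; apply: le_trans hs _; lra.
rewrite lee_fin => r1; have r0 : 0 < r by rewrite (lt_le_trans ltr01).
have one : 1 `^ r^-1 = 1 :> R by rewrite powR1.
rewrite -[leRHS]one; apply: ge0_ler_powR; rewrite ?nnegrE ?invr_ge0 ?(ltW r0)//.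
  by rewrite addr_ge0 ?powR_ge0.
have hs' : s `^ r <= s by apply: powR_le_self => //; lra.
have ht' : t `^ r <= t by apply: powR_le_self => //; lra.
lra.
Qed.

Lemma schatten_scale p M t : (1 <= p)%E -> 0 <= t -> t <= 1 ->
  schatten_norm p M <= 1 -> schatten_norm p (t *: M) <= 1.
Proof.
move=> p1 t0 t1; rewrite !(schatten2E _ p1).
have [b0 ba e d] := singular_values_frob M.
have [] : singular_values (t *: M) 0 o0 = t * singular_values M 0 o0 /\
    singular_values (t *: M) 0 o1 = t * singular_values M 0 o1.
  refine (singular_values_eq (mulr_ge0 t0 b0) (ler_wpM2l t0 ba) _ _).
  - rewrite !exprMn -mulrDr e /frob2 !mxZE !exprMn; ring.
  - have -> : det2 (t *: M) = t ^+ 2 * det2 M by rewrite /det2 !mxZE; ring.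
    by rewrite [RHS]exprMn -d; ring.
generalize (singular_values (t *: M) 0 o0) (singular_values (t *: M) 0 o1) => ? ? -> ->.
have a0 := le_trans b0 ba; move: a0 b0 p1; clear -t0 t1.
move: (singular_values M 0 o0) (singular_values M 0 o1) => a b a0 b0.
case: p => [r| |]; last by rewrite leeNy_eq.
  rewrite lee_fin => r1 h; apply: le_trans h; have r0 := le_trans ler01 r1.
  have m a' : 0 <= a' -> (t * a') `^ r <= a' `^ r.
    by move=> a0'; apply: (ge0_ler_powR r0); rewrite ?nnegrE ?mulr_ge0// ler_piMl.
  have r0' : 0 <= r^-1 by rewrite invr_ge0.
  apply: (ge0_ler_powR r0').
  - exact: addr_ge0 (powR_ge0 _ _) (powR_ge0 _ _).
  - exact: addr_ge0 (powR_ge0 _ _) (powR_ge0 _ _).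
  - exact: lerD (m a a0) (m b b0).
by move=> _ h; apply: le_trans h; exact: ler_piMl.
Qed.

(** The reciprocal of the norm of (1, 1) for the exponent conjugate to p. For p = +oo the extended
    inverse is 0 and the weight is 1/2. *)
Definition kernel_weight p : R := 2 `^ (fine p^-1%E - 1).

Lemma kernel_weight_ge0 p : 0 <= kernel_weight p.
Proof. exact: powR_ge0. Qed.

(** A symmetric traceless matrix of size two has equal singular values, here some m that is at most
    the weight. The conjugate norm is m for p = 1, 2m for p = +oo and 2^(1-1/p) m otherwise, hence
    at most 1 in each case. *)
Lemma schatten_kernel p a b s : (1 <= p)%E -> a ^+ 2 + b ^+ 2 <= 1 -> `|s| <= 1 ->
  schatten_norm (hoelder_conjugate p) ((kernel_weight p * s) *: mx2 a b b (- a)) <= 1.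
Proof.
move=> p1 ab s1; have p1' := hoelder_conj_ge1 p1.
pose w := kernel_weight p; have w0 : 0 <= w := kernel_weight_ge0 p.
pose m := w * (`|s| * Num.sqrt (a ^+ 2 + b ^+ 2)).
have ab0 : 0 <= a ^+ 2 + b ^+ 2 by rewrite addr_ge0 ?sqr_ge0.
have m0 : 0 <= m by rewrite !mulr_ge0 ?sqrtr_ge0.
have mw : m <= w.
  rewrite /m -[leRHS]mulr1 ler_wpM2l// mulr_ile1 ?sqrtr_ge0//.
  by rewrite -sqrtr1 ler_wsqrtr.
have m2 : m ^+ 2 = (w * s) ^+ 2 * (a ^+ 2 + b ^+ 2).
  by rewrite /m !exprMn sqr_sqrtr// real_normK ?num_real// mulrA.
have [e1 e2] : singular_values ((w * s) *: mx2 a b b (- a)) 0 o0 = m /\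
    singular_values ((w * s) *: mx2 a b b (- a)) 0 o1 = m.
  apply: singular_values_eq => //.
    by rewrite m2 /frob2 scale_mx2 !mxE !ordE /=; ring.
  by rewrite m2 /det2 scale_mx2 !mxE !ordE /=; ring.
rewrite (schatten2E _ p1') e1 e2; move: p1 p1' m0 mw w0; clear.
have hw : w = 2 `^ (fine p^-1%E - 1) by [].
move: hw; move: w m => {}w {}m hw.
case: p hw => [r| |]//; last first.
  move=> + _ _ m0 mw w0; rewrite hoelder_conjugatey invey /= sub0r powR_inv1// => hw.
  by rewrite invr1 !powRr1 ?addr_ge0//; lra.
move=> hw; rewrite lee_fin le_eqVlt => /predU1P[r1|r1] p1' m0 mw w0; move: hw.
  rewrite -r1.
  rewrite hoelder_conjugate1 inve1 /= subrr powRr0 => hw.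
  by rewrite -hw.
have r0 : 0 < r by rewrite (lt_trans ltr01).
rewrite inver gt_eqF//= => hw.
rewrite /hoelder_conjugate/= gt_eqF// inver subr_eq0 gt_eqF// -EFinM.
set k := r * _.
have k0 : 0 < k by rewrite mulr_gt0// invr_gt0 subr_gt0.
have kV : k^-1 = 1 - r^-1.
  by rewrite /k; field; rewrite gt_eqF//= subr_eq0 gt_eqF.
have -> : m `^ k + m `^ k = 2 * m `^ k by rewrite mulr_natl.
rewrite powRM ?powR_ge0// -powRrM mulfV ?gt_eqF// powRr1// kV.
apply: (@le_trans _ _ (2 `^ (1 - r^-1) * w)).
  by apply: ler_wpM2l => //; exact: powR_ge0.
have z0 : 1 - r^-1 + (r^-1 - 1) = 0 by ring.
have n2 : (1 - r^-1 + (r^-1 - 1) == 0) ==> ((2 : R) != 0) by rewrite pnatr_eq0 implybT.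
by rewrite hw -(powRD n2) z0 powRr0.
Qed.

End schatten.

(** * The variation as a supremum of pairings *)

Section variation.
Context {R : realType}.
Local Notation T2 := (R * R)%type.
Local Notation TM := (measurableTypeR R * measurableTypeR R)%type.
Local Notation mu := (@lebesgue2 R).
Implicit Types (f g : T2 -> R) (F G : T2 -> 'M[R]_2) (p : \bar R) (Omega : set T2).

Definition admissible p Omega F :=
  tfield Omega F /\ forall z, schatten_norm (hoelder_conjugate p) (F z) <= 1.

#[local] Transparent dd.

Lemma integral_hessian Omega f F : open Omega -> L1loc Omega f -> tfield Omega F ->
  (\int[mu]_(z in Omega) (\sum_(i < 2) \sum_(j < 2)
     f z * partial i (partial j (fun w => F w i j)) z)%:E =
   (ipair Omega f (dd F))%:E)%E.
Proof.
move=> oO Lf tF; rewrite /ipair /Rintegral fineK.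
  apply: eq_integral => z _; congr EFin; rewrite /dd mulr_sumr.
  by apply: eq_bigr => i _; rewrite mulr_sumr.
apply: integrable_fin_num; first exact: open_measurableT2.
exact: (testfun_integrable oO Lf (dd_testfun tF)).
Qed.

#[local] Opaque dd.

Section fixed_function.
Variables (p : \bar R) (Omega : set T2) (f : T2 -> R).
Hypothesis p1 : (1 <= p)%E.
Hypothesis oO : open Omega.
Hypothesis Lf : L1loc Omega f.
Local Notation V := (hessian_schatten_variation p f Omega).

Lemma hsv_ub F : admissible p Omega F -> ((ipair Omega f (dd F))%:E <= V)%E.
Proof.
move=> [tF hF]; apply: ereal_sup_ubound; exists F; last exact: integral_hessian.
by split => //; apply/tfieldP.
Qed.

Lemma hsv_le (v : R) : (forall F, admissible p Omega F -> ipair Omega f (dd F) <= v) ->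
  (V <= v%:E)%E.
Proof.
move=> h; apply: ge_ereal_sup => _ [F [/tfieldP tF hF] <-].
by rewrite integral_hessian// lee_fin; apply: h.
Qed.

Lemma admissible0 : admissible p Omega (fun=> 0).
Proof.
split.
  split; first exact: smooth_field_cst.
  by exists set0; split => //; exact: compact0.
move=> z; apply: schatten_le1; first exact: hoelder_conj_ge1.
by move=> i j; rewrite mxE normr0 invr_ge0.
Qed.

Lemma hsv_ge0 : (0 <= V)%E.
Proof.
by have := hsv_ub admissible0; rewrite dd0 (tf0 (testform_ipair oO Lf)).
Qed.

(** The factor 4 comes from [schatten_le1]: a field with entries at most s becomes admissible after
    division by 4s. *)
Lemma hsv_hessian_bound (v : R) : (V <= v%:E)%E ->
  hessian_bound Omega (ipair Omega f) (4 * v).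
Proof.
move=> hv F s tF hF; have tI := testform_ipair oO Lf.
have s0 : 0 <= s by apply: le_trans (hF 0 o0 o0).
have [s00|sn] := eqVneq s 0.
  by move: hF; rewrite s00 => /entries_le0 ->; rewrite dd0 (tf0 tI) mulr0.
have sp : 0 < s by rewrite lt0r sn.
have s4 : 0 < (4 * s)^-1 by rewrite invr_gt0 mulr_gt0.
have tG : tfield Omega (fun z => (4 * s)^-1 *: F z) := tfieldZ (smooth_cst _) tF.
have aG : admissible p Omega (fun z => (4 * s)^-1 *: F z).
  split => // z; apply: schatten_le1; first exact: hoelder_conj_ge1.
  move=> i j; rewrite mxZE normrM (gtr0_norm s4) invfM -mulrA; apply: ler_piMr; first by rewrite invr_ge0.
  by rewrite mulrC (ler_pdivrMr _ _ sp) mul1r; exact: hF.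
have h := le_trans (hsv_ub aG) hv; rewrite lee_fin in h.
have := eq_ind _ (fun t => t <= v) h _ (tf_ddZ tI (4 * s)^-1 tF).
have s4' : 0 < 4 * s by exact: mulr_gt0.
by rewrite mulrC (ler_pdivrMr _ _ s4') mulrCA mulrA.
Qed.

End fixed_function.

End variation.

(** * Approximation of the point values by affine functions *)

Section local_affine_bound.
Context {R : realType}.
Local Notation T2 := (R * R)%type.
Implicit Types (z x y : T2) (e s c d t u v r : R) (K A Omega : set T2) (h chi : T2 -> R).

Lemma mvt_abs (f df : R -> R) (a b M : R) :
  (forall s, `|s - a| <= `|b - a| -> is_derive s 1 f (df s)) ->
  (forall s, `|s - a| <= `|b - a| -> `|df s| <= M) ->
  `|f b - f a| <= M * `|b - a|.
Proof.
move=> hd hM.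
have in_ c d : forall s, s \in `[c, d] -> [\/ (c = a /\ d = b) | (c = b /\ d = a)] ->
    `|s - a| <= `|b - a|.
  move=> s; rewrite in_itv /= => /andP[cs sd] [] [ca db]; move: cs sd; rewrite ca db => h1 h2.
    by rewrite !ger0_norm ?subr_ge0 ?(le_trans h1)// lerD2r.
  by rewrite !ler0_norm ?subr_le0 ?(le_trans h1)// lerN2 lerD2r.
have mv c d : c < d -> [\/ (c = a /\ d = b) | (c = b /\ d = a)] -> `|f d - f c| <= M * (d - c).
  move=> cd cdab; have [||s sI ->] := @MVT _ f df _ _ cd.
  - by move=> s /subset_itv_oo_cc sI; apply: hd; exact: in_ sI cdab.
  - apply: derivable_within_continuous => s sI.
    by have [] := hd s (in_ _ _ _ sI cdab).
  rewrite normrM (ger0_norm (x := d - c)) ?subr_ge0 ?(ltW cd)//.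
  apply: ler_wpM2r; first by rewrite subr_ge0 ltW.
  by apply: hM; apply: in_ cdab; exact: subset_itv_oo_cc.
have [ab|ba|->] := ltgtP a b.
- by rewrite (ger0_norm (x := b - a)) ?subr_ge0 ?(ltW ab)//; apply: mv => //; left.
- rewrite distrC (distrC b) (ger0_norm (x := a - b)) ?subr_ge0 ?(ltW ba)//.
  by apply: mv => //; right.
- by rewrite !subrr normr0 mulr0.
Qed.

(** Two applications of the mean value inequality, which lose the factor 1/2 of the sharp
    remainder. *)
Lemma taylor1_abs (f f1 f2 : R -> R) (a b M : R) :
  (forall s, `|s - a| <= `|b - a| -> is_derive s 1 f (f1 s)) ->
  (forall s, `|s - a| <= `|b - a| -> is_derive s 1 f1 (f2 s)) ->
  (forall s, `|s - a| <= `|b - a| -> `|f2 s| <= M) ->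
  `|f b - f a - (b - a) * f1 a| <= M * `|b - a| ^+ 2.
Proof.
move=> h1 h2 hM.
have := @mvt_abs (fun s => f s - f1 a * (s - a)) (fun s => f1 s - f1 a) a b (M * `|b - a|).
rewrite subrr mulr0 subr0 expr2 mulrA.
have -> : f b - f1 a * (b - a) - f a = f b - f a - (b - a) * f1 a by ring.
apply.
  move=> s hs; apply: isdB; first exact: h1.
  have : is_derive s 1 (fun t : R => f1 a * (t - a)) ((f1 a) * (1 - 0) + (s - a) * 0).
    exact: (isdM (isdC _ _ _) (isdB (is_derive_id _ _) (isdC _ _ _))).
  by rewrite subr0 mulr1 mulr0 addr0.
move=> s hs; have M0 : 0 <= M.
  by apply: le_trans (hM s hs).
apply: (@le_trans _ _ (M * `|s - a|)); last exact: ler_wpM2l.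
by apply: mvt_abs => t ht; [apply: h2|apply: hM]; exact: le_trans hs.
Qed.

Definition setc (i : 'I_2) y t : T2 := if i == o0 then (t, y.2) else (y.1, t).
Definition getc (i : 'I_2) y : R := if i == o0 then y.1 else y.2.

Lemma translate_slice i h y t z : smooth h ->
  is_derive t 1 (fun s => h (z - setc i y s)) (- partial i h (z - setc i y t)).
Proof.
move=> sh.
have aff (c : R) : is_derive t 1 (fun s : R => c - s) (-1).
  rewrite -[X in is_derive _ _ _ X]sub0r; exact: (isdB (isdC _ _ _) (is_derive_id _ _)).
case: z => z1 z2; move: i; apply: ord2_ind; rewrite /setc !ordE.
- have [h1 _] := smooth_is_derive o0 (z1 - t, z2 - y.2) sh.
  have /= h2 := derivable_slice_fst h1.
  have := @is_derive1_comp R (fun t => h (t, z2 - y.2)) (fun s => z1 - s) t _ _ h2 (aff z1).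
  by rewrite mulrN1.
- have [h1 _] := smooth_is_derive o1 (z1 - y.1, z2 - t) sh.
  have /= h2 := derivable_slice_snd h1.
  have := @is_derive1_comp R (fun t => h (z1 - y.1, t)) (fun s => z2 - s) t _ _ h2 (aff z2).
  by rewrite mulrN1.
Qed.

Lemma norm_near t c r : `|t - c| < r -> \forall t' \near t, `|t' - c| < r.
Proof.
move=> h; apply/nbhs_ballP; exists (r - `|t - c|) => /=; first by rewrite subr_gt0.
move=> t'; rewrite /ball /= ltrBrDr => h'; apply: le_lt_trans h'.
by rewrite -[t' - c](subrKA t) (distrC t); exact: ler_normD.
Qed.

Section translates.
Variables (Omega : set T2) (I : (T2 -> R) -> R) (E : R).
Hypothesis tI : testform Omega I.
Hypothesis hE : hessian_bound Omega I E.
Variables (rho : R).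

(** The convolution of [I] with the reflection of [h]. It is differentiable in y although [I] is
    only a form, because the derivatives fall on [h]. *)
Definition pair_at h y := I (fun z => h (z - y)).

Definition supp_in h := smooth h /\ forall z, ~ sq 0 rho z -> h z = 0.

Lemma supp_in_partial i h : supp_in h -> supp_in (partial i h).
Proof.
move=> [sh h0]; split; first exact: smooth_partial.
by move=> z nz; exact: (@partial_off _ i _ _ (@sq_closed _ _ _) h0).
Qed.

Lemma sq_sub0 y z : sq 0 rho (z - y) <-> sq y rho z.
Proof. by rewrite /sq /= !subr0. Qed.

Lemma testfun_translate h y : supp_in h -> sq y rho `<=` Omega ->
  testfun Omega (fun z => h (z - y)).
Proof.
move=> [sh h0] yO; split; first exact: (smooth_continuous (smooth_translate y sh)).
exists (sq y rho); split => //; first exact: sq_compact.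
by move=> z nz; apply: h0 => /sq_sub0.
Qed.

Variables (x : T2) (a : R).
Hypothesis rho0 : 0 <= rho.
Hypothesis a0 : 0 < a.
Hypothesis xO : sq x (a + rho) `<=` Omega.

Lemma sq_in y : sq x a y -> sq y rho `<=` sq x (a + rho).
Proof. by move=> h z hz; exact: sq_trans h hz. Qed.

Lemma pair_at_diff h k y y' c : supp_in h -> supp_in k -> sq x a y -> sq x a y' ->
  I (fun z => h (z - y') - h (z - y) + c * k (z - y)) =
  pair_at h y' - pair_at h y + c * pair_at k y.
Proof.
move=> sh sk hy hy'.
have t1 := testfun_translate sh (subset_trans (sq_in hy) xO).
have t2 := testfun_translate sh (subset_trans (sq_in hy') xO).
have t3 := testfun_translate sk (subset_trans (sq_in hy) xO).
by rewrite (tfD tI (testfunB t2 t1) (testfunZ c t3)) (tfB tI t2 t1) (tfZ tI c t3).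
Qed.

(** By the mean value theorem and the uniform continuity of [partial i h], the difference quotients
    of the translates converge uniformly, with supports in a fixed compact square, where the form is
    continuous. *)
Lemma is_derive_pair_at i h y t : supp_in h -> osq x a (setc i y t) ->
  is_derive t 1 (fun s => pair_at h (setc i y s)) (- pair_at (partial i h) (setc i y t)).
Proof.
move=> sh oy; have sk := supp_in_partial i sh.
have [C C0 hC] := tf_bnd tI (@sq_compact _ x (a + rho)) xO.
have tk : testfun setT (partial i h).
  split; first exact: (smooth_continuous sk.1).
  by exists (sq 0 rho); split => //; [exact: sq_compact|exact: sk.2].
have near_in : \forall t' \near t, osq x a (setc i y t').
  move: oy; rewrite /setc; case: (i == o0) => -[/= h1 h2].
    by apply: filterS (norm_near h1) => t' h3; split.
  by apply: filterS (norm_near h2) => t' h3; split.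
have shift_t : (fun s : R => s * 1 + t) @ (0 : R) --> t.
  rewrite -[X in _ --> X]add0r; apply: cvgD; last exact: cvg_cst.
  by rewrite -[X in _ --> X](mul0r 1); apply: cvgM; [exact: cvg_id|exact: cvg_cst].
have key : (fun s : R => s^-1 *: (pair_at h (setc i y (s *: (1 : R) + t)) - pair_at h (setc i y t)))
    @ 0^' --> - pair_at (partial i h) (setc i y t).
  apply/cvgrPdist_le => c c0.
  have c1 : 0 < c / (C + 1) by rewrite divr_gt0// ltr_wpDl.
  have [d [d0 hd]] := testfun_uniform c1 tk.
  near=> s.
  have sn : s != 0 by near: s; exact: nbhs_dnbhs_neq.
  have sd : `|s| <= d.
    by near: s; apply: dnbhs0_le.
  have sI : osq x a (setc i y (s * 1 + t)).
    near: s; apply: cvg_within; exact: (shift_t _ near_in).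
  have Idiff := pair_at_diff s sh sk (osq_sub oy) (osq_sub sI).
  pose D z := h (z - setc i y (s * 1 + t)) - h (z - setc i y t) +
    s * partial i h (z - setc i y t).
  have cD : continuous D.
    have t1 := testfun_translate sh (subset_trans (sq_in (osq_sub oy)) xO).
    have t2 := testfun_translate sh (subset_trans (sq_in (osq_sub sI)) xO).
    have t3 := testfun_translate sk (subset_trans (sq_in (osq_sub oy)) xO).
    by case: (testfunD (testfunB t2 t1) (testfunZ s t3)).
  have D0 z : ~ sq x (a + rho) z -> D z = 0.
    move=> nz; rewrite /D sh.2; last by move=> /sq_sub0/(sq_in (osq_sub sI)).
    rewrite sh.2; last by move=> /sq_sub0/(sq_in (osq_sub oy)).
    rewrite sk.2; last by move=> /sq_sub0/(sq_in (osq_sub oy)).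
    by rewrite mulr0 subrr addr0.
  have Db z : `|D z| <= c / (C + 1) * `|s|.
    have := @mvt_abs (fun u => h (z - setc i y u) + (u - t) * partial i h (z - setc i y t))
      (fun u => - partial i h (z - setc i y u) + partial i h (z - setc i y t))
      t (s * 1 + t) (c / (C + 1)).
    rewrite subrr mul0r addr0 mulr1 addrK /D mulr1 => mv.
    rewrite addrAC; apply: mv => u hu.
      have e2 := isdM (isdB (is_derive_id u 1) (isdC t u 1)) (isdC (partial i h (z - setc i y t)) u 1).
      rewrite mulr0 add0r subr0 mulr1 in e2.
      exact: isdD (translate_slice i y u z sh.1) e2.
    rewrite addrC distrC; apply: ltW; rewrite distrC; apply: hd.
    have ud : `|u - t| <= d by exact: le_trans hu sd.
    have ut : `|t - u| <= d by rewrite distrC.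
    clear -d0 ut; case: z => z1 z2; rewrite /setc; case: (i == o0); split => /=.
    - by rewrite (_ : _ - _ - _ = - (t - u)) ?normrN//; ring.
    - by rewrite subrr normr0 ltW.
    - by rewrite subrr normr0 ltW.
    - by rewrite (_ : _ - _ - _ = - (t - u)) ?normrN//; ring.
  have := hC D _ cD D0 Db; rewrite Idiff => hI.
  have s0 : 0 < `|s| by rewrite normr_gt0.
  rewrite /GRing.scale /=.
  set P := pair_at (partial i h) _; set U' := pair_at h _; set U := pair_at h _.
  have -> : - P - s^-1 * (U' - U) = - (s^-1 * (U' - U + s * P)) by field.
  rewrite normrN normrM normfV ler_pdivrMl//; apply: (le_trans hI).
  rewrite mulrA [leRHS]mulrC; apply: ler_wpM2r => //.
  by rewrite mulrCA ger_pMr// ler_pdivrMr ?mul1r ?lerDl// ltr_wpDl.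
have dv : derivable (fun s => pair_at h (setc i y s)) t 1 by apply/cvg_ex; eexists; exact: key.
by apply: DeriveDef => //; exact: cvg_lim key.
Unshelve. all: by end_near.
Qed.

Lemma dd_delta h i j : smooth h ->
  dd (fun z => h z *: delta_mx i j) = partial i (partial j h).
Proof.
move=> sh; apply: funext => z; rewrite ddE.
have e k l : (fun w => (h w *: delta_mx i j : 'M[R]_2) k l) =
    if (k == i) && (l == j) then h else fun=> 0.
  by apply: funext => w; rewrite mxZE mxE; case: ifP => _; rewrite ?mulr1 ?mulr0.
rewrite !e; move: i j {e}; apply: ord2_ind; apply: ord2_ind; rewrite !ordE /= !partial_cst;
  rewrite ?partial_cst ?addr0 ?add0r//.
Qed.

(** A second derivative of a translate of [h] is the double divergence of that translate times an
    elementary matrix. The Hessian bound thus controls it by the supremum of [h] itself. *)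
Lemma pair_at_second i j h y M : supp_in h -> (forall z, `|h z| <= M) -> sq x a y ->
  `|pair_at (partial i (partial j h)) y| <= E * M.
Proof.
move=> sh hM hy; pose G z := h (z - y) *: delta_mx i j : 'M[R]_2.
have yO := subset_trans (sq_in hy) xO.
have st := smooth_translate y sh.1.
have tG : tfield Omega G.
  split; first exact: (smooth_fieldZ st (smooth_field_cst _)).
  exists (sq y rho); split => //; first exact: sq_compact.
  by move=> z nz; rewrite /G sh.2 ?scale0r// => /sq_sub0.
have eG : entries_le G M.
  move=> z k l; rewrite mxZE normrM mxE; apply: le_trans (hM (z - y)).
  by case: (_ && _); rewrite ?normr1 ?normr0 ?mulr1 ?mulr0.
have := hessian_bound_norm tI hE tG eG; rewrite /G (dd_delta i j st).
by rewrite !partial_translate.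
Qed.

Lemma setc_id i y : setc i y (getc i y) = y.
Proof. by case: y => y1 y2; rewrite /setc /getc; case: (i == o0). Qed.

(** The path from x to y goes through the corner x' along the coordinate directions. The three
    errors are the two Taylor remainders and the change of the second partial derivative between x
    and x'; each is at most E M a^2. *)
Lemma pair_at_taylor h M y : supp_in h -> 0 <= M -> (forall z, `|h z| <= M) ->
  sq x (a / 2) y ->
  `|pair_at h y - (pair_at h x - (y.1 - x.1) * pair_at (partial o0 h) x
     - (y.2 - x.2) * pair_at (partial o1 h) x)| <= 3 * (E * M) * a ^+ 2.
Proof.
move=> sh M0 hM [y1 y2].
have EM : 0 <= E * M by rewrite mulr_ge0// (hessian_bound_ge0 tI hE).
have ha t c : `|t| <= c -> c <= a / 2 -> `|t| < a.
  by move=> h1 h2; apply: (le_lt_trans h1); apply: (le_lt_trans h2); rewrite ltr_pdivrMr// ltr_pMr// ltr1n.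
pose x' := setc o0 x y.1.
have in0 s : `|s - x.1| <= `|y.1 - x.1| -> osq x a (setc o0 x s).
  by move=> hs; rewrite /setc eqxx; split => /=; [exact: ha hs y1|rewrite subrr normr0].
have in1 s : `|s - x.2| <= `|y.2 - x.2| -> osq x a (setc o1 x' s).
  move=> hs; rewrite /x' /setc !ordE; split => /=; [|exact: ha hs y2].
  by apply: ha y1.
have sp i := supp_in_partial i sh.
have x0E : setc o0 x x.1 = x by exact: (setc_id o0).
have x1E : setc o1 x' x.2 = x' by rewrite /x' /setc !ordE.
have yE : setc o1 x' y.2 = y by rewrite /x' /setc !ordE; case: (y).
have t0 : `|pair_at h x' - pair_at h x - (y.1 - x.1) * - pair_at (partial o0 h) x|
    <= E * M * `|y.1 - x.1| ^+ 2.
  have := @taylor1_abs (fun s => pair_at h (setc o0 x s))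
    (fun s => - pair_at (partial o0 h) (setc o0 x s))
    (fun s => - (- pair_at (partial o0 (partial o0 h)) (setc o0 x s))) x.1 y.1 (E * M).
  rewrite x0E -/x'; apply => s hs.
  - exact: is_derive_pair_at sh (in0 s hs).
  - apply: isdN; exact: is_derive_pair_at (sp o0) (in0 s hs).
  - by rewrite opprK; apply: pair_at_second => //; exact: osq_sub (in0 s hs).
have t1 : `|pair_at h y - pair_at h x' - (y.2 - x.2) * - pair_at (partial o1 h) x'|
    <= E * M * `|y.2 - x.2| ^+ 2.
  have := @taylor1_abs (fun s => pair_at h (setc o1 x' s))
    (fun s => - pair_at (partial o1 h) (setc o1 x' s))
    (fun s => - (- pair_at (partial o1 (partial o1 h)) (setc o1 x' s))) x.2 y.2 (E * M).
  rewrite x1E yE; apply => s hs.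
  - exact: is_derive_pair_at sh (in1 s hs).
  - apply: isdN; exact: is_derive_pair_at (sp o1) (in1 s hs).
  - by rewrite opprK; apply: pair_at_second => //; exact: osq_sub (in1 s hs).
have t2 : `|pair_at (partial o1 h) x' - pair_at (partial o1 h) x| <= E * M * `|y.1 - x.1|.
  have := @mvt_abs (fun s => pair_at (partial o1 h) (setc o0 x s))
    (fun s => - pair_at (partial o0 (partial o1 h)) (setc o0 x s)) x.1 y.1 (E * M).
  rewrite x0E -/x'; apply => s hs.
  - exact: is_derive_pair_at (sp o1) (in0 s hs).
  - by rewrite normrN; apply: pair_at_second => //; exact: osq_sub (in0 s hs).
have aa t c : 0 <= t -> t <= a / 2 -> 0 <= c -> c <= a / 2 -> t * c <= a ^+ 2.
  move=> ? ? ? ?; apply: (@le_trans _ _ (a / 2 * (a / 2))); first exact: ler_pM.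
  by move: (sqr_ge0 a); rewrite expr2; nra.
have n1 := normr_ge0 (y.1 - x.1); have n2 := normr_ge0 (y.2 - x.2).
have b0 : E * M * `|y.1 - x.1| ^+ 2 <= E * M * a ^+ 2 by apply: ler_wpM2l => //; exact: aa.
have b1 : E * M * `|y.2 - x.2| ^+ 2 <= E * M * a ^+ 2 by apply: ler_wpM2l => //; exact: aa.
have b2 : `|(y.2 - x.2) * (pair_at (partial o1 h) x' - pair_at (partial o1 h) x)|
    <= E * M * a ^+ 2.
  rewrite normrM; apply: le_trans (ler_wpM2l n2 t2) _.
  by rewrite mulrCA; apply: ler_wpM2l => //; exact: aa.
move: (le_trans t0 b0) (le_trans t1 b1) b2.
rewrite -(mulrA 3).
generalize (pair_at h y) (pair_at h x) (pair_at h x') (pair_at (partial o0 h) x)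
  (pair_at (partial o1 h) x) (pair_at (partial o1 h) x') (E * M * a ^+ 2)
  (y.1 - x.1) (y.2 - x.2) => uy ux ux' p0 p1 p1' B v0 v1.
clear => /ler_normlP[? ?] /ler_normlP[? ?] /ler_normlP[? ?].
by apply/ler_normlP; split; lra.
Qed.

End translates.

#[local] Transparent qden kerA kerB gradA gradB cut.

(** The remainder at any y is a translate of this function, so its pairing with [I] is a [pair_at],
    to which the Taylor estimate applies. *)
Definition kerrem0 r := kerrem (cut (0 : T2) r) 0 0.

Lemma cut_translate r y : cut y r = fun w => cut (0 : T2) r (w - y).
Proof. by apply: funext => w; rewrite /cut /bump1 /bump2 /= !subr0. Qed.

#[local] Opaque cut.

Lemma kerrem_translate r y z : kerrem (cut y r) y 0 z = kerrem0 r (z - y).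
Proof.
have p1 i : partial i (cut y r) = fun w => partial i (cut (0 : T2) r) (w - y).
  by rewrite cut_translate; exact: partial_translate.
have p2 i j : partial i (partial j (cut y r)) =
    fun w => partial i (partial j (cut (0 : T2) r)) (w - y).
  by rewrite p1; exact: (partial_translate i (partial j (cut (0 : T2) r))).
have kA : kerA y 0 z = kerA 0 0 (z - y) by rewrite /kerA /qden /= !subr0.
have kB : kerB y 0 z = kerB 0 0 (z - y) by rewrite /kerB /qden /= !subr0.
have gA : gradA y 0 z = gradA 0 0 (z - y) by rewrite /gradA /qden /= !subr0.
have gB : gradB y 0 z = gradB 0 0 (z - y) by rewrite /gradB /qden /= !subr0.
rewrite /kerrem0 (kerremE (cut y r) y 0 z) (kerremE (cut 0 r) 0 0 (z - y)) kA kB gA gB.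
have q1 i : partial i (cut y r) z = partial i (cut (0 : T2) r) (z - y) := congr1 (@^~ z) (p1 i).
have q2 i j := congr1 (@^~ z) (p2 i j).
exact: (congr2 +%R (congr2 +%R
  (congr1 ( *%R^~ _) (congr2 (fun u v => u - v) (q2 o0 o0) (q2 o1 o1)))
  (congr1 ( *%R^~ _) (congr2 +%R (q2 o0 o1) (q2 o1 o0))))
  (congr1 ( *%R 2) (congr2 +%R (congr1 ( *%R^~ _) (q1 o0)) (congr1 ( *%R^~ _) (q1 o1))))).
Qed.

(* Near the origin all derivatives of the cutoff vanish, so the singular
   denominators may be replaced by nonvanishing ones. *)
Lemma smooth_kerrem0 r : 0 < r -> smooth (kerrem0 r).
Proof.
move=> r0; have r4 : 0 < r / 4 by rewrite divr_gt0.
pose q (z : T2) := z.1 * z.1 + z.2 * z.2 + cut (0 : T2) (r / 4) z.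
have sc := @smooth_cut R 0 r.
have q0 z : q z != 0.
  rewrite /q gt_eqF// -!expr2.
  have [->|zn] := pselect (z = 0).
    rewrite cut_eq1//; last exact: sq_center (ltW r4).
    by rewrite ltr_wpDl// addr_ge0 ?sqr_ge0.
  have := qden_neq 0 zn; rewrite /qden !subr0 expr0n addr0 => hq.
  by rewrite ltr_pwDl ?cut_ge0// lt0r hq addr_ge0 ?sqr_ge0.
have sq_ : smooth q.
  apply: smoothD; last exact: smooth_cut.
  by apply: smoothD; apply: smoothM; [exact: smooth_fst..|exact: smooth_snd|exact: smooth_snd].
have sV := smoothV q0 sq_.
have s1 := @smooth_fst R; have s2 := @smooth_snd R.
have sP i := smooth_partial i sc; have sPP i j := smooth_partial i (smooth_partial j sc).
have -> : kerrem0 r = fun z =>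
   (partial o0 (partial o0 (cut 0 r)) z - partial o1 (partial o1 (cut 0 r)) z) *
     ((z.1 * z.1 - z.2 * z.2) * (q z)^-1)
  + (partial o0 (partial o1 (cut 0 r)) z + partial o1 (partial o0 (cut 0 r)) z) *
     (2 * (z.1 * z.2) * (q z)^-1)
  + 2 * (partial o0 (cut 0 r) z * (2 * z.1 * (q z)^-1) +
         partial o1 (cut 0 r) z * (2 * z.2 * (q z)^-1)).
  apply: funext => z; have [oz|noz] := pselect (osq 0 r z).
    have c1 w : sq 0 r w -> cut (0 : T2) r w = 1 by exact: cut_eq1.
    have P0 i : forall w, osq 0 r w -> partial i (cut (0 : T2) r) w = 0.
      move=> w ow; rewrite -(f_equal (@^~ w) (partial_cst i (1 : R))); apply: partial_near.
      by apply: filterS (open_nbhs_nbhs (conj (@osq_open _ 0 r) ow)) => v /osq_sub; exact: c1.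
    have P1 i j : partial i (partial j (cut (0 : T2) r)) z = 0.
      rewrite -(f_equal (@^~ z) (partial_cst i (0 : R))); apply: partial_near.
      by apply: filterS (open_nbhs_nbhs (conj (@osq_open _ 0 r) oz)) => v; exact: P0.
    have form0 (a b c d e f k l m n : R) : a = 0 -> b = 0 -> c = 0 -> d = 0 -> e = 0 -> f = 0 ->
        (a - b) * k + (c + d) * l + 2 * (e * m + f * n) = 0.
      by move=> -> -> -> -> -> ->; ring.
    rewrite [LHS](kerrem_near 0 0 sc c1 oz); apply/esym; apply: form0;
      [exact: P1..|exact: P0|exact: P0].
  have qE : q z = qden 0 0 z.
    rewrite /q cut_eq0//; last first.
      move=> [h1 h2]; apply: noz; split; [apply: le_lt_trans h1 _|apply: le_lt_trans h2 _];
        by move: r0; clear; lra.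
    by rewrite /qden !subr0 expr0n.
  have kA : kerA 0 0 z = (z.1 * z.1 - z.2 * z.2) * (q z)^-1.
    by rewrite /kerA -qE !subr0.
  have kB : kerB 0 0 z = 2 * (z.1 * z.2) * (q z)^-1 by rewrite /kerB -qE !subr0.
  have gA : gradA 0 0 z = 2 * z.1 * (q z)^-1.
    by rewrite /gradA -qE subr0 expr0n /= mul0r addr0 mulr1.
  have gB : gradB 0 0 z = 2 * z.2 * (q z)^-1.
    by rewrite /gradB -qE subr0 expr0n /= mul0r addr0 mulr1.
  by rewrite /kerrem0 kerremE kA kB gA gB.
have sK : smooth (fun z : T2 => (z.1 * z.1 - z.2 * z.2) * (q z)^-1).
  by apply: smoothM sV; apply: smoothB; apply: smoothM.
have sL : smooth (fun z : T2 => 2 * (z.1 * z.2) * (q z)^-1).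
  by apply: smoothM sV; apply: smoothM; [exact: smooth_cst|exact: smoothM].
have sM : smooth (fun z : T2 => 2 * z.1 * (q z)^-1).
  by apply: smoothM sV; apply: smoothM s1; exact: smooth_cst.
have sN : smooth (fun z : T2 => 2 * z.2 * (q z)^-1).
  by apply: smoothM sV; apply: smoothM s2; exact: smooth_cst.
exact: (smoothD (smoothD (smoothM (smoothB (sPP o0 o0) (sPP o1 o1)) sK)
  (smoothM (smoothD (sPP o0 o1) (sPP o1 o0)) sL))
  (smoothM (smooth_cst 2) (smoothD (smoothM (sP o0) sM) (smoothM (sP o1) sN)))).
Qed.

#[local] Opaque qden kerA kerB gradA gradB.

(** The coefficients form a row vector, so that evaluation at several points is multiplication by a
    matrix. This lets [normalisation] solve for them with a pseudo-inverse. *)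
Definition affine (al : 'rV[R]_3) z : R := (al *m (\col_k [:: 1; z.1; z.2]`_k)) 0 0.

Lemma affineE al z : affine al z = al 0 0 + al 0 1 * z.1 + al 0 (1 + 1) * z.2.
Proof.
rewrite /affine mxE !big_ord_recl big_ord0 !mxE /= mulr1 addr0 addrA.
by congr (_ + al _ _ * _ + al _ _ * _); exact: val_inj.
Qed.

Lemma affine_of (a b c : R) : exists al, forall z, affine al z = a + b * z.1 + c * z.2.
Proof.
exists (\row_k [:: a; b; c]`_k) => z.
by rewrite /affine mxE !big_ord_recl big_ord0 !mxE /= mulr1 addr0 addrA.
Qed.

(** By [pval_estimate], 4 pi times the value at y differs from minus the remainder term by at most
    E. That term has second derivatives at most E M in y, so it is close to its Taylor polynomial at
    x, which yields the affine function. The radius and C depend on Omega and x but not on the form,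
    which makes the bound uniform along a sequence. *)
Lemma local_affine Omega x : open Omega -> Omega x ->
  exists r C, [/\ 0 < r, 0 <= C, sq x r `<=` Omega & forall I E, testform Omega I ->
    hessian_bound Omega I E -> exists al, forall y, sq x r y ->
    `|pval Omega I y - affine al y| <= C * E].
Proof.
move=> oO Ox; have [d [d0 hd]] := nbhs_sq (open_nbhs_nbhs (conj oO Ox)).
have p0 : 0 < 4 * pi :> R := pi4_gt0.
(* The base square and the supports of the translates both have radius 2r and must fit together into
   Omega; the Taylor estimate then holds on half the base square. *)
pose r := d / 4; have r0 : 0 < r by rewrite divr_gt0.
have r2 : 0 < 2 * r by rewrite mulr_gt0.
have dE : 2 * r + 2 * r = d by rewrite /r; field.
have hr : sq x (2 * r + 2 * r) `<=` Omega by rewrite dE.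
have sH : supp_in (2 * r) (kerrem0 r).
  split; first exact: smooth_kerrem0.
  move=> z nz; apply: (kerrem_off _ _ (@sq_compact _ 0 (2 * r)) _ nz) => w.
  exact: cut_eq0.
have tH : testfun setT (kerrem0 r).
  split; first exact: (smooth_continuous sH.1).
  by exists (sq 0 (2 * r)); split => //; [exact: sq_compact|exact: sH.2].
have [M M0 hM] := testfun_bounded tH.
exists r, ((1 + 3 * M * (2 * r) ^+ 2) / (4 * pi)); split => //.
- have M3 : 0 <= 3 * M * (2 * r) ^+ 2 := mulr_ge0 (mulr_ge0 (ler0n _ 3) M0) (sqr_ge0 _).
  exact: divr_ge0 (addr_ge0 ler01 M3) (ltW p0).
- by apply: subset_trans hr; apply: sqS; lra.
move=> I E tI hE.
have h2 : 2 * r / 2 = r by field.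
pose u y := pair_at I (kerrem0 r) y; pose p i := pair_at I (partial i (kerrem0 r)) x.
have [al hal] := affine_of
  (- (u x + x.1 * p o0 + x.2 * p o1) / (4 * pi)) (p o0 / (4 * pi)) (p o1 / (4 * pi)).
exists al => y hy.
have Oy : Omega y by apply: hr; apply: sqS hy; lra.
have yr : sq y (2 * r) `<=` Omega.
  apply: subset_trans hr => z hz; apply: sq_trans hz; apply: sqS hy; lra.
have e1 : `|4 * pi * pval Omega I y + u y| <= E.
  have := pval_estimate oO tI hE Oy (cutoff_cut r0 yr (osq_center y r0)) (@subset_refl _ Omega) _ (EA := E).
  have -> : u y = I (kerrem (cut y r) y 0).
    by congr I; apply: funext => z; rewrite kerrem_translate.
  apply.
    exists (sq y (2 * r)); split => //; first exact: sq_compact.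
    by move=> z; exact: cut_eq0.
  by move=> F tF hF; have := hE F 1 tF hF; rewrite mulr1.
have e2 := pair_at_taylor tI hE r2 hr sH M0 hM (y := y); rewrite h2 in e2.
have {}e2 := e2 hy; rewrite -/(u y) -/(u x) -/(p o0) -/(p o1) in e2.
rewrite mulrAC ler_pdivlMr// -[X in _ * X](gtr0_norm p0) -normrM.
have -> : (pval Omega I y - affine al y) * (4 * pi) = (4 * pi * pval Omega I y + u y)
   - (u y - (u x - (y.1 - x.1) * p o0 - (y.2 - x.2) * p o1)).
  rewrite hal; have p00 : 4 * pi != 0 :> R by rewrite gt_eqF.
  move: p00; generalize (4 * pi : R) (u x) (u y) (p o0) (p o1) (pval Omega I y) => k a b c e f.
  by clear => k0; field.
apply: (le_trans (ler_normB _ _)); rewrite [leRHS]mulrDl mul1r; apply: (lerD e1).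
rewrite (_ : 3 * M * (2 * r) ^+ 2 * E = 3 * (E * M) * (2 * r) ^+ 2)//; ring.
Qed.

End local_affine_bound.

(** * Locally affine functions have no Hessian *)

Section affine_invariance.
Context {R : realType}.
Local Notation T2 := (R * R)%type.
Local Notation TM := (measurableTypeR R * measurableTypeR R)%type.
Local Notation mu := (@lebesgue2 R).
Implicit Types (z x y w : T2) (K A Omega : set T2) (h b : T2 -> R) (al : 'rV[R]_3).

Lemma smooth_affine al : smooth (affine al).
Proof.
rewrite (_ : affine al = fun z => al 0 0 + al 0 1 * z.1 + al 0 (1 + 1) * z.2).
  exact: (smoothD (smoothD (smooth_cst _) (smoothM (smooth_cst _) (@smooth_fst R)))
    (smoothM (smooth_cst _) (@smooth_snd R))).
by apply: funext => z; exact: affineE.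
Qed.

Lemma partial_affine i al : exists a : R, partial i (affine al) = fun=> a.
Proof.
rewrite (_ : affine al = fun z => al 0 0 + al 0 1 * z.1 + al 0 (1 + 1) * z.2); last first.
  by apply: funext => z; exact: affineE.
have s1 := @smooth_fst R; have s2 := @smooth_snd R.
have t1 := smoothM (smooth_cst (al 0 1)) s1; have t2 := smoothM (smooth_cst (al 0 (1 + 1))) s2.
exists (al 0 1 * (i == o0)%:R + al 0 (1 + 1) * (i == o1)%:R).
rewrite (partialD i (smoothD (smooth_cst _) t1) t2) (partialD i (smooth_cst _) t1).
by rewrite partial_cst (partialZ i _ s1) (partialZ i _ s2) partial_fst partial_snd; apply: funext => z; rewrite add0r.
Qed.

Lemma smooth_testfun h : smooth h -> (exists2 K, compact K & forall z, ~ K z -> h z = 0) ->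
  testfun setT h.
Proof. by move=> sh [K cK hK]; split; [exact: smooth_continuous|exists K]. Qed.

Lemma partial_supp i h : (exists2 K, compact K & forall z, ~ K z -> h z = 0) ->
  exists2 K, compact K & forall z, ~ K z -> partial i h z = 0.
Proof.
by move=> [K cK hK]; exists K => //; exact: (@partial_off _ i _ _ (compact_closedT2 cK) hK).
Qed.

Lemma supp_mul b h : (exists2 K, compact K & forall z, ~ K z -> h z = 0) ->
  exists2 K, compact K & forall z, ~ K z -> b z * h z = 0.
Proof. by move=> [K cK hK]; exists K => // z /hK ->; rewrite mulr0. Qed.

(** The product rule writes the integrand as a derivative of a compactly supported function minus a
    constant multiple of another one; both integrate to zero. *)
Lemma integral_affine_second i j al h : smooth h ->
  (exists2 K, compact K & forall z, ~ K z -> h z = 0) ->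
  \int[mu]_z (affine al z * partial i (partial j h) z) = 0.
Proof.
move=> sh hK; have [a ea] := partial_affine i al.
have sj := smooth_partial j sh; have sa := smooth_affine al.
have Kj := partial_supp j hK.
have s1 := smoothM sa sj; have s2 := smoothM (smooth_cst a) sh.
have K1 := supp_mul (affine al) Kj; have K2 := supp_mul (fun=> a) hK.
transitivity (\int[mu]_z (partial i (fun z => affine al z * partial j h z) z -
    partial j (fun z => a * h z) z)).
  apply: eq_Rintegral => z _.
  by rewrite (partialM i sa sj) (partialZ j a sh) ea addrK.
have i1 := testfun_integrableT (smooth_testfun (smooth_partial i s1) (partial_supp i K1)).
have i2 := testfun_integrableT (smooth_testfun (smooth_partial j s2) (partial_supp j K2)).
by rewrite (RintegralB measurableT i1 i2) (integral_partial i s1 K1) (integral_partial j s2 K2) subrr.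
Qed.

Lemma Rintegral_zero4 (a b c d : T2 -> R) :
  mu.-integrable (setT : set TM) (EFin \o a) -> mu.-integrable (setT : set TM) (EFin \o b) ->
  mu.-integrable (setT : set TM) (EFin \o c) -> mu.-integrable (setT : set TM) (EFin \o d) ->
  \int[mu]_z a z = 0 -> \int[mu]_z b z = 0 -> \int[mu]_z c z = 0 -> \int[mu]_z d z = 0 ->
  \int[mu]_z (a z + b z + (c z + d z)) = 0.
Proof.
move=> ia ib ic id a0 b0 c0 d0.
have iab := integrableD measurableT ia ib; have icd := integrableD measurableT ic id.
by rewrite (RintegralD measurableT iab icd) (RintegralD measurableT ia ib)
  (RintegralD measurableT ic id) a0 b0 c0 d0 !addr0.
Qed.

Lemma integral_affine_dd al (F : T2 -> 'M[R]_2) A : tfield A F ->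
  \int[mu]_z (affine al z * dd F z) = 0.
Proof.
move=> [sF [K [cK _ hK]]].
have FK k l : exists2 K, compact K & forall z, ~ K z -> F z k l = 0.
  by exists K => // z /hK ->; rewrite mxE.
have ti i j k l : mu.-integrable (setT : set TM)
    (EFin \o (fun z => affine al z * partial i (partial j (fun w => F w k l)) z)).
  apply: testfun_integrableT; apply: smooth_testfun.
    exact: smoothM (smooth_affine al) (smooth_partial i (smooth_partial j (sF k l))).
  exact/supp_mul/partial_supp/partial_supp.
have mul4 (k a b c d : R) : k * (a + b + (c + d)) = k * a + k * b + (k * c + k * d) by ring.
rewrite -[RHS](Rintegral_zero4 (ti o0 o0 o0 o0) (ti o0 o1 o0 o1) (ti o1 o0 o1 o0) (ti o1 o1 o1 o1)
  (integral_affine_second o0 o0 al (sF o0 o0) (FK o0 o0))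
  (integral_affine_second o0 o1 al (sF o0 o1) (FK o0 o1))
  (integral_affine_second o1 o0 al (sF o1 o0) (FK o1 o0))
  (integral_affine_second o1 o1 al (sF o1 o1) (FK o1 o1))).
by apply: eq_Rintegral => z _; rewrite ddE; exact: mul4.
Qed.

(** The coefficients may differ from one component of Omega to another; the local formulation
    expresses this directly. *)
Definition locally_affine Omega b := forall x, Omega x -> exists r al,
  [/\ 0 < r, sq x r `<=` Omega & forall y, sq x r y -> b y = affine al y].

Lemma locally_affine_continuous Omega b : locally_affine Omega b ->
  {in Omega, continuous b}.
Proof.
move=> lb x; rewrite inE => /lb [r [al [r0 _ hr]]].
have ca : (affine al) @ x --> affine al x by exact: (smooth_continuous (smooth_affine al)).
rewrite /continuous_at hr; last exact: sq_center (ltW r0).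
apply: cvg_trans ca; apply: near_eq_cvg.
by apply: filterS (sq_nbhs x r0) => y /hr ->.
Qed.

Lemma locally_affine_dd Omega b F : open Omega -> locally_affine Omega b ->
  tfield Omega F -> ipair Omega b (dd F) = 0.
Proof.
move=> oO lb; have Lb := continuous_L1loc oO (locally_affine_continuous lb).
apply: (testform_dd_local (testform_ipair oO Lb)) => x Ox.
have [r [al [r0 rO hr]]] := lb x Ox.
have r2 : 2 * (r / 2) = r by field.
exists (r / 2); rewrite r2; split => //; first by rewrite divr_gt0.
move=> G tG; have [_ [K [cK KA hK]]] := dd_testfun tG.
rewrite (pairing_restrict b cK (subset_trans KA rO) hK).
rewrite -(integral_affine_dd al tG) [RHS](@Rintegral_off _ K); last first.
  by move=> z /hK ->; rewrite mulr0.
by apply: eq_Rintegral => z /set_mem /KA Kz; rewrite hr.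
Qed.

End affine_invariance.

(** * Normalisation by locally affine functions *)

Section normalisation.
Context {R : realType}.
Local Notation T2 := (R * R)%type.
Implicit Types (z x y w : T2) (al : 'rV[R]_3) (f g : nat -> R).

Lemma affineB al be z : affine (al - be) z = affine al z - affine be z.
Proof. by rewrite /affine mulmxBl !mxE. Qed.

Lemma affine_sum al z : affine al z = \sum_k al 0 k * [:: 1; z.1; z.2]`_k.
Proof. by rewrite /affine mxE; apply: eq_bigr => k _; rewrite mxE. Qed.

#[local] Opaque affine.

Definition bdd f := exists C, forall n, `|f n| <= C.

Lemma bddD f g : bdd f -> bdd g -> bdd (fun n => f n + g n).
Proof.
by move=> [C hC] [D hD]; exists (C + D) => n; apply: le_trans (ler_normD _ _) _; exact: lerD.
Qed.

Lemma bddZ (c : R) f : bdd f -> bdd (fun n => f n * c).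
Proof. by move=> [C hC]; exists (C * `|c|) => n; rewrite normrM ler_wpM2r. Qed.

Lemma bddN f : bdd f -> bdd (fun n => - f n).
Proof. by move=> [C hC]; exists C => n; rewrite normrN. Qed.

Lemma bdd_sum m (f : 'I_m -> nat -> R) : (forall i, bdd (f i)) ->
  bdd (fun n => \sum_i f i n).
Proof.
move=> h; have /choice [C hC] : forall i, exists C, forall n, `|f i n| <= C by [].
exists (\sum_i C i) => n; apply: le_trans (ler_norm_sum _ _ _) _.
by apply: ler_sum => i _; exact: hC.
Qed.

Definition rbdd m (A : nat -> 'rV[R]_m) := forall k, bdd (fun n => A n 0 k).

Lemma rbdd_mulmx m k (A : nat -> 'rV[R]_m) (M : 'M[R]_(m, k)) : rbdd A ->
  rbdd (fun n => A n *m M).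
Proof.
move=> hA j; have [C hC] : bdd (fun n => \sum_i A n 0 i * M i j).
  by apply: bdd_sum => i; apply: bddZ; exact: hA.
by exists C => n; rewrite mxE.
Qed.

Lemma rbdd_affine (A : nat -> 'rV[R]_3) x r : rbdd A -> exists C, forall n y, sq x r y ->
  `|affine (A n) y| <= C.
Proof.
move=> hA; have [C0 h0] := hA 0; have [C1 h1] := hA 1; have [C2 h2] := hA (1 + 1).
exists (C0 + C1 * (`|x.1| + r) + C2 * (`|x.2| + r)) => n y [y1 y2]; rewrite affineE.
have b1 : `|y.1| <= `|x.1| + r.
  by rewrite -(subrK x.1 y.1) addrC; apply: le_trans (ler_normD _ _) _; rewrite lerD2l.
have b2 : `|y.2| <= `|x.2| + r.
  by rewrite -(subrK x.2 y.2) addrC; apply: le_trans (ler_normD _ _) _; rewrite lerD2l.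
apply: le_trans (ler_normD _ _) _; apply: lerD.
  apply: le_trans (ler_normD _ _) _; apply: lerD; first exact: h0.
  by rewrite normrM; apply: ler_pM.
by rewrite normrM; apply: ler_pM.
Qed.

(** The slopes are difference quotients between x and its translates by r along the axes; the
    constant coefficient follows from the value at x. *)
Lemma affine_rbdd (A : nat -> 'rV[R]_3) x r C : 0 < r ->
  (forall n y, sq x r y -> `|affine (A n) y| <= C) -> rbdd A.
Proof.
move=> r0 h.
have c0 : bdd (fun n => affine (A n) x).
  by exists C => n; apply: h; exact: sq_center (ltW r0).
have rr (t : R) : `|t + r - t| <= r by rewrite [t + r]addrC addrK gtr0_norm.
have r00 (t : R) : `|t - t| <= r by rewrite subrr normr0 ltW.
have in1 : sq x r (x.1 + r, x.2) := conj (rr x.1) (r00 x.2).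
have in2 : sq x r (x.1, x.2 + r) := conj (r00 x.1) (rr x.2).
have c1 : bdd (fun n => affine (A n) (x.1 + r, x.2)) := ex_intro _ C (fun n => h n _ in1).
have c2 : bdd (fun n => affine (A n) (x.1, x.2 + r)) := ex_intro _ C (fun n => h n _ in2).
have e1 : bdd (fun n => A n 0 1).
  have [D hD] := bddZ r^-1 (bddD c1 (bddN c0)); exists D => n.
  rewrite (_ : A n 0 1 = (affine (A n) (x.1 + r, x.2) - affine (A n) x) * r^-1)//.
  by rewrite !affineE /=; field; rewrite gt_eqF.
have e2 : bdd (fun n => A n 0 (1 + 1)).
  have [D hD] := bddZ r^-1 (bddD c2 (bddN c0)); exists D => n.
  rewrite (_ : A n 0 (1 + 1) = (affine (A n) (x.1, x.2 + r) - affine (A n) x) * r^-1)//.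
  by rewrite !affineE /=; field; rewrite gt_eqF.
have e0 : bdd (fun n => A n 0 0).
  have [D hD] := bddD (bddD c0 (bddN (bddZ x.1 e1))) (bddN (bddZ x.2 e2)); exists D => n.
  rewrite (_ : A n 0 0 = affine (A n) x - A n 0 1 * x.1 - A n 0 (1 + 1) * x.2)//.
  by rewrite affineE; ring.
case=> -[|[|[|//]]] hk.
- by rewrite (_ : Ordinal hk = 0)//; exact: val_inj.
- by rewrite (_ : Ordinal hk = 1)//; exact: val_inj.
- by rewrite (_ : Ordinal hk = 1 + 1)//; exact: val_inj.
Qed.

Variables (Omega : set T2) (N : nat) (x : 'I_N -> T2) (u : nat -> T2 -> R).
Hypothesis Ox : forall i, Omega (x i).
Hypothesis oO : open Omega.
Hypothesis ux : forall i, bdd (fun n => u n (x i)).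
Hypothesis uaff : forall z, Omega z -> exists r C, [/\ 0 < r, sq z r `<=` Omega &
  forall n, exists al, forall y, sq z r y -> `|u n y - affine al y| <= C].

(** Call two points equivalent when the affine approximations of u_n near them differ by a bounded
    sequence. The classes are open, so one approximation per class gives a locally affine function.
    It is corrected to vanish at the x_i of its class, and boundedness of the u_n(x_i) keeps the
    corrections bounded. *)
Lemma normalisation : exists b : nat -> T2 -> R,
  [/\ forall n, locally_affine Omega (b n),
      forall n i, b n (x i) = 0 &
      forall z, Omega z -> exists r C, [/\ 0 < r, sq z r `<=` Omega &
        forall n y, sq z r y -> `|u n y - b n y| <= C]].
Proof.
have /choice [A hA] : forall z, exists A : nat -> 'rV[R]_3, Omega z -> exists r C,
    [/\ 0 < r, sq z r `<=` Omega &
      forall n y, sq z r y -> `|u n y - affine (A n) y| <= C].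
  move=> z; have [Oz|nO] := pselect (Omega z); last by exists (fun=> 0).
  have [r [C [r0 rO hr]]] := uaff Oz; have /choice [A hA] := hr.
  by exists A => _; exists r, C; split => // n y; exact: hA.
pose eqv z w := rbdd (fun n => A z n - A w n).
have eqv_sym z w : eqv z w -> eqv w z.
  move=> h k; have [C hC] := bddN (h k); exists C => n; have := hC n.
  by rewrite !mxE opprB.
have eqv_trans z w v : eqv z w -> eqv w v -> eqv z v.
  move=> h1 h2 k; have [C hC] := bddD (h1 k) (h2 k); exists C => n; have := hC n.
  by rewrite !mxE addrA subrK.
have eqv_refl z : eqv z z.
  by move=> k; exists 0 => n; rewrite !mxE subrr normr0.
have eqv_near z : Omega z -> exists2 r, 0 < r & sq z r `<=` Omega /\
    forall w, sq z r w -> eqv z w.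
  move=> Oz; have [r [C [r0 rO hC]]] := hA z Oz.
  have r2 : 0 < r / 2 by rewrite divr_gt0.
  have r2r : r / 2 <= r by lra.
  exists (r / 2) => //; split; first exact: subset_trans (sqS r2r) rO.
  move=> w hw; have Ow : Omega w by apply: rO; exact: sqS r2r _ hw.
  have [s [D [s0 sO hD]]] := hA w Ow.
  apply: (@affine_rbdd _ w (Num.min (r / 2) s) (D + C)); first by rewrite lt_min r2.
  move=> n y hy; rewrite affineB.
  have y1 : sq z r y.
    rewrite [r](splitr r); apply: sq_trans hw _; apply: sqS hy.
    by rewrite ge_min lexx.
  have y2 : sq w s y by apply: sqS hy; rewrite ge_min lexx orbT.
  rewrite (_ : _ - _ = (u n y - affine (A w n) y) - (u n y - affine (A z n) y)); last by ring.
  by apply: le_trans (ler_normB _ _) _; apply: lerD; [exact: hD|exact: hC].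
(* Equivalent points have the same class as a set, so [xget] returns the same representative for
   them and the choice is locally constant on Omega. *)
pose rep z := xget (0 : T2) [set w | Omega w /\ eqv z w].
have repP z : Omega z -> eqv z (rep z).
  move=> Oz; rewrite /rep; case: xgetP => [w _ []//|/(_ z) h]; exfalso; apply: h.
  by split; [|exact: eqv_refl].
have rep_eq z w : eqv z w -> rep z = rep w.
  move=> zw; rewrite /rep; congr xget.
  apply/seteqP; split => v [Ov zv]; split => //; first exact: eqv_trans (eqv_sym _ _ zw) zv.
  exact: eqv_trans zw zv.
(* Evaluation at the data points of the class of w; points of other classes get a zero column and
   impose no condition. *)
pose Ev w : 'M[R]_(3, N) := \matrix_(k, i)
  (if `[< eqv w (x i) >] then [:: 1; (x i).1; (x i).2]`_k else 0).
have EvE w al i : (al *m Ev w) 0 i = if `[< eqv w (x i) >] then affine al (x i) else 0.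
  rewrite affine_sum mxE; case: ifPn => h.
    by apply: eq_bigr => k _; rewrite mxE h.
  by rewrite big1// => k _; rewrite mxE (negbTE h) mulr0.
(* Coefficients with the same values as [A w n] at the data points of the class. They are the image
   of these values under a fixed matrix, hence bounded in n as soon as the values are. *)
pose D w n := A w n *m Ev w *m pinvmx (Ev w).
pose be w n := A w n - D w n.
have be0 w n : be w n *m Ev w = 0.
  by rewrite mulmxBl mulmxKpV ?subrr// submxMl.
have bD w : rbdd (D w).
  apply: rbdd_mulmx => i; have [h|h] := asboolP (eqv w (x i)); last first.
    by exists 0 => n; rewrite EvE asboolF// normr0.
  have [r [C [r0 rO hC]]] := hA _ (Ox i).
  have [C1 h1] := rbdd_affine (x i) 0 h.
  have [B hB] := ux i.
  have sc s : 0 <= s -> sq (x i) s (x i) := @sq_center _ (x i) s.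
  exists (C1 + (B + C)) => n; rewrite EvE asboolT//.
  have := h1 n _ (sc _ (lexx 0)); rewrite affineB => b1.
  have b2 := hB n; have b3 := hC n _ (sc _ (ltW r0)).
  move: b1 b2 b3; move: (affine _ _) (affine _ _) (u _ _) => p q s.
  by move=> /ler_normlP[? ?] /ler_normlP[? ?] /ler_normlP[? ?]; apply/ler_normlP; split; lra.
exists (fun n z => affine (be (rep z) n) z); split.
- move=> n z Oz; have [r r0 [rO hr]] := eqv_near z Oz.
  exists r, (be (rep z) n); split; [exact: r0|exact: rO|].
  by move=> y /hr /rep_eq e; rewrite e; exact: erefl.
- move=> n i; have /asboolP h := eqv_sym _ _ (repP _ (Ox i)).
  have := EvE (rep (x i)) (be (rep (x i)) n) i.
  by rewrite be0 mxE h => <-; exact: erefl.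
move=> z Oz; have [r r0 [rO hr]] := eqv_near z Oz.
have [s [C [s0 sO hC]]] := hA z Oz.
have [C1 h1] := rbdd_affine z r (repP z Oz).
have [C2 h2] := rbdd_affine z r (bD (rep z)).
exists (Num.min r s), (C + (C1 + C2)).
have mr : Num.min r s <= r by rewrite ge_min lexx.
have ms : Num.min r s <= s by rewrite ge_min lexx orbT.
split; [by rewrite lt_min r0|exact: subset_trans (sqS mr) rO|].
move=> n y hy; rewrite -(rep_eq _ _ (hr y (sqS mr hy))).
have := h1 n y (sqS mr hy); have := h2 n y (sqS mr hy); have := hC n y (sqS ms hy).
rewrite !affineB; move: (affine _ _) (affine _ _) (affine _ _) (u _ _) => p q k v.
by move=> /ler_normlP[? ?] /ler_normlP[? ?] /ler_normlP[? ?]; apply/ler_normlP; split; lra.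
Qed.

End normalisation.

(** * Ultrafilter limits of forms *)

Section ultralimits.
Context {R : realType}.
Local Notation T2 := (R * R)%type.
Local Notation TM := (measurableTypeR R * measurableTypeR R)%type.
Local Notation mu := (@lebesgue2 R).
Implicit Types (a : nat -> R) (z x y : T2) (K A Omega : set T2) (h : T2 -> R).

(** The limit is the supremum of the t with t <= a_n on a set of the ultrafilter; for a larger
    threshold the complementary set belongs to the ultrafilter. *)
Lemma ultra_cvg (U : set_system nat) a : UltraFilter U -> bdd a ->
  exists l : R, a n @[n --> U] --> l.
Proof.
move=> UU [C hC].
pose S : set R := [set t | U [set n | t <= a n]].
have CS : S (- C).
  by apply: filterE => n /=; have := hC n; rewrite ler_norml => /andP[].
have ubS : ubound S C.
  move=> t /filter_ex [n /= tn]; apply: le_trans tn _.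
  by have := hC n; rewrite ler_norml => /andP[].
have hs : has_sup S by split; [exists (- C)|exists C].
exists (sup S); apply/cvgrPdist_lt => e e0.
have [t St lt] := sup_adherent e0 hs.
have nS : ~ S (sup S + e).
  by move=> h; have := ub_le_sup hs.2 h; rewrite gerDl leNgt e0.
have [//|h2] := in_ultra_setVsetC [set n | sup S + e <= a n] UU.
apply: filterS2 St h2 => n /= h1 /negP; rewrite -ltNge => h3.
by rewrite ltr_norml; apply/andP; split; lra.
Qed.

Section limits.
Variables (P : Type) (F : set_system P).
Context {FF : ProperFilter F}.

Lemma cvg_le_bound (a : P -> R) l B : a n @[n --> F] --> l -> (forall n, a n <= B) -> l <= B.
Proof.
move=> al aB; apply/ler_addgt0Pr => e e0.
have /filter_ex [n hn] : \forall n \near F, `|l - a n| < e by move/cvgrPdist_lt : al; apply.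
by move: hn (aB n); move: (a n) => t /ltr_normlP[? ?] ?; lra.
Qed.

Lemma near_ord N (Q : 'I_N -> P -> Prop) : (forall i, \forall n \near F, Q i n) ->
  \forall n \near F, forall i, Q i n.
Proof.
move=> h; suff : forall s : seq 'I_N, \forall n \near F, forall i, i \in s -> Q i n.
  by move=> /(_ (enum 'I_N)); apply: filterS => n hn i; apply: hn; rewrite mem_enum.
elim=> [|j s IH]; first exact: filterE.
apply: filterS2 (h j) IH => n hj hs i; rewrite in_cons => /predU1P[->|]; first exact: hj.
exact: hs.
Qed.

Lemma cvg_sum_ord N (a : 'I_N -> P -> R) (l : 'I_N -> R) :
  (forall i, a i n @[n --> F] --> l i) -> \sum_i a i n @[n --> F] --> \sum_i l i.
Proof.
move=> h; elim: (index_enum _) => [|i s IH].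
  by rewrite big_nil; under eq_fun do rewrite big_nil; exact: cvg_cst.
by rewrite big_cons; under eq_fun do rewrite big_cons; exact: cvgD (h i) IH.
Qed.

End limits.

Variables (Omega : set T2) (g : nat -> T2 -> R) (E : R).
Hypothesis oO : open Omega.
Hypothesis cg : forall n, {in Omega, continuous (g n)}.
Hypothesis hg : forall n, hessian_bound Omega (ipair Omega (g n)) E.
Hypothesis bg : forall z, Omega z -> exists r C, [/\ 0 < r, sq z r `<=` Omega &
  forall n y, sq z r y -> `|g n y| <= C].

Let Lg n : L1loc Omega (g n) := continuous_L1loc oO (@cg n).

Lemma compact_bdd K : compact K -> K `<=` Omega ->
  exists C, 0 <= C /\ forall n z, K z -> `|g n z| <= C.
Proof.
move=> cK KO; pose D (p : T2 * R) := exists C, forall n y, sq p.1 p.2 y -> `|g n y| <= C.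
have [|l [Dl hl]] := @compact_sq_cover R K D cK.
  by move=> z Kz; have [r [C [r0 _ hC]]] := bg (KO z Kz); exists r; split => //; exists C.
have [C [C0 hC]] : exists C, 0 <= C /\ forall p, p \in l -> forall n y, sq p.1 p.2 y -> `|g n y| <= C.
  elim: l Dl {hl} => [|p l IH] Dl; first by exists 0.
  have [|C [C0 hC]] := IH; first by move=> q ql; apply: Dl; rewrite in_cons ql orbT.
  have [D0 hD] := Dl p (mem_head _ _).
  exists (Num.max C D0); split; first by rewrite le_max C0.
  move=> q; rewrite in_cons => /predU1P[->|ql] n y hy; rewrite le_max.
    by rewrite (hD n y hy) orbT.
  by rewrite (hC q ql n y hy).
by exists C; split => // n z /hl [p pl sz]; exact: hC pl n z sz.
Qed.

Lemma pairing_ubnd K : compact K -> K `<=` Omega -> exists2 C, 0 <= C &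
  forall n h s, continuous h -> (forall z, ~ K z -> h z = 0) ->
    (forall z, `|h z| <= s) -> `|ipair Omega (g n) h| <= C * s.
Proof.
move=> cK KO; have [C [C0 hC]] := compact_bdd cK KO.
have mK : measurable (K : set TM) := compact_measurableT2 cK.
have i1 : mu.-integrable (K : set TM) (EFin \o (fun=> C)).
  apply/integrableP; split; first exact/measurable_EFinP/measurable_cst.
  apply: (@le_lt_trans _ _ (\int[mu]_(z in K) (cst `|C|%:E) z)%E); first exact: lexx.
  by rewrite integral_cst//; apply: lte_mul_pinfty => //; exact: compact_finite_measure.
exists (\int[mu]_(z in K) C); first exact: Rintegral_ge0.
move=> n h s ch h0 hs.
have s0 : 0 <= s by apply: le_trans (hs 0).
have mh : measurable_fun (K : set TM) h := measurable_funTS (continuous_measurableT2T ch).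
apply: (le_trans (pairing_bound oO (Lg n) cK KO mh h0 (fun z _ => hs z))).
apply: (ler_wpM2r s0); apply: (le_Rintegral mK) => //.
  exact: (integrable_abse (L1loc_integrable oO (Lg n) cK KO)).
by move=> z Kz; exact: hC.
Qed.

Variable U : set_system nat.
Hypothesis UU : UltraFilter U.

(** A single ultrafilter makes the pairings with all test functions converge simultaneously. Off the
    test functions of Omega the limit may fail to exist and the value is arbitrary. *)
Definition ulim_form h : R := lim (ipair Omega (g n) h @[n --> U]).

Lemma ulim_form_cvg h : testfun Omega h -> ipair Omega (g n) h @[n --> U] --> ulim_form h.
Proof.
move=> th; have [ch [K [cK KO hK]]] := th.
have [C C0 hC] := pairing_ubnd cK KO; have [s s0 hs] := testfun_bounded th.
have [|l hl] := @ultra_cvg U (fun n => ipair Omega (g n) h) UU.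
  by exists (C * s) => n; exact: hC.
by rewrite /ulim_form; apply/cvg_ex; exists l.
Qed.

Lemma testform_ulim : testform Omega ulim_form.
Proof.
split.
  move=> a h k th tk; have tl := testfunD (testfunZ a th) tk.
  have h1 := ulim_form_cvg tl.
  have h2 : ipair Omega (g n) (fun z => a * h z + k z) @[n --> U] --> a * ulim_form h + ulim_form k.
    under eq_fun do rewrite (tf_lin (testform_ipair oO (Lg _)) a th tk).
    by apply: cvgD; [apply: cvgMl_tmp; exact: ulim_form_cvg|exact: ulim_form_cvg].
  exact: (cvg_unique (@Rhausdorff R) h1 h2).
move=> K cK KO; have [C C0 hC] := pairing_ubnd cK KO; exists C => // h s ch h0 hs.
have th : testfun Omega h by split => //; exists K.
have h1 : `|ipair Omega (g n) h| @[n --> U] --> `|ulim_form h|.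
  by apply: cvg_norm; exact: ulim_form_cvg.
by apply: (cvg_le_bound h1) => n; exact: hC.
Qed.

Lemma hessian_bound_ulim : hessian_bound Omega ulim_form E.
Proof.
move=> F s tF hF; apply: (cvg_le_bound (ulim_form_cvg (dd_testfun tF))) => n.
exact: hg.
Qed.

Lemma pval_ulim_pairing phi : testfun Omega phi ->
  ipair Omega (pval Omega ulim_form) phi = ulim_form phi.
Proof.
exact: (pval_pairing oO testform_ulim hessian_bound_ulim Lg pairing_ubnd ulim_form_cvg).
Qed.

End ultralimits.

(** * Insertion of kernels into a test field *)

Section kernel_insertion.
Context {R : realType}.
Local Notation T2 := (R * R)%type.
Implicit Types (z y : T2) (K A Omega : set T2) (h : T2 -> R) (F G : T2 -> 'M[R]_2).

Lemma smooth_prod (J : Type) (s : seq J) (f : J -> T2 -> R) : (forall i, smooth (f i)) ->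
  smooth (fun z => \prod_(i <- s) f i z).
Proof.
move=> sf; elim: s => [|i s IH].
  by rewrite (_ : (fun z => _) = fun=> 1); [exact: smooth_cst|apply: funext => z; rewrite big_nil].
rewrite (_ : (fun z => _) = fun z => f i z * \prod_(j <- s) f j z); first exact: smoothM.
by apply: funext => z; rewrite big_cons.
Qed.

Lemma tfield_sum (J : Type) (s : seq J) A (G : J -> T2 -> 'M[R]_2) : (forall i, tfield A (G i)) ->
  tfield A (fun z => \sum_(i <- s) G i z).
Proof.
move=> tG; elim: s => [|i s IH].
  rewrite (_ : (fun z => _) = fun=> 0); last by apply: funext => z; rewrite big_nil.
  split; first exact: smooth_field_cst.
  by exists set0; split => //; exact: compact0.
rewrite (_ : (fun z => _) = fun z => G i z + \sum_(j <- s) G j z); first exact: tfieldD.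
by apply: funext => z; rewrite big_cons.
Qed.

Lemma tf_dd_sum (J : Type) (s : seq J) Omega I (a : J -> R) (G : J -> T2 -> 'M[R]_2) :
  testform Omega I -> (forall i, tfield Omega (G i)) ->
  I (dd (fun z => \sum_(i <- s) a i *: G i z)) = \sum_(i <- s) a i * I (dd (G i)).
Proof.
move=> tI tG; elim: s => [|i s IH].
  rewrite (_ : (fun z => _) = fun=> 0); last by apply: funext => z; rewrite big_nil.
  by rewrite dd0 (tf0 tI) big_nil.
rewrite (_ : (fun z => _) = fun z => a i *: G i z + \sum_(j <- s) a j *: G j z); last first.
  by apply: funext => z; rewrite big_cons.
have ta j : tfield Omega (fun z => a j *: G j z) := tfieldZ (smooth_cst _) (tG j).
rewrite big_cons -IH.
exact: etrans (tf_ddD tI (ta i) (tfield_sum s ta)) (congr1 (+%R^~ _) (tf_ddZ tI (a i) (tG i))).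
Qed.

#[local] Transparent kerA kerB qden.

Lemma ker_unit y (e : R) z : e != 0 -> kerA y e z ^+ 2 + kerB y e z ^+ 2 <= 1.
Proof.
move=> e0; have q0 := qden_neq0 y z e0; have qp := qden_ge0 y e z.
have -> : kerA y e z ^+ 2 + kerB y e z ^+ 2 =
    (((z.1 - y.1) ^+ 2 + (z.2 - y.2) ^+ 2) * (qden y e z)^-1) ^+ 2.
  by rewrite /kerA /kerB; ring.
have s0 : 0 <= (z.1 - y.1) ^+ 2 + (z.2 - y.2) ^+ 2 := addr_ge0 (sqr_ge0 _) (sqr_ge0 _).
apply: exprn_ile1; first by rewrite mulr_ge0 ?invr_ge0.
by rewrite ler_pdivrMr ?lt0r ?q0// mul1r /qden lerDl sqr_ge0.
Qed.

#[local] Opaque kerA kerB qden.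

Variables (Omega : set T2) (p : \bar R) (N : nat) (x : 'I_N -> T2).
Hypothesis oO : open Omega.
Hypothesis p1 : (1 <= p)%E.
Hypothesis Ox : forall i, Omega (x i).

(** The factor vanishes on the squares of radius d around the data points and is 1 off the squares
    of radius 2d. *)
Definition removed d F z := (\prod_(i < N) (1 - cut (x i) d z)) *: F z.

Lemma smooth_removal d : smooth (fun z => \prod_(i < N) (1 - cut (x i) d z)).
Proof. by apply: smooth_prod => i; apply: smoothB; [exact: smooth_cst|exact: smooth_cut]. Qed.

Lemma removal_ge0_le1 d z : 0 <= \prod_(i < N) (1 - cut (x i) d z) <= 1.
Proof.
have c01 i : 0 <= 1 - cut (x i) d z <= 1 by rewrite subr_ge0 cut_le1 lerBlDr lerDl cut_ge0.
elim: (index_enum _) => [|i s /andP[h1 h2]]; first by rewrite big_nil ler01 lexx.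
have /andP[h3 h4] := c01 i; rewrite big_cons mulr_ge0//=.
by rewrite -[leRHS]mul1r; apply: ler_pM.
Qed.

Variables (d : R) (sg : 'I_N -> R).
Hypothesis d0 : 0 < d.
Hypothesis dO : forall i, sq (x i) d `<=` Omega.
Hypothesis dsep : forall i j z, sq (x i) d z -> sq (x j) d z -> i = j.
Hypothesis sg1 : forall i, `|sg i| <= 1.

Let d2 : 0 < d / 2. Proof. by rewrite divr_gt0. Qed.
Let dd2 : 2 * (d / 2) = d. Proof. by field. Qed.

Definition inserted e F z := removed d F z +
  \sum_(i < N) (kernel_weight p * sg i) *: (cut (x i) (d / 2) z *: ker (x i) e z).

Lemma tfield_inserted_ker e i : e != 0 ->
  tfield Omega (fun z => cut (x i) (d / 2) z *: ker (x i) e z).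
Proof.
move=> e0; apply: tfield_cut => //; last exact: smooth_ker.
by rewrite dd2.
Qed.

(** The kernels live in the squares of radius d, which are disjoint and on which [removed] vanishes.
    At each point the field is therefore one weighted kernel or a multiple of [F] with a factor in
    [0, 1], never a proper sum. *)
Lemma admissible_inserted e F : e != 0 -> admissible p Omega F ->
  admissible p Omega (inserted e F).
Proof.
move=> e0 [tF hF]; have p1' := hoelder_conj_ge1 p1; split.
  apply: tfieldD; first exact: tfieldZ (smooth_removal d) tF.
  apply: tfield_sum => i; apply: tfieldZ; first exact: smooth_cst.
  exact: tfield_inserted_ker.
move=> z; rewrite /inserted /removed.
have k0 i : ~ sq (x i) d z -> cut (x i) (d / 2) z = 0.
  by move=> h; apply: cut_eq0 => //; rewrite dd2.
have [[i iz]|ni] := pselect (exists i, sq (x i) d z).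
  rewrite (bigD1 i)//= (cut_eq1 d0 iz) subrr mul0r scale0r add0r.
  rewrite (bigD1 i)//= big1 ?addr0; last first.
    move=> j ji; rewrite k0 ?scale0r ?scaler0// => jz.
    by move: ji; rewrite (dsep iz jz) eqxx.
  rewrite kerE scalerA -mulrA; apply: schatten_kernel => //; first exact: ker_unit.
  rewrite normrM -[leRHS]mul1r.
  exact: ler_pM (normr_ge0 _) (normr_ge0 _) (sg1 i) (cut_norm _ _ _).
rewrite [X in _ + X]big1 ?addr0; last first.
  by move=> i _; rewrite k0 ?scale0r ?scaler0// => iz; apply: ni; exists i.
by have /andP[h1 h2] := removal_ge0_le1 d z; exact: schatten_scale.
Qed.

(** The inserted field is admissible for every nonzero e. As e -> 0 its pairing tends to the
    left-hand side, because by [dd_ker_limit] each kernel contributes a point value and a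
    remainder. *)
Lemma insertion_bound I E v F : testform Omega I -> hessian_bound Omega I E ->
  (forall G, admissible p Omega G -> I (dd G) <= v) -> admissible p Omega F ->
  I (dd (removed d F)) + \sum_(i < N) kernel_weight p * sg i *
    (4 * pi * pval Omega I (x i) + I (kerrem (cut (x i) (d / 2)) (x i) 0)) <= v.
Proof.
move=> tI hE hv aF; have [tF _] := aF.
have fin (a S T U b c : R) : a + T <= b -> S <= T + U -> U <= c -> a + S <= b + c.
  by move=> *; lra.
have w0 := kernel_weight_ge0 p.
set S := \sum_(i < N) _.
have aux (k t a b m : R) : 0 <= k -> `|t| <= 1 -> `|a - b| <= m -> k * t * b <= k * t * a + k * m.
  move=> k0 t1 abm; rewrite -!(mulrA k) -mulrDr; apply: (ler_wpM2l k0).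
  have : `|t * (a - b)| <= 1 * m.
    by rewrite normrM; exact: ler_pM (normr_ge0 _) (normr_ge0 _) t1 abm.
  by rewrite mulrBr mul1r => /ler_normlP[? ?]; lra.
apply/ler_addgt0Pr => c c0.
(* With tolerance c/B the N errors, each multiplied by the kernel weight, sum to at most c. *)
pose B := kernel_weight p * N%:R + 1.
have B0 : 0 < B by rewrite ltr_wpDl// mulr_ge0.
have cB : 0 < c / B by rewrite divr_gt0.
have [e [e0 he]] : exists e : R, e != 0 /\ forall i : 'I_N,
    `|I (dd (fun z => cut (x i) (d / 2) z *: ker (x i) e z)) -
      (4 * pi * pval Omega I (x i) + I (kerrem (cut (x i) (d / 2)) (x i) 0))| <= c / B.
  apply: (@filter_ex _ 0^'+); near=> e; split.
    by rewrite gt_eqF//; near: e; exact: nbhs_right_gt.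
  near: e; apply: near_ord => i.
  have hc : cutoff Omega (x i) (cut (x i) (d / 2)).
    by apply: cutoff_cut => //; [rewrite dd2|exact: osq_center].
  have [r [r0 hr]] := dd_ker_limit oO tI hE (Ox i) hc cB.
  near=> e; apply: hr.
    by rewrite gt_eqF//; near: e; exact: nbhs_right_gt.
  have ep : 0 < e by near: e; exact: nbhs_right_gt.
  by rewrite gtr0_norm//; near: e; exact: nbhs_right_le.
have tr : tfield Omega (removed d F) := tfieldZ (smooth_removal d) tF.
have tk i := tfield_inserted_ker i e0.
have ta i : tfield Omega (fun z => (kernel_weight p * sg i) *: (cut (x i) (d / 2) z *: ker (x i) e z)).
  exact: tfieldZ (smooth_cst _) (tk i).
have e1 : I (dd (inserted e F)) = I (dd (removed d F)) + \sum_(i < N) kernel_weight p * sg i *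
     I (dd (fun z => cut (x i) (d / 2) z *: ker (x i) e z)).
  exact: (etrans (tf_ddD tI tr (tfield_sum (index_enum 'I_N) ta))
    (congr1 (+%R _) (tf_dd_sum (index_enum 'I_N) (fun i => kernel_weight p * sg i) tI tk))).
have h := eq_ind _ (fun t => t <= v) (hv _ (admissible_inserted e0 aF)) _ e1.
have hS : S <= \sum_(i < N) kernel_weight p * sg i *
     I (dd (fun z => cut (x i) (d / 2) z *: ker (x i) e z)) + \sum_(i < N) kernel_weight p * (c / B).
  rewrite -big_split /=; apply: ler_sum => i _; exact: (aux _ _ _ _ _ w0 (sg1 i) (he i)).
have cc : \sum_(i < N) kernel_weight p * (c / B) <= c.
  rewrite sumr_const card_ord -mulr_natr mulrAC -[leRHS](divfK (lt0r_neq0 B0)) mulrC.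
  by apply: ler_wpM2l; [exact: ltW|rewrite lerDl].
exact: (fin _ _ _ _ _ _ h hS cc).
Unshelve. all: by end_near.
Qed.

End kernel_insertion.

(** * Lower semicontinuity with the price of the jumps *)

Section semicontinuity.
Context {R : realType}.
Local Notation T2 := (R * R)%type.
Implicit Types (z y : T2) (K A Omega : set T2) (h f : T2 -> R) (F G : T2 -> 'M[R]_2).

Lemma pval_pairing_self Omega f E : open Omega -> L1loc Omega f ->
  hessian_bound Omega (ipair Omega f) E ->
  forall phi, testfun Omega phi -> ipair Omega (pval Omega (ipair Omega f)) phi = ipair Omega f phi.
Proof.
move=> oO Lf hE; have tI := testform_ipair oO Lf.
apply: (@pval_pairing _ _ _ E oO tI hE nat \oo (fun=> f)) => //.
  by move=> K cK KO; have [C C0 hC] := tf_bnd tI cK KO; exists C.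
by move=> h _; exact: cvg_cst.
Qed.

Lemma representative_refl Omega f : {in Omega, continuous f} -> is_continuous_representative Omega f f.
Proof. by move=> cf; split => //; exact: aeW. Qed.

Lemma pval_continuous_eq Omega f E x : open Omega -> {in Omega, continuous f} ->
  hessian_bound Omega (ipair Omega f) E -> Omega x -> pval Omega (ipair Omega f) x = f x.
Proof.
move=> oO cf hE; have Lf := continuous_L1loc oO cf.
exact: (representative_unique oO (pval_representative oO Lf hE) (representative_refl cf)).
Qed.

Lemma tfield_entries_bounded A F : tfield A F -> exists2 s, 0 <= s & entries_le F s.
Proof.
move=> [sF [K [cK KA hK]]].
have te i j : exists s, 0 <= s /\ forall z, `|F z i j| <= s.
  have [|s s0 hs] := @testfun_bounded R A (fun z => F z i j).
    split; first exact: (smooth_continuous (sF i j)).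
    by exists K; split => // z /hK ->; rewrite mxE.
  by exists s.
have [a [a0 ha]] := te o0 o0; have [b [b0 hb]] := te o0 o1.
have [c [c0 hc]] := te o1 o0; have [e [e0 he]] := te o1 o1.
exists (a + b + c + e); first by rewrite !addr_ge0.
by move=> z; apply: ord2_ind; apply: ord2_ind;
  [have := ha z|have := hb z|have := hc z|have := he z]; lra.
Qed.

(** The factors 1 - cut are applied one at a time. Each of them subtracts a field supported in one
    small square with entries at most s, at a cost of at most c. *)
Lemma removed_close Omega I N (x : 'I_N -> T2) d c s F : testform Omega I -> 0 < d -> 0 <= s ->
  tfield Omega F -> entries_le F s -> (forall i, sq (x i) (2 * d) `<=` Omega) ->
  (forall i G, tfield (sq (x i) (2 * d)) G -> entries_le G s -> I (dd G) <= c) ->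
  I (dd F) <= I (dd (removed x d F)) + N%:R * c.
Proof.
have stp (a b t m : R) : a <= b + m -> t <= c -> a <= b - t + (m + c).
  by move=> h1 h2; rewrite addrACA -[leLHS]addr0; apply: lerD => //; rewrite addrC subr_ge0.
move=> tI d0 s0 tF hF xO hc.
pose Rl (l : seq 'I_N) z := (\prod_(i <- l) (1 - cut (x i) d z)) *: F z.
have sl l : smooth (fun z => \prod_(i <- l) (1 - cut (x i) d z)).
  by apply: smooth_prod => i; exact: smoothB (smooth_cst _) (smooth_cut _ _).
have tl l : tfield Omega (Rl l) := tfieldZ (sl l) tF.
have nl (l : seq 'I_N) z : `|\prod_(i <- l) (1 - cut (x i) d z)| <= 1.
  elim: l => [|i l IH]; first by rewrite big_nil normr1.
  rewrite big_cons normrM -[leRHS]mul1r.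
  exact: ler_pM (normr_ge0 _) (normr_ge0 _) (onem_cut_norm _ _ _) IH.
have aux (a b t : R) : `|a| <= 1 -> `|b| <= 1 -> `|a * (b * t)| <= `|t|.
  move=> a1 b1; rewrite mulrA normrM ler_piMl// normrM -[leRHS]mul1r.
  exact: ler_pM (normr_ge0 _) (normr_ge0 _) a1 b1.
have key (l : seq 'I_N) : I (dd F) <= I (dd (Rl l)) + (size l)%:R * c.
  elim: l => [|i l IH].
    rewrite mul0r addr0 (_ : Rl [::] = F) ?lexx//.
    by apply: funext => z; rewrite /Rl big_nil scale1r.
  have tc : tfield (sq (x i) (2 * d)) (fun z => cut (x i) d z *: Rl l z).
    by apply: tfield_cut => //; case: (tl l).
  have ec : entries_le (fun z => cut (x i) d z *: Rl l z) s.
    move=> z j k; rewrite !mxZE.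
    exact: le_trans (aux _ _ _ (cut_norm _ _ _) (nl l z)) (hF z j k).
  have E1 : Rl (i :: l) = fun z => Rl l z - cut (x i) d z *: Rl l z.
    by apply: funext => z; rewrite /Rl big_cons -scalerA scalerBl scale1r.
  have e1 := tf_ddB tI (tl l) (tfieldS (xO i) tc).
  have h1 := hc i _ tc ec.
  have e2 : I (dd (Rl l)) - I (dd (fun z => cut (x i) d z *: Rl l z)) <= I (dd (Rl (i :: l))).
    exact: (eq_ind _ (fun t => _ <= t) (lexx _) _ (esym (etrans (congr1 (fun G => I (dd G)) E1) e1))).
  have e3 : (size (i :: l))%:R * c = (size l)%:R * c + c by rewrite /= -natr1 mulrDl mul1r.
  rewrite e3; exact: (le_trans (stp _ _ _ _ IH h1) (lerD e2 (lexx _))).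
have := key (index_enum 'I_N).
have -> : size (index_enum 'I_N) = N by rewrite -sum1_size big_const_ord iter_addn_0 mul1n.
exact: id.
Qed.

Lemma separation N (x : 'I_N -> T2) : injective x ->
  \forall d \near (0 : R)^'+, forall i j z, sq (x i) d z -> sq (x j) d z -> i = j.
Proof.
move=> xi; apply: near_ord => i; apply: near_ord => j.
have [->|ij] := eqVneq i j; first by near=> d.
have [e e0 he] : exists2 e, 0 < e & (e <= `|(x i).1 - (x j).1| \/ e <= `|(x i).2 - (x j).2|).
  have [h|h] := eqVneq (x i).1 (x j).1; last first.
    by exists `|(x i).1 - (x j).1|; [rewrite normr_gt0 subr_eq0|left].
  exists `|(x i).2 - (x j).2|; last by right.
  rewrite normr_gt0 subr_eq0; apply: contra_neq ij => h2; apply: xi.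
  by move: h h2; case: (x i) (x j) => [? ?] [? ?] /= -> ->.
have e2 : 0 < e / 2 by rewrite divr_gt0.
near=> d => z [a1 a2] [b1 b2]; exfalso.
have de : d < e / 2 by near: d; exact: nbhs_right_lt.
have tri (s t w : R) : `|w - s| <= d -> `|w - t| <= d -> `|s - t| < e.
  by move=> /ler_normlP[? ?] /ler_normlP[? ?]; apply/ltr_normlP; split; lra.
have t1 := tri _ _ _ a1 b1; have t2 := tri _ _ _ a2 b2.
by case: he => h; [have := le_lt_trans h t1|have := le_lt_trans h t2]; rewrite ltxx.
Unshelve. all: by end_near.
Qed.

Variables (Omega : set T2) (p : \bar R) (N : nat) (x : 'I_N -> T2).
Variables (g : nat -> T2 -> R) (E : R) (U : set_system nat).
Hypothesis oO : open Omega.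
Hypothesis p1 : (1 <= p)%E.
Hypothesis Ox : forall i, Omega (x i).
Hypothesis xi : injective x.
Hypothesis cg : forall n, {in Omega, continuous (g n)}.
Hypothesis hg : forall n, hessian_bound Omega (ipair Omega (g n)) E.
Hypothesis bg : forall z, Omega z -> exists r C, [/\ 0 < r, sq z r `<=` Omega &
  forall n y, sq z r y -> `|g n y| <= C].
Hypothesis UU : UltraFilter U.
Variables (v : nat -> R) (vl : R) (w : 'I_N -> R).
Hypothesis hv : forall n G, admissible p Omega G -> ipair Omega (g n) (dd G) <= v n.
Hypothesis vlim : v n @[n --> U] --> vl.
Hypothesis wlim : forall i, g n (x i) @[n --> U] --> w i.
Local Notation I := (ulim_form Omega g U).

(** The kernel at x_i carries the sign of the jump w_i - f(x_i), f being the point values of the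
    limit form. Tested against g_n it reads g_n(x_i), which tends to w_i, plus a remainder [H i].
    The remainder is a pairing with a fixed test function, so it passes to the limit form, where it
    is nearly -4 pi f(x_i). The two contributions add up to 4 pi times the jump. *)
Lemma lower_semicontinuity F : admissible p Omega F ->
  I (dd F) + 4 * pi * kernel_weight p * \sum_(i < N) `|w i - pval Omega I (x i)| <= vl.
Proof.
have fin (a b t m n1 n2 l e : R) : b + t - l <= 0 -> a <= b + n1 -> m <= t + n2 ->
  n1 + n2 <= e -> a + m <= l + e.
  by move=> *; lra.
move=> aF; have [tF _] := aF.
have tI : testform Omega I := testform_ulim oO cg bg UU.
have hE : hessian_bound Omega I E := hessian_bound_ulim oO cg hg bg UU.
have cvgI h : testfun Omega h -> ipair Omega (g n) h @[n --> U] --> I h :=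
  ulim_form_cvg oO cg bg UU (h := h).
have w0 := kernel_weight_ge0 p; set k := kernel_weight p in w0 *.
have [s s0 hs] := tfield_entries_bounded tF.
apply/ler_addgt0Pr => e e0.
(* The tolerance c has to cover N removals costing c s each and N remainders costing c times the
   kernel weight each. *)
pose B := N%:R * s + k * N%:R + 1.
have B0 : 0 < B by rewrite ltr_wpDl// addr_ge0// mulr_ge0.
pose c := e / B; have c0 : 0 < c by rewrite divr_gt0.
have [r hr] := choice (fun i => no_atom oO tI hE (Ox i) c0).
have [d [d0 [dr dsep]]] : exists d : R, 0 < d /\ ((forall i, 2 * d <= r i) /\
    forall i j z, sq (x i) d z -> sq (x j) d z -> i = j).
  apply: (@filter_ex _ 0^'+); near=> d; split; first by near: d; exact: nbhs_right_gt.
  split; last by near: d; exact: separation.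
  near: d; apply: near_ord => i; have [r0 _ _] := hr i.
  near=> d; rewrite mulrC -ler_pdivlMr//; near: d; apply: nbhs_right_le.
  by rewrite divr_gt0.
have d2d : d <= 2 * d by rewrite ler_pMl// ler1n.
have dd2 : 2 * (d / 2) = d by field.
have sub2 i : sq (x i) (2 * d) `<=` sq (x i) (r i) := sqS (dr i).
have sub1 i : sq (x i) d `<=` sq (x i) (r i) := subset_trans (sqS d2d) (@sub2 i).
have rO i : sq (x i) (r i) `<=` Omega by case: (hr i).
have small i G t : 0 <= t -> tfield (sq (x i) (r i)) G -> entries_le G t -> I (dd G) <= c * t.
  by case: (hr i) => _ _; apply.
pose f := pval Omega I; pose sg i := Num.sg (w i - f (x i)).
have sg1 i : `|sg i| <= 1 by rewrite /sg normr_sg; case: (_ != 0).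
pose H i := kerrem (cut (x i) (d / 2)) (x i) 0.
have d20 : 0 < d / 2 by rewrite divr_gt0.
have hc i : cutoff Omega (x i) (cut (x i) (d / 2)).
  apply: cutoff_cut => //; last exact: osq_center.
  by rewrite dd2; exact: subset_trans (@sub1 i) (@rO i).
have tH i : testfun Omega (H i) := testfun_kerrem0 (hc i).
have tr : tfield Omega (removed x d F) := tfieldZ (smooth_removal x d) tF.
have step1 : I (dd (removed x d F)) + \sum_(i < N) k * sg i * (4 * pi * w i + I (H i)) - vl <= 0.
  have dO i : sq (x i) d `<=` Omega := subset_trans (@sub1 i) (@rO i).
  have bnd n := insertion_bound oO p1 Ox d0 dO dsep sg1
    (testform_ipair oO (continuous_L1loc oO (@cg n))) (@hg n) (@hv n) aF.
  pose an n := ipair Omega (g n) (dd (removed x d F)) +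
    \sum_(i < N) k * sg i * (4 * pi * g n (x i) + ipair Omega (g n) (H i)) - v n.
  have ca : an n @[n --> U] -->
      I (dd (removed x d F)) + \sum_(i < N) k * sg i * (4 * pi * w i + I (H i)) - vl.
    apply: cvgB => //; apply: cvgD; first exact: cvgI (dd_testfun tr).
    apply: cvg_sum_ord => i; apply: cvgM; first exact: cvg_cst.
    apply: cvgD; last exact: cvgI (tH i).
    by apply: cvgM; [exact: cvg_cst|exact: wlim].
  apply: (cvg_le_bound ca) => n; rewrite /an subr_le0; apply: le_trans (bnd n).
  rewrite lerD2l; apply: ler_sum => i _.
  by rewrite (pval_continuous_eq oO (@cg n) (@hg n) (Ox i)).
have step2 : I (dd F) <= I (dd (removed x d F)) + N%:R * (c * s).
  apply: (removed_close tI d0 s0 tF hs).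
    by move=> i; exact: subset_trans (@sub2 i) (@rO i).
  by move=> i G tG hG; apply: (small i) => //; exact: tfieldS (@sub2 i) tG.
(* The square around [x i] carries little of the Hessian of the limit form, so a kernel supported
   there has a small pairing: point value and remainder cancel up to c. *)
have step3 i : `|4 * pi * f (x i) + I (H i)| <= c.
  apply: (pval_estimate oO tI hE (Ox i) (hc i) (subset_trans (@sub1 i) (@rO i))).
    exists (sq (x i) d); split => //; first exact: sq_compact.
    by move=> z nz; apply: cut_eq0 => //; rewrite dd2.
  move=> G tG hG; rewrite -[leRHS]mulr1; apply: (small i) => //.
  exact: tfieldS (@sub1 i) tG.
have step4 : 4 * pi * k * \sum_(i < N) `|w i - f (x i)| <=
    \sum_(i < N) k * sg i * (4 * pi * w i + I (H i)) + N%:R * (k * c).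
  have -> : N%:R * (k * c) = \sum_(i < N) k * c by rewrite sumr_const card_ord mulr_natl.
  rewrite mulr_sumr -big_split /=; apply: ler_sum => i _.
  rewrite (normrEsg (w i - f (x i))) -/(sg i).
  have := step3 i; have := sg1 i; move: (I (H i)) (f (x i)) (w i) (sg i) (4 * pi) w0 => a b u t q.
  clear => k0 t1 h.
  have h2 : `|t * (q * b + a)| <= c.
    by rewrite normrM -[leRHS]mul1r; exact: ler_pM (normr_ge0 _) (normr_ge0 _) t1 h.
  have -> : q * k * (t * (u - b)) = k * t * (q * u + a) + k * - (t * (q * b + a)) by ring.
  by rewrite lerD2l; apply: (ler_wpM2l k0); move: h2 => /ler_normlP[].
have step5 : N%:R * (c * s) + N%:R * (k * c) <= e.
  rewrite (_ : _ + _ = c * (N%:R * s + k * N%:R)); last by ring.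
  rewrite -[leRHS](divfK (lt0r_neq0 B0)) -/c; apply: (ler_wpM2l (ltW c0)).
  by rewrite /B lerDl.
exact: (fin _ _ _ _ _ _ _ _ step1 step2 step4 step5).
Unshelve. all: by end_near.
Qed.

End semicontinuity.

(** * Existence of a minimiser *)

Section existence.
Context {R : realType}.
Local Notation T2 := (R * R)%type.
Implicit Types (z y : T2) (f g h b : T2 -> R) (F G : T2 -> 'M[R]_2).

Variables (Omega : set T2) (N : nat) (x : 'I_N -> T2) (y : 'I_N -> R).
Variables (p q : \bar R) (lambda : R).
Hypothesis oO : open Omega.
Hypothesis Ox : forall i, Omega (x i).
Hypothesis xi : injective x.
Hypothesis p1 : (1 <= p)%E.
Hypothesis q1 : (1 <= q)%E.
Hypothesis lambda0 : 0 <= lambda.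
Hypothesis lambda_le : lambda <= kernel_weight p * (4 * pi).

Local Notation V f := (hessian_schatten_variation p f Omega).
Local Notation Fl := (functionalF p q lambda Omega x y).

Definition misfit (u : 'I_N -> R) : R := lpnorm q (\row_i (u i - y i)).

Lemma misfit_add (u w : 'I_N -> R) : misfit w <= misfit u + \sum_i `|w i - u i|.
Proof.
have := lpnorm_add (\row_i (u i - y i)) (\row_i (w i - u i)) q1.
have -> : \row_i (u i - y i) + \row_i (w i - u i) = \row_i (w i - y i) :> 'rV[R]_N.
  by apply/rowP => i; rewrite !mxE; ring.
by congr (_ <= _ + _); apply: eq_bigr => i _; rewrite mxE.
Qed.

Lemma functional_ge0 g : L1loc Omega g -> (0 <= Fl g)%E.
Proof.
move=> Lg; rewrite /functionalF; case: ifP => // _; apply: adde_ge0; first exact: hsv_ge0.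
by rewrite lee_fin mulr_ge0// lpnorm_ge0.
Qed.

Lemma functional_finite g : L1loc Omega g -> (Fl g < +oo)%E ->
  exists v, [/\ 0 <= v, V g = v%:E &
    Fl g = (v + lambda * misfit (fun i => pval Omega (ipair Omega g) (x i)))%:E].
Proof.
move=> Lg; have V0 : (0 <= V g)%E := hsv_ge0 p1 oO Lg.
rewrite /functionalF; case: ifPn => // Vn _.
have Vf : V g \is a fin_num by rewrite ge0_fin_numE// lt_neqAle Vn leey.
have VE : V g = (fine (V g))%:E by rewrite fineK.
exists (fine (V g)); split => //; first by rewrite fine_ge0.
rewrite VE -EFinD /=; congr (_ + _ * lpnorm q _)%:E; apply/rowP => i; rewrite !mxE.
have hE : hessian_bound Omega (ipair Omega g) (4 * fine (V g)).
  by apply: (hsv_hessian_bound p1 oO Lg); rewrite -VE.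
by rewrite (continuous_representativeE oO (pval_representative oO Lg hE) (Ox i)).
Qed.

Lemma functional_le f v : {in Omega, continuous f} -> (V f <= v%:E)%E ->
  (Fl f <= (v + lambda * misfit (fun i => f (x i)))%:E)%E.
Proof.
move=> cf Vv; rewrite /functionalF; case: ifPn => [/eqP Voo|_].
  by move: Vv; rewrite Voo leye_eq.
rewrite EFinD; apply: leeD => //; rewrite lee_fin; apply: (ler_wpM2l lambda0).
rewrite /misfit (_ : (\row_i (f (x i) - y i)) =
  (\row_i (continuous_representative Omega f (x i) - y i)))//.
apply/rowP => i; rewrite !mxE.
by rewrite (continuous_representativeE oO (representative_refl cf) (Ox i)).
Qed.

Lemma zero_continuous : {in Omega, continuous (fun=> 0 : R)}.
Proof. by move=> z _; exact: cvg_cst. Qed.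

Lemma zero_L1loc : L1loc Omega (fun=> 0).
Proof. exact: continuous_L1loc oO zero_continuous. Qed.

Lemma zero_variation : (V (fun=> 0%R) <= 0%:E)%E.
Proof.
apply: (hsv_le oO zero_L1loc) => F [tF _]; rewrite /ipair /Rintegral.
by under eq_integral do rewrite mul0r; rewrite integral0.
Qed.

(** For lambda > 0 the fidelity term bounds the values at the x_i along a minimising sequence, as
    the normalisation requires. *)
Lemma minimizer_positive : 0 < lambda -> exists f, L1loc Omega f /\
  forall g, L1loc Omega g -> (Fl f <= Fl g)%E.
Proof.
have arith1 (a b c d l v' k mr : R) : a <= b + d -> l - v' < c -> k < c ->
  v' + b <= mr + k -> l + a <= mr + (2 * c + d) by move=> *; lra.
have arith2 (l a d f k mr : R) : l + a <= mr -> f <= a + d -> d <= k -> l - k + f <= mr.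
  by move=> *; lra.
move=> lp.
pose S := [set Fl g | g in [set g | L1loc Omega g]].
pose m := ereal_inf S.
have m_le g : L1loc Omega g -> (m <= Fl g)%E.
  by move=> Lg; apply: ereal_inf_lbound; exists g.
have m0 : (0 <= m)%E by apply: le_ereal_inf_tmp => _ [g Lg <-]; exact: functional_ge0.
have mf : m \is a fin_num.
  rewrite ge0_fin_numE//; apply: le_lt_trans (m_le _ zero_L1loc) _.
  by apply: le_lt_trans (functional_le zero_continuous zero_variation) _; rewrite ltry.
pose mr := fine m; have mE : m = mr%:E by rewrite fineK.
have mr0 : 0 <= mr by rewrite fine_ge0.
have minseq n : exists g, [/\ L1loc Omega g, (Fl g < +oo)%E & (Fl g <= (mr + n.+1%:R^-1)%:E)%E].
  have n0 : 0 < n.+1%:R^-1 :> R by rewrite invr_gt0.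
  have [_ [g Lg <-] hg] := lb_ereal_inf_adherent n0 mf.
  have {}hg : (Fl g < (mr + n.+1%:R^-1)%:E)%E by rewrite EFinD -mE.
  by exists g; split => //; [apply: lt_trans hg _; rewrite ltry|exact: ltW].
have [g hg] := choice minseq.
have Lg n : L1loc Omega (g n) by case: (hg n).
have [v hv] := choice (fun n => let: And3 L Foo _ := hg n in functional_finite L Foo).
pose u n := pval Omega (ipair Omega (g n)).
(* [mr + 1] bounds the variations of the whole sequence, and 4 is the factor of
   [hsv_hessian_bound]. *)
pose E := 4 * (mr + 1).
have tot n : v n + lambda * misfit (fun i => u n (x i)) <= mr + n.+1%:R^-1.
  by have [_ _ h] := hg n; have [_ _ e] := hv n; rewrite e lee_fin in h.
have inv1 n : n.+1%:R^-1 <= 1 :> R by rewrite invf_le1// ler1n.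
have mis0 w : 0 <= misfit w := lpnorm_ge0 _ _.
have v0 n : 0 <= v n by case: (hv n).
have v_le n : v n <= mr + 1.
  have h := mulr_ge0 lambda0 (mis0 (fun i => u n (x i))).
  by apply: (le_trans _ (le_trans (tot n) (lerD (lexx mr) (inv1 n)))); rewrite lerDl.
have hEg n : hessian_bound Omega (ipair Omega (g n)) E.
  apply: (hsv_hessian_bound p1 oO (Lg n)); have [_ -> _] := hv n.
  by rewrite lee_fin.
have tg n := testform_ipair oO (Lg n).
have cu n : {in Omega, continuous (u n)} := pval_continuous oO (tg n) (@hEg n).
have Lu n : L1loc Omega (u n) := continuous_L1loc oO (@cu n).
have ubx i : bdd (fun n => u n (x i)).
  exists ((mr + 1) / lambda + `|y i|) => n.
  have h1 : `|u n (x i) - y i| <= misfit (fun i => u n (x i)).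
    by have := lpnorm_entry (\row_j (u n (x j) - y j)) i q1; rewrite mxE.
  have h2 : misfit (fun i => u n (x i)) <= (mr + 1) / lambda.
    rewrite ler_pdivlMr// mulrC.
    by apply: (le_trans _ (le_trans (tot n) (lerD (lexx mr) (inv1 n)))); rewrite lerDr.
  rewrite -[u n (x i)](subrK (y i)); apply: le_trans (ler_normD _ _) _.
  by rewrite lerD2r; exact: le_trans h1 h2.
have uaff z : Omega z -> exists r C, [/\ 0 < r, sq z r `<=` Omega &
    forall n, exists al, forall y, sq z r y -> `|u n y - affine al y| <= C].
  move=> Oz; have [r [C [r0 C0 rO hC]]] := local_affine oO Oz.
  by exists r, (C * E); split => // n; exact: hC (tg n) (@hEg n).
have [b [lb bx ub]] := normalisation Ox ubx uaff.
(* Subtracting [b n] preserves the pairings with double divergences and the values at the x_i, hence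
   all bounds on both terms of the functional, and [w] is in addition locally bounded uniformly in
   n. *)
pose w n z := u n z - b n z.
have cb n : {in Omega, continuous (b n)} := locally_affine_continuous (lb n).
have cw n : {in Omega, continuous (w n)}.
  by move=> z Oz; apply: cvgB; [exact: cu|exact: cb].
have Lb n : L1loc Omega (b n) := continuous_L1loc oO (@cb n).
have dd_w n F : tfield Omega F -> ipair Omega (w n) (dd F) = ipair Omega (g n) (dd F).
  move=> tF; have tdF := dd_testfun tF.
  rewrite -(pval_pairing_self oO (Lg n) (@hEg n) tdF) -[RHS]subr0.
  rewrite -{1}(locally_affine_dd oO (lb n) tF) /ipair -RintegralB.
  - by apply: eq_Rintegral => z _; rewrite mulrBl.
  - exact: open_measurableT2.
  - exact: (testfun_integrable oO (Lu n) tdF).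
  - exact: (testfun_integrable oO (Lb n) tdF).
have hw n : hessian_bound Omega (ipair Omega (w n)) E.
  by move=> F s tF hF; rewrite dd_w//; exact: hEg.
have adw n G : admissible p Omega G -> ipair Omega (w n) (dd G) <= v n.
  move=> aG; rewrite dd_w; last by case: aG.
  by have := hsv_ub oO (Lg n) aG; have [_ -> _] := hv n; rewrite lee_fin.
have wx n i : w n (x i) = u n (x i) by rewrite /w bx subr0.
(* [U] contains every set that is eventual at infinity; this is what makes 1/(n+1) small along
   [U]. *)
have [U [UU Uoo]] := ultraFilterLemma (@eventually_filter).
have [vl hvl] : exists l : R, v n @[n --> U] --> l.
  by apply: ultra_cvg UU _; exists (mr + 1) => n; rewrite ger0_norm.
have hwl0 i : exists l : R, w n (x i) @[n --> U] --> l.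
  by apply: ultra_cvg UU _; have [C hC] := ubx i; exists C => n; rewrite wx; exact: hC.
have [wl hwl] := choice hwl0.
pose I := ulim_form Omega w U; pose f := pval Omega I.
have tI : testform Omega I := testform_ulim oO cw ub UU.
have hI : hessian_bound Omega I E := hessian_bound_ulim oO cw hw ub UU.
have cf : {in Omega, continuous f} := pval_continuous oO tI hI.
have Lf : L1loc Omega f := continuous_L1loc oO cf.
exists f; split => // g' Lg'.
apply: le_trans (m_le g' Lg').
pose D := \sum_(i < N) `|wl i - f (x i)|.
have D0 : 0 <= D by exact: sumr_ge0.
(* The variation of [f] falls below the limit of the variations by at least the price of the jumps,
   whose total size is [D]. *)
have Vf : (V f <= (vl - 4 * pi * kernel_weight p * D)%:E)%E.
  apply: (hsv_le oO Lf) => G aG; rewrite lerBrDr.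
  have := lower_semicontinuity oO p1 Ox xi cw hw ub UU adw hvl hwl aG.
  by rewrite (pval_ulim_pairing oO cw hw ub UU (dd_testfun aG.1)).
apply: le_trans (functional_le cf Vf) _; rewrite mE lee_fin.
(* This concerns the limits of the values, [vl] and [wl], for which the minimising property passes
   to the limit. The values of [f] itself are compared with [wl] afterwards, through [D]. *)
have limit : vl + lambda * misfit wl <= mr.
  have B0 : 0 < 2 + lambda * N%:R by rewrite ltr_wpDr// mulr_ge0.
  apply/ler_addgt0Pr => e e0; pose c := e / (2 + lambda * N%:R).
  have c0 : 0 < c by rewrite divr_gt0.
  have [n [h1 [h2 h3]]] : exists n, `|vl - v n| < c /\ ((forall i, `|wl i - w n (x i)| < c) /\
      n.+1%:R^-1 < c).
    apply: (@filter_ex _ U); apply: filterI; first by move/cvgrPdist_lt : hvl; apply.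
    apply: filterI; first by apply: near_ord => i; move/cvgrPdist_lt : (hwl i); apply.
    by apply: Uoo; exact: near_infty_natSinv_lt (PosNum c0).
  have h4 := misfit_add (fun i => u n (x i)) wl.
  have h5 : \sum_(i < N) `|wl i - u n (x i)| <= N%:R * c.
    rewrite (_ : N%:R * c = \sum_(i < N) c); last by rewrite sumr_const card_ord mulr_natl.
    by apply: ler_sum => i _; rewrite -wx ltW.
  have h6 : lambda * misfit wl <= lambda * misfit (fun i => u n (x i)) + lambda * N%:R * c.
    by rewrite -mulrA -mulrDr; apply: (ler_wpM2l lambda0); apply: le_trans h4 _; rewrite lerD2l.
  have h7 : 2 * c + lambda * N%:R * c = e by rewrite -mulrDl mulrC divfK// gt_eqF.
  have /ltr_normlP[_ h8] := h1; rewrite -h7.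
  exact: (arith1 _ _ _ _ _ _ _ _ h6 h8 h3 (tot n)).
have h1 := misfit_add wl (fun i => f (x i)).
have h2 : \sum_(i < N) `|f (x i) - wl i| = D by apply: eq_bigr => i _; rewrite distrC.
rewrite h2 in h1.
have h3 : lambda * misfit (fun i => f (x i)) <= lambda * misfit wl + lambda * D.
  by rewrite -mulrDr; apply: (ler_wpM2l lambda0).
(* Here the upper bound on lambda enters: the gain in variation outweighs the possible loss in
   fidelity. *)
have h4 : lambda * D <= 4 * pi * kernel_weight p * D.
  by apply: (ler_wpM2r D0); rewrite mulrC.
exact: (arith2 _ _ _ _ _ _ limit h3 h4).
Qed.

(** For lambda = 0 the values at the x_i of a minimising sequence are not controlled, but then the
    zero function attains the value 0. *)
Lemma minimizer : exists f, L1loc Omega f /\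
  forall g, L1loc Omega g -> (Fl f <= Fl g)%E.
Proof.
have [l0|ln] := eqVneq lambda 0; last by apply: minimizer_positive; rewrite lt0r ln.
exists (fun=> 0); split; first exact: zero_L1loc.
move=> g Lg; apply: le_trans (functional_le zero_continuous zero_variation) _.
have e : (0 + lambda * misfit (fun=> 0))%:E = 0%E by rewrite l0 mul0r addr0.
by rewrite e; exact: functional_ge0.
Qed.

End existence.

Theorem theorem4p1 (R : realType) (Omega : set (R * R)) (hOmega : open Omega)
  (N : nat) (x : 'I_N -> R * R) (hx : forall i, Omega (x i))
  (x_inj : injective x) (y : 'I_N -> R)
  (p q : \bar R) (hp : (1 <= p)%E) (hq : (1 <= q)%E)
  (lambda : R) (hlambda0 : 0 <= lambda)
  (hlambda : lambda <= 2 `^ (fine p^-1%E - 1) * (4 * pi)) :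
  exists f : R * R -> R, L1loc Omega f /\
    forall g : R * R -> R, L1loc Omega g ->
      (functionalF p q lambda Omega x y f <=
       functionalF p q lambda Omega x y g)%E.
Proof. exact: minimizer. Qed.
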